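(* Let $\xi$ be a non-degenerate real random variable with $\mathbf E\xi=0$ such that $\mathbf E e^{\delta|\xi|}<\infty$ for some $\delta>0$, and let $\sigma^2:=\mathbf E\xi^2$. Let $\xi_1,\xi_2,\dots$ be i.i.d. copies of $\xi$, $S_0:=0$, $S_k:=\xi_1+\dots+\xi_k$ for $k\ge1$, and let $x=x(n)$ be a sequence of positive constants with $$\frac{x}{\sqrt n}\to\infty,\qquad \frac xn\to0\qquad(n\to\infty).$$ Let $s_n=s_n(t)$, $t\ge0$, be the random continuous piecewise linear function going through the nodes $\left(\frac kn,\frac{S_k}{x}\right)$, $k=0,1,2,\dots$. Then $s_n$ satisfies the large deviation principle with speed $\frac{x^2}{n}$ in the space $(\mathbb C,\rho_\kappa)$ with $\kappa=0$ with rate function $$I_0(f)=\begin{cases}\displaystyle\frac1{2\sigma^2}\int_0^\infty (f'(t))^2\,dt, & f(0)=0,\ f\text{ absolutely continuous},\\ \infty,&\text{otherwise},\end{cases}$$ that is, for every measurable $B\subset\mathbb C$ $$\limsup_{n\to\infty}\frac n{x^2}\ln\mathbf P(s_n\in B)\le -I_0([B]),\qquad \liminf_{n\to\infty}\frac n{x^2}\ln\mathbf P(s_n\in B)\ge -I_0((B)).$$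
   Context: $\mathbb C$ is the space of continuous functions $f:[0,\infty)\to\mathbb R$ with $\rho_\kappa(f,g):=\sup_{t\ge0}\frac{|f(t)-g(t)|}{1+t^{1+\kappa}}$; here $\kappa=0$ ($\rho_\kappa$ may equal $+\infty$ for some pairs; the topology is the one generated by open balls of finite radius). $[B]$ and $(B)$ are the closure and interior of $B$ in $\rho_0$; measurable means Borel; $I_0(B):=\inf_{f\in B}I_0(f)$, $I_0(\emptyset):=\infty$. ''Rate function'' means good rate function: lower semicontinuous with values in $[0,\infty]$ and with compact level sets $\{I_0\le r\}$, $r\ge0$. ''Absolutely continuous'' means absolutely continuous on every bounded interval $[0,T]$. *)

(* Defs.v *)
From HB Require Import structures.
From mathcomp Require Import all_boot all_order all_algebra finmap.
From mathcomp Require Import all_classical all_reals all_analysis.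
Set Implicit Arguments.
Unset Strict Implicit.
Unset Printing Implicit Defensive.
Import Order.TTheory GRing.Theory Num.Theory.
Import numFieldNormedType.Exports.
Local Open Scope classical_set_scope.
Local Open Scope ring_scope.

(* A continuous function [0, +oo[ -> R is represented by its unique extension
   to R that is constant on ]-oo, 0]. *)
Record halfline_fun (R : realType) := HalflineFun {
  halfline_val :> R -> R;
  halfline_continuous : continuous halfline_val;
  halfline_lt0 : forall t, t < 0 -> halfline_val t = halfline_val 0 }.

Section rho.
Context {R : realType}.
Implicit Types (kappa t : R) (f g h : halfline_fun R).
Local Open Scope ereal_scope.

Definition rho kappa f g : \bar R :=
  ereal_sup [set (`|f t - g t| / (1 + t `^ (1 + kappa)))%:E | t in `[0%R, +oo[].

Let rho_ub kappa f g t : (0 <= t)%R ->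
  (`|f t - g t| / (1 + t `^ (1 + kappa)))%:E <= rho kappa f g.
Proof.
by move=> t0; apply: ereal_sup_ubound; exists t => //=; rewrite in_itv/= t0.
Qed.

Lemma rho_xx kappa f : rho kappa f f = 0.
Proof.
apply/eqP; rewrite eq_le; apply/andP; split.
  by apply: ge_ereal_sup => _ [t _ <-]; rewrite subrr normr0 mul0r.
by have := @rho_ub kappa f f 0%R (lexx _); rewrite subrr normr0 mul0r.
Qed.

Lemma rho_sym kappa f g : rho kappa f g = rho kappa g f.
Proof. by congr ereal_sup; apply: eq_imagel => t _; rewrite distrC. Qed.

Lemma rho_triangle kappa f g h : rho kappa f h <= rho kappa f g + rho kappa g h.
Proof.
apply: ge_ereal_sup => _ [t /= t0 <-]; rewrite in_itv/= andbT in t0.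
apply: (@le_trans _ _ ((`|f t - g t| / (1 + t `^ (1 + kappa)))%:E +
    (`|g t - h t| / (1 + t `^ (1 + kappa)))%:E)).
  rewrite -EFinD lee_fin -mulrDl ler_wpM2r ?ler_distD//.
  by rewrite invr_ge0 addr_ge0// powR_ge0.
by rewrite leeD// rho_ub.
Qed.

End rho.

(* An alias carrying kappa, so that each (possibly infinite) rho kappa induces
   its own topology. *)
Definition Cspace (R : realType) (kappa : R) := halfline_fun R.

Section Cspace_topology.
Context {R : realType} (kappa : R).
Notation C := (Cspace kappa).

Definition Cspace_ball (f : C) (e : R) : set C :=
  [set g : C | (rho kappa f g < e%:E)%E].

Let ball_center (f : C) (e : R) : 0 < e -> Cspace_ball f e f.
Proof. by move=> e0; rewrite /Cspace_ball /= rho_xx lte_fin. Qed.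

Let ball_sym (f g : C) (e : R) : Cspace_ball f e g -> Cspace_ball g e f.
Proof. by rewrite /Cspace_ball /= rho_sym. Qed.

Let ball_triangle (f g h : C) (e1 e2 : R) :
  Cspace_ball f e1 g -> Cspace_ball g e2 h -> Cspace_ball f (e1 + e2) h.
Proof.
rewrite /Cspace_ball /= => fg gh.
by apply: le_lt_trans (rho_triangle kappa f g h) _; rewrite EFinD lteD.
Qed.

HB.instance Definition _ := gen_eqMixin C.
HB.instance Definition _ := gen_choiceMixin C.
HB.instance Definition _ := hasNbhs.Build C (nbhs_ (entourage_ Cspace_ball)).
HB.instance Definition _ := @Nbhs_isPseudoMetric.Build R C
  (entourage_ Cspace_ball) erefl Cspace_ball ball_center ball_sym ball_triangle
  erefl.

End Cspace_topology.

Section large_deviations.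
Context {R : realType} {E : topologicalType}.
Local Open Scope ereal_scope.

Definition good_rate_function (I : E -> \bar R) :=
  [/\ forall f, 0 <= I f,
      lower_semicontinuous I &
      forall r : R, (0 <= r)%R -> compact [set f | I f <= r%:E]].

Definition rate_of (I : E -> \bar R) (B : set E) : \bar R :=
  ereal_inf [set I f | f in B].

(* p n B stands for the probability that the n-th random element is in B, and
   v is the speed. *)
Definition large_deviation_principle (p : nat -> set E -> \bar R) (v : nat -> R)
    (I : E -> \bar R) :=
  good_rate_function I /\
  forall B : set E, <<s open >> B ->
    limn_esup (fun n => (v n)^-1%:E * lne (p n B)) <= - rate_of I (closure B) /\
    - rate_of I (interior B) <= limn_einf (fun n => (v n)^-1%:E * lne (p n B)).

End large_deviations.

Definition absolutely_continuous {R : realType} (f : R -> R) :=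
  forall T : R, 0 < T -> forall e : R, 0 < e -> exists2 delta : R, 0 < delta &
    forall (m : nat) (a b : 'I_m -> R),
      (forall i, [/\ 0 <= a i, a i <= b i & b i <= T]) ->
      trivIset setT (fun i => `]a i, b i[%classic) ->
      \sum_i (b i - a i) < delta -> \sum_i `|f (b i) - f (a i)| < e.

Definition rate_I0 {R : realType} (sigma2 : R) (f : halfline_fun R) : \bar R :=
  if `[< f 0 = 0 /\ absolutely_continuous f >]
  then ((2 * sigma2)^-1%:E *
        \int[lebesgue_measure]_(t in `[0%R, +oo[) (derive1 f t ^+ 2)%:E)%E
  else +oo%E.

Section random_variables.
Context d (Omega : measurableType d) (R : realType) (P : probability Omega R).

Definition degenerate (X : {RV P >-> R}) :=
  exists c : R, {ae P, forall w, X w = c}.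

(* Only measurable A: P is unspecified on non-measurable sets. *)
Definition same_law (X Y : {RV P >-> R}) :=
  forall A : set R, measurable A -> P (X @^-1` A) = P (Y @^-1` A).

Definition mutually_independent (X : nat -> {RV P >-> R}) :=
  forall (J : {fset nat}) (A : nat -> set R),
    (forall j, j \in J -> measurable (A j)) ->
    P (\bigcap_(j in [set` J]) (X j @^-1` A j)) =
    (\prod_(j <- J) P (X j @^-1` A j))%E.

End random_variables.

Section interpolation.
Context {R : realType}.
Implicit Types (a : nat -> R) (t u : R).

(* On [k, k+1] this is the affine function from a k to a (k+1). *)
Definition interpolate a u :=
  let k := Num.truncn u in a k + (u - k%:R) * (a k.+1 - a k).

Let clamp u : R := Num.max 0 (Num.min 1 u).

Let clamp_continuous : continuous clamp.
Proof.
move=> u; apply: (@continuous_max _ _ (cst 0) (fun u => Num.min 1 u)).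
  exact: cst_continuous.
by apply: (@continuous_min _ _ (cst 1) id); [exact: cst_continuous|exact: cvg_id].
Qed.

Let interpolateE a u (N : nat) : 0 <= u < N%:R ->
  interpolate a u = a 0 + \sum_(k < N) (a k.+1 - a k) * clamp (u - k%:R).
Proof.
move=> /andP[u0 uN]; rewrite /interpolate; set m := Num.truncn u.
have /andP[mu um] : m%:R <= u < m.+1%:R by exact: truncn_itv.
have mN : (m < N)%N by rewrite truncn_lt_nat.
rewrite -(big_mkord xpredT (fun k => (a k.+1 - a k) * clamp (u - k%:R))).
rewrite (big_cat_nat (n := m)) ?(ltnW mN)//=.
have -> : \sum_(0 <= k < m) (a k.+1 - a k) * clamp (u - k%:R) = a m - a 0%N.
  rewrite -telescope_sumr//; apply: eq_big_nat => k /andP[_ km].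
  have ku : 1 <= u - k%:R.
    by rewrite lerBrDl (le_trans _ mu)// natr1 ler_nat.
  by rewrite /clamp (min_idPl ku) (max_idPr ler01) mulr1.
have -> : \sum_(m <= k < N) (a k.+1 - a k) * clamp (u - k%:R) =
    (a m.+1 - a m) * (u - m%:R).
  rewrite big_ltn// big_nat big1 => [|k /andP[mk _]].
    rewrite /clamp (min_idPr _); last by rewrite lerBlDl natr1 ltW.
    by rewrite (max_idPr _) ?subr_ge0// addr0.
  have uk : u - k%:R <= 0.
    by rewrite subr_le0 (le_trans (ltW um))// ler_nat.
  by rewrite /clamp (min_idPr (le_trans uk ler01)) (max_idPl uk) mulr0.
by rewrite addrA subrKC mulrC.
Qed.

Let interpolate_max_continuous a :
  continuous (fun u => interpolate a (Num.max 0 u)).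
Proof.
move=> u0; set N := (Num.truncn u0).+1.
have Nu0 : u0 < N%:R by exact: truncnS_gt.
have N0 : 0 < N%:R :> R by rewrite ltr0n.
pose g u := a 0 + \sum_(k < N) (a k.+1 - a k) * clamp (Num.max 0 u - k%:R).
have E u : u < N%:R -> interpolate a (Num.max 0 u) = g u.
  by move=> uN; apply: interpolateE; rewrite le_max lexx /= gt_max N0.
have gc : {for u0, continuous g}.
  apply: cvgD; first exact: cvg_cst.
  apply: (cvg_big (op := +%R)) => [|k _]; first exact: add_continuous.
  apply: cvgM; first exact: cvg_cst.
  apply: (@continuous_comp _ _ _ (fun u => Num.max 0 u - k%:R) clamp);
    last exact: clamp_continuous.
  apply: cvgB; last exact: cvg_cst.
  apply: (@continuous_max _ _ (cst 0) id); [exact: cst_continuous|exact: cvg_id].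
rewrite /continuous_at E//; apply: cvg_trans gc; apply: near_eq_cvg.
by near=> u; rewrite E//; near: u; exact: lt_nbhsl.
Unshelve. all: by end_near. Qed.

Let polygon_val a (n : nat) t := interpolate a (n%:R * Num.max 0 t).

Let polygon_continuous a n : continuous (polygon_val a n).
Proof.
have -> : polygon_val a n =
    (fun u => interpolate a (Num.max 0 u)) \o (fun t => n%:R * t).
  by apply/funext => t /=; rewrite /polygon_val maxr_pMr ?mulr0.
move=> t; apply: continuous_comp; last exact: interpolate_max_continuous.
exact: mulrl_continuous.
Qed.

Let polygon_lt0 a n t : t < 0 -> polygon_val a n t = polygon_val a n 0.
Proof. by move=> t0; rewrite /polygon_val maxxx (max_idPl (ltW t0)). Qed.

(* The piecewise linear function through the nodes (k / n, a k), for n > 0. *)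
Definition polygon a (n : nat) : halfline_fun R :=
  HalflineFun (@polygon_continuous a n) (@polygon_lt0 a n).

End interpolation.

Section random_walk.
Context d (Omega : measurableType d) (R : realType) (P : probability Omega R).

(* xis k is the (k+1)-st step of the walk. *)
Definition walk (xis : nat -> {RV P >-> R}) (k : nat) (w : Omega) : R :=
  \sum_(i < k) xis i w.

Definition walk_path (xis : nat -> {RV P >-> R}) (x : nat -> R) (n : nat)
    (w : Omega) : halfline_fun R :=
  polygon (fun k => walk xis k w / x n) n.

(* completed_measure_extension (mu := P) is the completion of P. It is needed
   because (C, rho_0) is not separable: paths lie in a separable subspace only
   almost surely, so that for a Borel set B the event below is in general
   P-measurable only up to a P-null set. *)
Definition walk_law (kappa : R) (xis : nat -> {RV P >-> R}) (x : nat -> R)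
    (n : nat) (B : set (Cspace kappa)) : \bar R :=
  completed_measure_extension (mu := P) [set w | B (walk_path xis x n w)].

End random_walk.

(* Main.v *)
Require Import Defs.
From HB Require Import structures.
From mathcomp Require Import all_boot all_order all_algebra finmap.
From mathcomp Require Import all_classical all_reals all_analysis.
From mathcomp Require Import measurable_realfun ring lra.
Set Implicit Arguments.
Unset Strict Implicit.
Unset Printing Implicit Defensive.
Import Order.TTheory GRing.Theory Num.Theory.
Import numFieldNormedType.Exports.
Local Open Scope classical_set_scope.
Local Open Scope ring_scope.

(** The path is compared with the polyline through finitely many block ends, and everything random
    is reduced to a few properties of one step, collected in [light_tailed]: the moment generating
    function is [phi l] = exp((sigma2/2 + o(1)) l^2), the step tilted by exp(l X) has mean [m l] =
    (sigma2 + o(1)) l, and the centred tilted steps are sub-Gaussian uniformly over small tilts. As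
    x/n tends to 0, only small tilts occur, and this is why the rate is the Gaussian one.

    Rate function. [energy_le f c] bounds the sums of (increment of f)^2 / length over disjoint
    intervals. By Riesz's theorem ([rate_I0P]) the level set of I_0 at r is the set of paths of
    energy at most 2 sigma2 r. One inclusion represents an absolutely continuous f as the integral
    of its derivative and uses Cauchy-Schwarz; the other applies Fatou's lemma to difference
    quotients. An energy bound gives a common 1/2-Hoelder modulus and growth at most sqrt(c t),
    negligible against the weight 1 + t, and it survives pointwise limits. An Arzela-Ascoli argument
    then gives [energy_level_compact].

    Upper bound ([walk_law_upper], [walk_law_upper_rate]). If r < I_0([B]), the level set at r is
    compact and lies at positive distance from B. Cut time into [mm] blocks of L steps, L of order
    n. A path in B either has a block polyline of energy above 2 sigma2 r, or moves too much inside
    a block, or grows too fast after the blocks. The last two events are negligible by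
    [line_crossing], Ottaviani's inequality on dyadic blocks. For the first, the block increments
    lie outside a ball, a finite grid of directions covers this region by half-spaces, and each
    half-space is handled by the exponential Chebyshev inequality ([squared_increments_tail]).

    Lower bound ([walk_law_lower], [walk_law_lower_rate]). For f in the interior of B with I_0(f) <=
    r, tilt the steps of block k with parameter x D_k / (L sigma2), where D_k is the increment of f
    over the block. Under the tilted law Q the drift follows f, and [line_crossing] keeps the walk
    near its drift with probability at least 1/2. On that event dQ/dP is at most exp(q) with q close
    to r x^2 / n, so P(s_n in B) is at least exp(-q)/2. *)

(** * Independence of sigma-algebras over disjoint index sets, and product expectations *)

Section independence.
Context d (T : measurableType d) (R : realType).
Implicit Types (X : nat -> T -> R) (I : set nat) (P : probability T R).
Local Open Scope ereal_scope.

(** Initial segments suffice: any other finite set of indices is obtained by taking [A i] = [setT]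
    at the remaining ones. *)
Definition independent P X :=
  (forall i, measurable_fun setT (X i)) /\
  forall n (A : nat -> set R), (forall i, measurable (A i)) ->
    P (\bigcap_(i < n) X i @^-1` A i) = \prod_(i < n) P (X i @^-1` A i).

(** Finite-dimensional cylinders over coordinates in [I]: a pi-system generating the sigma-algebra
    of the [X i], i in [I]. *)
Definition cylinder X I : set (set T) :=
  [set B | exists (A : nat -> set R) n,
    [/\ forall i, measurable (A i), forall i, ~ I i -> A i = setT,
        forall i, (n <= i)%N -> A i = setT & B = \bigcap_i X i @^-1` A i]].

Lemma measurable_preimage (f : T -> R) A :
  measurable_fun setT f -> measurable A -> measurable (f @^-1` A).
Proof. by move=> mf mA; rewrite -[_ @^-1` _]setTI; exact: mf. Qed.

Lemma cylinder_setI_closed X I : setI_closed (cylinder X I).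
Proof.
move=> B1 B2 [A1 [n1 [mA1 IA1 nA1 ->]]] [A2 [n2 [mA2 IA2 nA2 ->]]].
exists (fun i => A1 i `&` A2 i), (maxn n1 n2); split.
- by move=> i; exact: measurableI.
- by move=> i Ii; rewrite IA1// IA2// setIT.
- by move=> i; rewrite geq_max => /andP[? ?]; rewrite nA1// nA2// setIT.
- by rewrite -bigcapI; apply: eq_bigcapr => i _; rewrite preimage_setI.
Qed.

Lemma cylinderT X I : cylinder X I setT.
Proof.
exists (fun=> setT), 0%N; split => //.
by apply/seteqP; split => w /=.
Qed.

Lemma cylinder_measurable X I : (forall i, measurable_fun setT (X i)) ->
  cylinder X I `<=` measurable.
Proof.
move=> mX _ [A [n [mA _ _ ->]]].
by apply: bigcapT_measurable => i; exact: measurable_preimage.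
Qed.

Lemma bigcap_preimage_ord X (A : nat -> set R) n :
  (forall i, (n <= i)%N -> A i = setT) ->
  \bigcap_i X i @^-1` A i = \bigcap_(i < n) X i @^-1` A i.
Proof.
move=> nA; apply/seteqP; split => w /= H i _; first exact: H.
by have [/H//|/nA ->] := ltnP i n.
Qed.

Lemma cylinder_independent P X I1 I2 B1 B2 : independent P X ->
  (forall i, I1 i -> I2 i -> False) ->
  cylinder X I1 B1 -> cylinder X I2 B2 -> P (B1 `&` B2) = P B1 * P B2.
Proof.
move=> [mX iX] I12 [A1 [n1 [mA1 IA1 nA1 ->]]] [A2 [n2 [mA2 IA2 nA2 ->]]].
pose n := maxn n1 n2.
have {}nA1 i : (n <= i)%N -> A1 i = setT by rewrite geq_max => /andP[/nA1].
have {}nA2 i : (n <= i)%N -> A2 i = setT by rewrite geq_max => /andP[_ /nA2].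
have -> : (\bigcap_i X i @^-1` A1 i) `&` (\bigcap_i X i @^-1` A2 i) =
    \bigcap_i X i @^-1` (A1 i `&` A2 i).
  by rewrite -bigcapI; apply: eq_bigcapr => i _; rewrite preimage_setI.
rewrite (@bigcap_preimage_ord X _ n); last first.
  by move=> i ni; rewrite nA1// nA2// setIT.
rewrite (bigcap_preimage_ord _ nA1) (bigcap_preimage_ord _ nA2) !iX//; last first.
  by move=> i; exact: measurableI.
rewrite -big_split/=; apply: eq_bigr => i _.
have [I1i|I1i] := pselect (I1 i).
- rewrite [A2 i]IA2; last by move=> /(I12 _ I1i).
  by rewrite setIT preimage_setT probability_setT mule1.
- by rewrite [A1 i]IA1// setTI preimage_setT probability_setT mul1e.
Qed.

Lemma sigma_cylinder_measurable X I : (forall i, measurable_fun setT (X i)) ->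
  <<s cylinder X I >> `<=` measurable.
Proof.
move=> mX; apply: smallest_sub; first exact: sigma_algebra_measurable.
exact: cylinder_measurable.
Qed.

(** [A] -> P(A & B) and [A] -> P(A) P(B) are finite measures that agree on a pi-system containing
    the whole space, hence on the sigma-algebra it generates. *)
Lemma product_rule_extends P (G : set (set T)) B : measurable B ->
  G `<=` measurable -> setI_closed G -> G setT ->
  (forall A, G A -> P (A `&` B) = P A * P B) ->
  forall A, <<s G >> A -> P (A `&` B) = P A * P B.
Proof.
move=> mB Gm GI GT GB A GA.
have PBfin : P B \is a fin_num by exact: fin_num_measure.
pose c := NngNum (fine_ge0 (measure_ge0 P B)).
have rE C : mrestr P mB C = P (C `&` B) by [].
have cE C : mscale c P C = P C * P B by rewrite /mscale /= fineK// muleC.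
rewrite -rE -cE; apply: (@g_sigma_algebra_measure_unique _ R T G Gm (fun=> setT) (fun=> GT)) => //.
- by apply/seteqP; split => // w _; exists 0%N.
- by move=> C /GB e; exact: etrans e (esym (cE C)).
- by move=> _; rewrite [X in X < _](_ : _ = P B) ?rE/= /mrestr ?setTI//; exact: (le_lt_trans (probability_le1 P mB) (ltry 1)).
Qed.

(** The product rule passes from cylinders to the sigma-algebras by two extensions, one in each
    argument. *)
Lemma sigma_independent P X I1 I2 B1 B2 : independent P X ->
  (forall i, I1 i -> I2 i -> False) ->
  <<s cylinder X I1 >> B1 -> <<s cylinder X I2 >> B2 ->
  P (B1 `&` B2) = P B1 * P B2.
Proof.
move=> iX I12 sB1 sB2; have mX := iX.1.
have mB2 := sigma_cylinder_measurable mX sB2.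
apply: (@product_rule_extends P (cylinder X I1)) => //.
- exact: cylinder_measurable.
- exact: cylinder_setI_closed.
- exact: cylinderT.
move=> A cA; rewrite setIC muleC.
apply: (@product_rule_extends P (cylinder X I2)) => //.
- exact: (cylinder_measurable mX cA).
- exact: cylinder_measurable.
- exact: cylinder_setI_closed.
- exact: cylinderT.
move=> C cC; rewrite setIC (muleC (P C)).
exact: (cylinder_independent iX I12).
Qed.

(** The sample space with the sigma-algebra of the [X i], i in [I]; measurability with respect to it
    becomes ordinary measurability from this type. *)
Definition sigma_of X I := g_sigma_algebraType (cylinder X I).

Lemma measurable_sigma_of X I i : I i -> measurable_fun [set: sigma_of X I] (X i).
Proof.
move=> Ii _ A mA; rewrite setTI; apply: sub_sigma_algebra.
exists (fun j => if j == i then A else setT), i.+1; split.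
- by move=> j; case: ifP.
- by move=> j; case: eqP => // ->.
- by move=> j; case: eqP => // ->; rewrite ltnn.
- apply/seteqP; split => [w Aw j _|w /(_ i Logic.I)]; last by rewrite /= eqxx.
  by rewrite /=; case: eqP => // ->.
Qed.

(** The law of the pair (f, g) is the product of the two laws, by uniqueness of the product measure;
    then Tonelli's theorem applies. *)
Lemma expectation_mul_independent P (f g : T -> R) :
  measurable_fun setT f -> measurable_fun setT g ->
  (forall w, 0 <= f w)%R -> (forall w, 0 <= g w)%R ->
  (forall A B, measurable A -> measurable B ->
    P (f @^-1` A `&` g @^-1` B) = P (f @^-1` A) * P (g @^-1` B)) ->
  \int[P]_w (f w * g w)%:E = \int[P]_w (f w)%:E * \int[P]_w (g w)%:E.
Proof.
move=> mf mg f0 g0 fg.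
pose F : {RV P >-> R} := HB.pack f (isMeasurableFun.Build _ _ _ _ f mf).
pose G : {RV P >-> R} := HB.pack g (isMeasurableFun.Build _ _ _ _ g mg).
have mh : measurable_fun setT (fun w => (f w, g w)).
  exact/measurable_fun_pairP.
pose H : {RV P >-> (R * R)%type} :=
  HB.pack (fun w => (f w, g w)) (isMeasurableFun.Build _ _ _ _ _ mh).
(* The absolute values make the integrand nonnegative on the whole plane, as Tonelli requires; on
   the range of (f, g) they have no effect. *)
pose phi (z : R * R) : \bar R := (`|z.1| * `|z.2|)%:E.
have mphi : measurable_fun [set: (R * R)%type] phi.
  apply/measurable_EFinP; apply: measurable_funM.
    by apply: measurableT_comp => //; exact: measurable_fst.
  by apply: measurableT_comp => //; exact: measurable_snd.
have mabs : measurable_fun setT (fun y : R => (`|y|%R)%:E).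
  by apply/measurable_EFinP; exact: normr_measurable.
have phi0 z : 0 <= phi z by rewrite /phi lee_fin mulr_ge0.
transitivity (\int[distribution P H]_z phi z).
  rewrite ge0_integral_distribution//; apply: eq_integral => w _ /=.
  by rewrite /phi/= !ger0_norm.
transitivity (\int[distribution P F \x distribution P G]_z phi z).
  apply: eq_measure_integral => A mA _; apply/esym.
  exact: product_measure_unique.
rewrite fubini_tonelli1// /fubini_F/=.
under eq_integral => x _.
  rewrite /phi /=; under eq_integral do rewrite EFinM.
  rewrite ge0_integralZl//.
  over.
rewrite /= ge0_integralZr//; last by apply: integral_ge0 => y _; rewrite lee_fin.
rewrite !ge0_integral_distribution//=.
by congr (_ * _); apply: eq_integral => w _ /=; rewrite ger0_norm.
Qed.

Lemma expectation_mul_sigma P X I1 I2 (f g : T -> R) : independent P X ->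
  (forall i, I1 i -> I2 i -> False) ->
  measurable_fun [set: sigma_of X I1] f -> measurable_fun [set: sigma_of X I2] g ->
  (forall w, 0 <= f w)%R -> (forall w, 0 <= g w)%R ->
  \int[P]_w (f w * g w)%:E = \int[P]_w (f w)%:E * \int[P]_w (g w)%:E.
Proof.
move=> iX I12 mf mg f0 g0.
have sf A : measurable A -> <<s cylinder X I1 >> (f @^-1` A).
  by move=> mA; have := mf measurableT A mA; rewrite setTI.
have sg A : measurable A -> <<s cylinder X I2 >> (g @^-1` A).
  by move=> mA; have := mg measurableT A mA; rewrite setTI.
apply: expectation_mul_independent => //.
- by move=> _ A mA; rewrite setTI; exact: (sigma_cylinder_measurable iX.1 (sf _ mA)).
- by move=> _ A mA; rewrite setTI; exact: (sigma_cylinder_measurable iX.1 (sg _ mA)).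
- by move=> A B mA mB; apply: (sigma_independent iX I12); [exact: sf|exact: sg].
Qed.

Lemma expectation_prod P X n (g : nat -> R -> R) : independent P X ->
  (forall i, measurable_fun setT (g i)) -> (forall i y, 0 <= g i y)%R ->
  \int[P]_w (\prod_(i < n) g i (X i w))%:E =
  \prod_(i < n) \int[P]_w (g i (X i w))%:E.
Proof.
move=> iX mg g0; elim: n => [|n IHn].
  rewrite big_ord0; under eq_integral do rewrite big_ord0.
  by rewrite integral_cst// mul1e; exact: probability_setT.
rewrite big_ord_recr/= -IHn.
rewrite -(@expectation_mul_sigma P X [set i | (i < n)%N] [set n])//.
- by apply: eq_integral => w _; rewrite big_ord_recr.
- by move=> i; rewrite /set1/= => + in_; rewrite in_ ltnn.
- apply: measurable_prod => i _.
  by apply: measurableT_comp => //; apply: measurable_sigma_of => /=; exact: ltn_ord.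
- by apply: measurableT_comp => //; exact: measurable_sigma_of.
- by move=> w; exact: prodr_ge0.
Qed.

End independence.

(** * Ottaviani's maximal inequality and the crossing of a line by partial sums *)

Section maximal_inequality.
Context d (T : measurableType d) (R : realType).
Implicit Types (X : nat -> T -> R) (P : probability T R).

Lemma measurable_norm_ge d' (T' : measurableType d') (f : T' -> R) (a : R) :
  measurable_fun setT f -> measurable [set w | a <= `|f w|].
Proof.
move=> mf; have -> : [set w | a <= `|f w|] = ((fun y : R => `|y|) \o f) @^-1` `[a, +oo[.
  by apply/seteqP; split => w /=; rewrite in_itv/= andbT.
rewrite -[_ @^-1` _]setTI; apply: measurableT_comp => //; exact: normr_measurable.
Qed.

Definition partial_sum X j w : R := \sum_(i < j) X i w.

Lemma measurable_partial_sum X j : (forall i, measurable_fun setT (X i)) ->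
  measurable_fun setT (partial_sum X j).
Proof. by move=> mX; exact: measurable_sum. Qed.

Lemma partial_sumB X (j N : nat) w : (j <= N)%N ->
  partial_sum X N w - partial_sum X j w = \sum_(j <= i < N) X i w.
Proof.
move=> jN; rewrite /partial_sum -!(big_mkord xpredT (fun i => X i w)).
by rewrite (big_cat_nat (leq0n j) jN)/= addrC addrK.
Qed.

(** Split according to the first j with |S_j| >= 2a. The later increment S_N - S_j is independent of
    this event and is below a with probability at least 1/2; when both hold, |S_N| > a. *)
Lemma ottaviani P X (N : nat) (a : R) : independent P X ->
  (forall j, (j <= N)%N ->
    (P [set w | (a <= `|partial_sum X N w - partial_sum X j w|)%R] <= (2^-1)%:E)%E) ->
  (P [set w | exists2 j, (j <= N)%N & (2 * a <= `|partial_sum X j w|)%R] <=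
   2%:E * P [set w | (a <= `|partial_sum X N w|)%R])%E.
Proof.
move=> iX half; set S := partial_sum X.
have mS j : measurable_fun setT (S j) by apply: measurable_partial_sum; exact: iX.1.
pose F j := [set w | 2 * a <= `|S j w|].
have mF j : measurable (F j) by exact: measurable_norm_ge.
(* [A j] is the event that the level 2a is reached for the first time at j, so these events are
   disjoint. *)
pose A := seqDU F; pose B j := [set w | `|S N w - S j w| < a].
pose C := [set w | a <= `|S N w|].
have mC : measurable C by exact: measurable_norm_ge.
have BE j : B j = ~` [set w | a <= `|S N w - S j w|].
  by apply/seteqP; split => w /=; [move=> ?; apply/negP; rewrite -ltNge|
    move=> /negP; rewrite -ltNge].
have mA j : measurable (A j).
  by apply: measurableD => //; exact: bigsetU_measurable.
have mBC j : measurable [set w | a <= `|S N w - S j w|].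
  by apply: measurable_norm_ge; exact: measurable_funB.
have mB j : measurable (B j) by rewrite BE; exact: measurableC.
have sS (I : set nat) j : (forall i, (i < j)%N -> I i) ->
    measurable_fun [set: sigma_of X I] (S j).
  move=> Ij; apply: (@measurable_sum _ (sigma_of X I)) => i.
  by apply: measurable_sigma_of; apply: Ij; exact: ltn_ord.
have sA j : <<s cylinder X [set i | (i < j)%N] >> (A j).
  have sF k : (k <= j)%N ->
      @measurable _ (sigma_of X [set i | (i < j)%N]) (F k).
    move=> kj; apply: (@measurable_norm_ge _ (sigma_of X [set i | (i < j)%N])).
    by apply: sS => i ik /=; exact: leq_trans kj.
  apply: (@measurableD _ (sigma_of X [set i | (i < j)%N])); first exact: sF.
  apply: bigsetU_measurable => i _; apply: sF; exact/ltnW/ltn_ord.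
have sB j : (j <= N)%N -> <<s cylinder X [set i | (j <= i)%N] >> (B j).
  move=> jN; rewrite BE.
  apply: (@measurableC _ (sigma_of X [set i | (j <= i)%N])).
  apply: (@measurable_norm_ge _ (sigma_of X [set i | (j <= i)%N])).
  have -> : (fun w => S N w - S j w) = (fun w => \sum_(i < N - j) X (i + j)%N w).
    apply/funext => w; rewrite partial_sumB// -{1}[j]add0n big_addn.
    by rewrite big_mkord.
  apply: (@measurable_sum _ (sigma_of X [set i | (j <= i)%N])) => i.
  by apply: measurable_sigma_of => /=; exact: leq_addl.
have -> : [set w | exists2 j, (j <= N)%N & 2 * a <= `|S j w|] =
    \big[setU/set0]_(j < N.+1) A j.
  rewrite -(bigsetU_seqDU F) -bigcup_mkord; apply/seteqP.
  by split => w /= [j jN Sj]; exists j.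
rewrite measure_bigsetU//; last exact: trivIset_seqDU.
apply: (@le_trans _ _ (\sum_(j < N.+1) 2%:E * P (A j `&` B j))%E).
  apply: lee_sum => j _.
  have jN : (j <= N)%N by rewrite -ltnS.
  rewrite (@sigma_independent _ _ _ P X [set i | (i < j)%N] [set i | (j <= i)%N])//;
    [|by move=> i /= /leq_trans /[apply]; rewrite ltnn|exact: sB].
  rewrite muleCA -[leLHS]mule1; apply: lee_pmul => //.
  rewrite BE probability_setC//.
  have := half _ jN; have : P [set w | a <= `|S N w - S j w|] \is a fin_num.
    exact: fin_num_measure.
  move=> /fineK <-; rewrite -EFinB -EFinM !lee_fin; lra.
rewrite -ge0_sume_distrr//; apply: lee_pmul => //; first exact: sume_ge0.
pose AB j := A j `&` B j.
have mAB j : measurable (AB j) by exact: measurableI.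
have tAB : trivIset setT AB.
  by apply: trivIset_setIr; exact: trivIset_seqDU.
rewrite -[leLHS](measure_bigsetU P mAB tAB N.+1).
apply: le_measure; rewrite ?inE//.
  by apply: bigsetU_measurable => j _; exact: mAB.
rewrite -bigcup_mkord => w [j /= jN [Ajw Bjw]].
have Fjw : 2 * a <= `|S j w| by exact: (subset_seqDU Ajw).
have {}Bjw : `|S N w - S j w| < a by [].
rewrite /C/=; have := ler_normB (S N w) (S N w - S j w).
by rewrite opprB addrCA subrr addr0; lra.
Qed.

(** Picks the dyadic block whose length is comparable with j + N0, so that the line is comparable
    with a constant on the block. *)
Lemma line_crossing_block (N0 j : nat) : (0 < N0)%N ->
  exists2 i, (j <= 2 ^ i * N0)%N & (2 ^ i * N0 <= 2 * (j + N0))%N.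
Proof.
move=> N0_gt0.
have ex : exists i, (j <= 2 ^ i * N0)%N.
  exists j; apply: (@leq_trans (2 ^ j)); first exact/ltnW/ltn_expl.
  by rewrite leq_pmulr.
case: (ex_minnP ex) => -[|i] ji imin.
  by exists 0%N => //; rewrite expn0 mul1n mulnDr (leq_trans _ (leq_addl _ _))// leq_pmull.
exists i.+1 => //; rewrite expnS -mulnA leq_mul2l /=.
apply: leq_trans (leq_addr _ _); rewrite leqNgt; apply/negP => /ltnW /imin.
by rewrite ltnn.
Qed.

(** Bounds the doubly exponential decay over dyadic blocks by a geometric series. *)
Lemma pow2_pow_le (x : R) i : 0 <= x <= 2^-1 -> x ^+ (2 ^ i) <= x / (2 ^ i)%:R.
Proof.
move=> /andP[x0 x1].
have xp k : x ^+ (2 ^ k) <= x.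
  by rewrite -[leRHS]expr1 ler_wiXn2l ?expn_gt0//; lra.
elim: i => [|i IHi]; first by rewrite expn0 expr1 divr1.
rewrite expnS mulnC exprM expr2 natrM invfM mulrA.
apply: ler_pM; rewrite ?exprn_ge0//.
exact: le_trans (xp i) _.
Qed.

(** A crossing of the line at j forces |S_j| >= 2 a_i in a dyadic block of length N_i = 2^i N0,
    where a_i = b N_i / 4. Ottaviani's inequality reduces this to the tail of S at N_i, of order
    exp(-2^i w), and the sum over i is geometric. *)
Lemma line_crossing P X (V u0 b w : R) (N0 : nat) : independent P X -> 0 < V ->
  (forall j N (a u : R), (j <= N)%N -> 0 <= u <= u0 ->
    (P [set w | (a <= `|partial_sum X N w - partial_sum X j w|)%R] <=
     (2 * expR (V * u ^+ 2 * N%:R - u * a))%:E)%E) ->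
  0 < b -> b <= 8 * V * u0 -> w = N0%:R * b ^+ 2 / (64 * V) -> 3 <= w ->
  (P [set w | exists j, (b * (j + N0)%:R <= `|partial_sum X j w|)%R] <=
   (8 * expR (- w))%:E)%E.
Proof.
move=> iX V0 tail b0 bu wE w3; set S := partial_sum X.
have N0_gt0 : (0 < N0)%N.
  by rewrite lt0n; apply/eqP => N00; move: w3; rewrite wE N00 !mul0r; lra.
(* Minimiser of V u^2 N - u a at a = b N / 4; the minimum is -b^2 N / (64 V), which explains [w]. *)
pose u := b / (8 * V).
have u_itv : 0 <= u <= u0.
  by rewrite divr_ge0 ?(ltW b0)//=; [rewrite ler_pdivrMr; lra|lra].
(* Thus the tail 2 exp(-w) is at most 1/2, as Ottaviani's inequality requires. *)
have ew : expR (- w) <= 4^-1.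
  rewrite expRN lef_pV2 ?posrE ?expR_gt0//.
  by apply: le_trans (expR_ge1Dx w); lra.
pose NN i := (2 ^ i * N0)%N.
pose a i := b * (NN i)%:R / 4.
have tail_i i j : (j <= NN i)%N ->
    (P [set w | (a i <= `|S (NN i) w - S j w|)%R] <= (2 * expR (- w) ^+ (2 ^ i))%:E)%E.
  move=> jN; apply: le_trans (tail _ _ _ _ jN u_itv) _.
  rewrite lee_fin ler_pM2l// -expRM_natl.
  suff -> : V * u ^+ 2 * (NN i)%:R - u * a i = (2 ^ i)%:R * - w by [].
  by rewrite /a /u /NN wE natrM; field; lra.
have mS j : measurable_fun setT (S j) by apply: measurable_partial_sum; exact: iX.1.
have mge c j : measurable [set w | c <= `|S j w|] by exact: measurable_norm_ge.
pose F i := [set w | exists2 j, (j <= NN i)%N & 2 * a i <= `|S j w|].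
have mF i : measurable (F i).
  have -> : F i = \bigcup_(j in [set j | (j <= NN i)%N]) [set w | 2 * a i <= `|S j w|].
    by apply/seteqP; split => x [j]; exists j.
  exact: bigcup_measurable.
have PF i : (P (F i) <= ((8 * expR (- w)) / (2 ^ i.+1)%:R)%:E)%E.
  have ewi : expR (- w) ^+ (2 ^ i) <= expR (- w) / (2 ^ i)%:R.
    by apply: pow2_pow_le; rewrite expR_ge0/=; lra.
  apply: le_trans (ottaviani iX _) _ => [j jN|].
    apply: le_trans (tail_i i j jN) _; rewrite lee_fin.
    have : expR (- w) / (2 ^ i)%:R <= expR (- w).
      by rewrite ler_pdivrMr ?ltr0n ?expn_gt0// ler_peMr ?expR_ge0// ler1n expn_gt0.
    lra.
  apply: (@le_trans _ _ (2%:E * (2 * expR (- w) ^+ (2 ^ i))%:E)%E).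
    apply: lee_pmul => //.
    have := tail_i i 0%N (leq0n _).
    apply: le_trans; apply: le_measure; rewrite ?inE//.
      by apply: measurable_norm_ge; exact: measurable_funB.
    by move=> z /=; rewrite [S 0%N z]/S /partial_sum big_ord0 subr0.
  rewrite -EFinM lee_fin expnS natrM invfM.
  apply: (@le_trans _ _ (2 * (2 * (expR (- w) / (2 ^ i)%:R)))); first by lra.
  by rewrite le_eqVlt; apply/orP; left; apply/eqP; field; rewrite pnatr_eq0 expn_eq0.
apply: (@le_trans _ _ (\sum_(i <oo) P (F i))%E).
  apply: measure_sigma_subadditive => //.
    have -> : [set w | exists j, b * (j + N0)%:R <= `|S j w|] =
        \bigcup_j [set w | b * (j + N0)%:R <= `|S j w|].
      by apply/seteqP; split => x [j]; exists j.
    exact: bigcup_measurable.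
  move=> z [j jz]; have [i ji iN] := line_crossing_block j N0_gt0.
  exists i => //; exists j => //; apply: le_trans jz.
  rewrite /a [leLHS](_ : _ = b * ((NN i)%:R / 2)); last by field.
  by rewrite ler_pM2l// ler_pdivrMr// -natrM ler_nat mulnC.
apply: le_trans (epsilon_trick0 xpredT _); last by rewrite mulr_ge0// expR_ge0.
by apply: lee_nneseries => i _ //; exact: PF.
Qed.
End maximal_inequality.

(** * Independence under coordinatewise maps and index shifts *)

Section independence_transfer.
Context d (T : measurableType d) (R : realType).
Implicit Types (X : nat -> T -> R) (P : probability T R).

Lemma independent_comp P X (h : nat -> R -> R) : independent P X ->
  (forall i, measurable_fun setT (h i)) -> independent P (fun i => h i \o X i).
Proof.
move=> [mX iX] mh; split=> [i|n A mA]; first exact: measurableT_comp.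
have := iX n (fun i => h i @^-1` A i) (fun i => measurable_preimage (mh i) (mA i)).
by [].
Qed.

Lemma independent_shift P X k : independent P X ->
  independent P (fun i => X (k + i)%N).
Proof.
move=> [mX iX]; split=> [i|n A mA]; first exact: mX.
pose A' i := if (i < k)%N then setT else A (i - k)%N.
have mA' i : measurable (A' i) by rewrite /A'; case: ifP.
have -> : \bigcap_(i < n) X (k + i)%N @^-1` A i = \bigcap_(i < k + n) X i @^-1` A' i.
  apply/seteqP; split => w /= H i /=.
    rewrite /A' => ikn; case: ltnP => // ki.
    by have := H (i - k)%N; rewrite /= ltn_subLR// subnKC//; exact.
  move=> i_n; have := H (k + i)%N; rewrite /= ltn_add2l => /(_ i_n).
  by rewrite /A' ltnNge leq_addr /= addKn.
rewrite iX// big_split_ord/= big1 ?mul1e => [|i _].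
  by apply: eq_bigr => i _; rewrite /A' ltnNge leq_addr /= addKn.
by rewrite /A' ltn_ord preimage_setT probability_setT.
Qed.

End independence_transfer.

(** * Change of measure, and product densities that preserve independence *)

Section density_probability.
Context d (T : measurableType d) (R : realType) (P : probability T R).
Variables (Z : T -> R) (mZ : measurable_fun setT Z) (Z0 : forall w, 0 <= Z w).
Hypothesis Z1 : (\int[P]_w (Z w)%:E = 1)%E.
Local Open Scope ereal_scope.

Definition density_measure (A : set T) : \bar R := \int[P]_(w in A) (Z w)%:E.

Let density0 : density_measure set0 = 0.
Proof. by rewrite /density_measure integral_set0. Qed.

Let density_ge0 A : 0 <= density_measure A.
Proof. by apply: integral_ge0 => w _; rewrite lee_fin. Qed.

Let density_sigma_additive : semi_sigma_additive density_measure.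
Proof.
move=> /= F mF tF mUF; rewrite /density_measure; apply: cvg_toP.
  apply: ereal_nondecreasing_is_cvgn => m n mn.
  apply: lee_sum_nneg_natr => // k _ _; apply: integral_ge0 => /= x Fkx.
  by rewrite lee_fin.
rewrite ge0_integral_bigcup//=; last by move=> x _; rewrite lee_fin.
by apply/measurable_funTS/measurableT_comp.
Qed.

HB.instance Definition _ := isMeasure.Build _ _ _
  density_measure density0 density_ge0 density_sigma_additive.

Let density_setT : density_measure setT = 1.
Proof. exact: Z1. Qed.

HB.instance Definition _ :=
  @Measure_isProbability.Build _ _ R density_measure density_setT.

Definition density_probability : probability T R := density_measure.

Lemma density_probabilityE A : measurable A ->
  density_probability A = \int[P]_w (Z w * \1_A w)%:E.
Proof.
move=> mA; rewrite /density_probability/= /density_measure integral_mkcond.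
apply: eq_integral => w _; rewrite patchE indicE.
by case: ifP; rewrite ?mulr1 ?mulr0.
Qed.

End density_probability.

Section tilting.
Context d (T : measurableType d) (R : realType) (P : probability T R).
Variables (X : nat -> T -> R) (iX : independent P X).
Variables (g : nat -> R -> R) (M : nat).
Hypothesis mg : forall i, measurable_fun setT (g i).
Hypothesis g0 : forall i y, 0 <= g i y.
Hypothesis g1 : forall i, (\int[P]_w (g i (X i w))%:E = 1)%E.
Hypothesis gM : forall i y, (M <= i)%N -> g i y = 1.

(** The density dQ/dP. Since [g i] = 1 from index [M] on, a finite product tilts the whole
    sequence. *)
Definition tilt_weight w : R := \prod_(i < M) g i (X i w).

Lemma tilt_weightE K w : (M <= K)%N -> tilt_weight w = \prod_(i < K) g i (X i w).
Proof.
move=> MK; rewrite /tilt_weight -!(big_mkord xpredT (fun i => g i (X i w))).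
rewrite [RHS](big_cat_nat (leq0n M) MK)/= [X in _ * X]big_nat [X in _ * X]big1 ?mulr1//.
by move=> i /andP[Mi _]; rewrite gM.
Qed.

Lemma tilt_weight_ge0 w : 0 <= tilt_weight w.
Proof. exact: prodr_ge0. Qed.

Lemma measurable_tilt_weight : measurable_fun setT tilt_weight.
Proof.
by apply: measurable_prod => i _; apply: measurableT_comp => //; exact: iX.1.
Qed.

Lemma tilt_expectation K (h : nat -> R -> R) : (M <= K)%N ->
  (forall i, measurable_fun setT (h i)) -> (forall i y, 0 <= h i y) ->
  (\int[P]_w (tilt_weight w * \prod_(i < K) h i (X i w))%:E =
   \prod_(i < K) \int[P]_w (g i (X i w) * h i (X i w))%:E)%E.
Proof.
move=> MK mh h0; pose gh i y := g i y * h i y.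
rewrite -(@expectation_prod _ _ _ P X K gh)//.
- by apply: eq_integral => w _; rewrite (tilt_weightE _ MK) -big_split.
- by move=> i; exact: measurable_funM.
- by move=> i y; rewrite /gh mulr_ge0.
Qed.

Lemma tilt_weight1 : (\int[P]_w (tilt_weight w)%:E = 1)%E.
Proof.
have := @tilt_expectation M (fun=> cst 1) (leqnn _).
rewrite [X in _ -> _ -> _ = X]big1/= => [|i _]; last first.
  by rewrite -[RHS](g1 i); apply: eq_integral => w _; rewrite mulr1.
by move=> <- //; apply: eq_integral => w _; rewrite big1 ?mulr1.
Qed.

Definition tilted : probability T R :=
  density_probability measurable_tilt_weight tilt_weight_ge0 tilt_weight1.

Lemma tiltedE A : measurable A -> tilted A = (\int[P]_w (tilt_weight w * \1_A w)%:E)%E.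
Proof. exact: density_probabilityE. Qed.

Lemma tilted_preimage K (A : nat -> set R) : (M <= K)%N ->
  (forall i, measurable (A i)) ->
  tilted (\bigcap_(i < K) X i @^-1` A i) =
  (\prod_(i < K) \int[P]_w (g i (X i w) * \1_(A i) (X i w))%:E)%E.
Proof.
move=> MK mA; rewrite tiltedE; last first.
  by apply: bigcap_measurableType => // i _; apply: measurable_preimage; [exact: iX.1|].
rewrite -(@tilt_expectation K (fun i => \1_(A i)))//.
apply: eq_integral => w _; congr (_ * _)%:E.
rewrite indicE; have [wA|wA] := boolP (w \in _).
  rewrite big1// => i _; rewrite indicE mem_set//.
  by move: wA; rewrite inE => /(_ i); apply => /=.
move: wA; rewrite notin_setE => /existsNP[i /not_implyP[/= iK wA]].
rewrite (bigD1 (Ordinal iK))//= indicE memNset ?mul0r//.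
Qed.

(** A product density factorises over coordinates: under the tilted law [X i] has density [g i] with
    respect to its old law, and the coordinates stay independent. *)
Lemma tilted_independent : independent tilted X.
Proof.
split=> [|n A mA]; first exact: iX.1.
pose K := maxn M n; have MK : (M <= K)%N := leq_maxl _ _.
pose A' i := if (i < n)%N then A i else setT.
have mA' i : measurable (A' i) by rewrite /A'; case: ifP.
have AA' : \bigcap_(i < n) X i @^-1` A i = \bigcap_(i < K) X i @^-1` A' i.
  apply/seteqP; split => w /= H i /=; rewrite /A'.
    by move=> _; case: ifP => // i_n; exact: H.
  move=> i_n; have := H i; rewrite /A' /= i_n; apply.
  by rewrite leq_max i_n orbT.
(* Marginal law of one coordinate: all other factors integrate to 1. *)
have gA i B : measurable B -> tilted (X i @^-1` B) =
    (\int[P]_w (g i (X i w) * \1_B (X i w))%:E)%E.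
  move=> mB; pose L := maxn M i.+1; pose B' j := if j == i then B else setT.
  have iL : (i < L)%N by rewrite leq_max ltnSn orbT.
  have -> : X i @^-1` B = \bigcap_(j < L) X j @^-1` B' j.
    apply/seteqP; split => w /= H; last by have := H i iL; rewrite /B' eqxx.
    by move=> j _; rewrite /= /B'; case: eqP => // ->.
  rewrite tilted_preimage ?leq_maxl//; last by move=> j; rewrite /B'; case: ifP.
  rewrite (bigD1 (Ordinal iL))//= [X in (_ * X)%E]big1 ?mule1.
    by rewrite /B' eqxx.
  move=> j /eqP ji; rewrite /B'; case: eqP => [ji'|_].
    by exfalso; apply: ji; exact: val_inj.
  by rewrite -[RHS](g1 j); apply: eq_integral => w _; rewrite indicT mulr1.
rewrite AA' tilted_preimage//.
rewrite -(big_mkord xpredT (fun i => \int[P]_w (g i (X i w) * \1_(A' i) (X i w))%:E)%E).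
rewrite (big_cat_nat (leq0n n) (leq_maxr M n))/= [X in (_ * X)%E]big_nat [X in (_ * X)%E]big1 ?mule1.
  rewrite big_mkord; apply: eq_bigr => i _.
  by rewrite gA// /A' ltn_ord.
move=> i /andP[ni _]; rewrite /A' ltnNge ni/= -[RHS](g1 i).
by apply: eq_integral => w _; rewrite indicT mulr1.
Qed.

Lemma tilted_exp_moment (c : nat -> R) (V u0 u : R) (j N : nat) : 0 <= V ->
  (forall i u', `|u'| <= u0 ->
    (\int[P]_w (g i (X i w) * expR (u' * (X i w - c i)))%:E <=
     (expR (V * u' ^+ 2))%:E)%E) ->
  (j <= N)%N -> `|u| <= u0 ->
  (\int[P]_w (tilt_weight w * expR (u * \sum_(j <= i < N) (X i w - c i)))%:E <=
   (expR (V * u ^+ 2 * N%:R))%:E)%E.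
Proof.
move=> V0 gexp jN uu0; pose K := maxn M N.
have MK : (M <= K)%N := leq_maxl _ _.
have NK : (N <= K)%N := leq_maxr _ _.
pose h i y := if (j <= i < N)%N then expR (u * (y - c i)) else 1.
have mh i : measurable_fun setT (h i).
rewrite /h; case: (j <= i < N)%N; last exact: measurable_cst.
  apply: measurableT_comp; first exact: measurable_expR.
  by apply: measurable_funM => //; exact: measurable_funB.
have h0 i y : 0 <= h i y by rewrite /h; case: ifP => // _; exact: expR_ge0.
have -> : (\int[P]_w (tilt_weight w *
      expR (u * \sum_(j <= i < N) (X i w - c i)))%:E =
    \int[P]_w (tilt_weight w * \prod_(i < K) h i (X i w))%:E)%E.
  apply: eq_integral => w _; congr (_ * _)%:E.
  rewrite big_distrr/= expR_sum -(big_mkord xpredT (fun i => h i (X i w))).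
  rewrite (big_cat_nat (leq0n j) (leq_trans jN NK))/=.
  rewrite [X in _ = X * _]big_nat [X in _ = X * _]big1 ?mul1r; last first.
    by move=> i /andP[_ ij]; rewrite /h leqNgt ij.
  rewrite (big_cat_nat jN NK)/=.
  rewrite [X in _ = _ * X]big_nat [X in _ = _ * X]big1 ?mulr1; last first.
    by move=> i /andP[Ni _]; rewrite /h [(i < N)%N]ltnNge Ni andbF.
  rewrite big_nat [RHS]big_nat; apply: eq_bigr => i /andP[ji iN].
  by rewrite /h ji iN.
rewrite tilt_expectation//.
(* Indices below j also receive the bound exp(V u^2) >= 1; hence N, and not N - j, in the
   exponent. *)
pose F i := if (i < N)%N then expR (V * u ^+ 2) else 1.
have -> : expR (V * u ^+ 2 * N%:R) = \prod_(i < K) F i.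
  rewrite -(big_mkord xpredT F) (big_cat_nat (leq0n N) NK)/=.
  rewrite [X in _ = _ * X]big_nat [X in _ = _ * X]big1 ?mulr1; last first.
    by move=> i /andP[Ni _]; rewrite /F ltnNge Ni.
  rewrite big_mkord (eq_bigr (fun=> expR (V * u ^+ 2))) => [|i _].
    by rewrite prodr_const card_ord expRM_natr.
  by rewrite /F ltn_ord.
have F1 i : 1 <= F i.
  by rewrite /F; case: ifP => // _; rewrite -expR0 ler_expR mulr_ge0// sqr_ge0.
rewrite -prodEFin.
suff : (0 <= \prod_(i < K) \int[P]_w (g i (X i w) * h i (X i w))%:E <=
    \prod_(i < K) (F i)%:E)%E by move=> /andP[].
elim/big_ind2 : _ => [|x1 x2 y1 y2 /andP[x10 x12] /andP[y10 y12]|i _].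
- by rewrite lexx lee_fin ler01.
- by rewrite mule_ge0//= lee_pmul.
- apply/andP; split; first by apply: integral_ge0 => w _; rewrite lee_fin mulr_ge0.
  rewrite /h; case jiN: (j <= i < N)%N.
    by move: jiN => /andP[_ iN]; rewrite /F iN; exact: gexp.
  under eq_integral do rewrite mulr1.
  by rewrite g1 lee_fin.
Qed.

(** Two-sided exponential Chebyshev inequality: with s the increment, the indicator of |s| >= a is
    at most exp(-u a) (exp(u s) + exp(-u s)). *)
Lemma tilted_tail (c : nat -> R) (V u0 a u : R) (j N : nat) : 0 <= V ->
  (forall i u', `|u'| <= u0 ->
    (\int[P]_w (g i (X i w) * expR (u' * (X i w - c i)))%:E <=
     (expR (V * u' ^+ 2))%:E)%E) ->
  (j <= N)%N -> 0 <= u <= u0 ->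
  (tilted [set w | (a <= `|partial_sum (fun i w => X i w - c i) N w -
                          partial_sum (fun i w => X i w - c i) j w|)%R] <=
   (2 * expR (V * u ^+ 2 * N%:R - u * a))%:E)%E.
Proof.
move=> V0 gexp jN /andP[u0' uu0]; set S := partial_sum _.
have mY i : measurable_fun setT (fun w => X i w - c i).
  by apply: measurable_funB => //; exact: iX.1.
have mS k : measurable_fun setT (S k) by exact: measurable_partial_sum.
rewrite tiltedE; last by apply: measurable_norm_ge; exact: measurable_funB.
pose s w := \sum_(j <= i < N) (X i w - c i).
have sE w : S N w - S j w = s w by rewrite /S partial_sumB.
have ms : measurable_fun setT s.
  have <- : (fun w => S N w - S j w) = s by apply/funext => w; rewrite sE.
  exact: measurable_funB.
have mZe v : measurable_fun setT (fun w => (tilt_weight w * expR (v * s w))%:E).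
  apply/measurable_EFinP; apply: measurable_funM.
    exact: measurable_tilt_weight.
  by apply: measurableT_comp => //; exact: measurable_funM.
have Ze0 v w : (0 <= (tilt_weight w * expR (v * s w))%:E)%E.
  by rewrite lee_fin mulr_ge0 ?expR_ge0 ?tilt_weight_ge0.
apply: (@le_trans _ _ (\int[P]_w ((expR (- (u * a)))%:E *
    ((tilt_weight w * expR (u * s w))%:E + (tilt_weight w * expR (- u * s w))%:E)))%E).
  apply: ge0_le_integral => //.
  - by move=> w _; rewrite lee_fin mulr_ge0 ?tilt_weight_ge0.
  - apply/measurable_EFinP; apply: measurable_funM.
      exact: measurable_tilt_weight.
    apply: measurable_indic; apply: measurable_norm_ge; exact: measurable_funB.
  - by apply: measurable_funeM; exact: emeasurable_funD.
  - move=> w _; rewrite -EFinD -EFinM lee_fin -mulrDr mulrCA.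
    rewrite ler_wpM2l ?tilt_weight_ge0// indicE.
    have [|_] := boolP (w \in _); last first.
      by rewrite mulr_ge0 ?expR_ge0// addr_ge0// expR_ge0.
    rewrite inE/= sE => aw; rewrite mulrDr -!expRD.
    have [s0|s0] := leP 0 (s w).
      rewrite -[leLHS]addr0 lerD ?expR_ge0//= -expR0 ler_expR addrC subr_ge0.
      by rewrite ler_wpM2l// (le_trans aw)// ger0_norm.
    rewrite -[leLHS]add0r lerD ?expR_ge0//= -expR0 ler_expR addrC mulNr -mulrN subr_ge0.
    by rewrite ler_wpM2l// (le_trans aw)// ltr0_norm.
rewrite ge0_integralZl//; first last.
- by move=> w _; rewrite adde_ge0.
- exact: emeasurable_funD.
rewrite ge0_integralD//.
have E1 : `|u| <= u0 by rewrite ger0_norm.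
have E2 : `|- u| <= u0 by rewrite normrN.
have := leeD (tilted_exp_moment V0 gexp jN E1) (tilted_exp_moment V0 gexp jN E2).
rewrite sqrrN -EFinD => H.
apply: le_trans (lee_pmul _ _ (lexx _) H) _.
- by rewrite lee_fin expR_ge0.
- by rewrite adde_ge0// integral_ge0.
rewrite -EFinM lee_fin expRD.
by rewrite le_eqVlt; apply/orP; left; apply/eqP; ring.
Qed.

End tilting.

(** * Absolute continuity of a function and of its total variation *)

Section interval_families.
Context {R : realType}.
Implicit Types (f : R -> R) (T a b : R).

(** Absolute continuity for an interval function [v], so that increments and total variations share
    one notion. Arbitrary finite index types allow the partitions of all intervals of a family to be
    merged into one family. *)
Definition absolutely_small (v : R -> R -> R) T :=
  forall e, 0 < e -> exists2 delta, 0 < delta &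
    forall (I : finType) (a b : I -> R),
      (forall i, [/\ 0 <= a i, a i <= b i & b i <= T]) ->
      trivIset setT (fun i => `]a i, b i[%classic) ->
      \sum_i (b i - a i) < delta -> \sum_i v (a i) (b i) <= e.

Lemma absolutely_continuous_small f T : absolutely_continuous f -> 0 < T ->
  absolutely_small (fun a b => `|f b - f a|) T.
Proof.
move=> acf T0 e e0; have [delta d0 H] := acf T T0 e e0.
exists delta => // I a b ab tab sab.
have E (F : I -> R) : \sum_i F i = \sum_(j < #|I|) F (enum_val j).
  by rewrite (reindex (enum_val (A := I)))//; exact/onW_bij/enum_val_bij.
rewrite E in sab; rewrite E; apply/ltW.
apply: (H #|I| (a \o enum_val) (b \o enum_val)) => // [i|]; first exact: ab.
by move=> i j _ _ /(tab _ _ Logic.I Logic.I)/enum_val_inj.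
Qed.

Lemma itv_partition_ltn (a b : R) s (i j : nat) : itv_partition a b s ->
  (i < j <= size s)%N -> nth b (a :: s) i < nth b (a :: s) j.
Proof.
move=> [sa _] /andP[ij js].
apply: (sorted_ltn_nth lt_trans) => //; rewrite inE/= ltnS//.
exact: (leq_trans (ltnW ij)).
Qed.

(** The partition intervals of all ]a i, b i[ together, indexed by pairs, form one disjoint family
    of the same total length. *)
Lemma variation_family f T (e delta : R) (I : finType) (a b : I -> R)
    (s : I -> seq R) :
  (forall (I : finType) (a b : I -> R),
      (forall i, [/\ 0 <= a i, a i <= b i & b i <= T]) ->
      trivIset setT (fun i => `]a i, b i[%classic) ->
      \sum_i (b i - a i) < delta -> \sum_i `|f (b i) - f (a i)| <= e) ->
  (forall i, [/\ 0 <= a i, a i <= b i & b i <= T]) ->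
  trivIset setT (fun i => `]a i, b i[%classic) ->
  \sum_i (b i - a i) < delta ->
  (forall i, itv_partition (a i) (b i) (s i)) ->
  \sum_i variation (a i) (b i) f (s i) <= e.
Proof.
move=> H ab tab sab ps.
pose A (p : {i : I & 'I_(size (s i))}) :=
  nth (b (tag p)) (a (tag p) :: s (tag p)) (tagged p).
pose B (p : {i : I & 'I_(size (s i))}) :=
  nth (b (tag p)) (a (tag p) :: s (tag p)) (tagged p).+1.
have aA p : a (tag p) <= A p by apply: itv_partition_nth_ge => //; exact/ltnW/ltn_ord.
have Bb p : B p <= b (tag p) by apply: itv_partition_nth_le => //; exact: ltn_ord.
have AB p : A p < B p.
  by apply: (itv_partition_ltn (ps _)); rewrite ltnSn ltn_ord.
have -> : \sum_i variation (a i) (b i) f (s i) = \sum_p `|f (B p) - f (A p)|.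
  under eq_bigr do rewrite /variation big_mkord.
  by rewrite sig_big_dep.
apply: H => [p||].
- have [a0 _ bT] := ab (tag p); split; first exact: le_trans (aA p).
    exact: ltW.
  exact: le_trans (Bb p) _.
- move=> [i k] [i' k'] _ _ [x /= []]; rewrite !in_itv/= => /andP[x1 x2] /andP[x3 x4].
  have ii' : i = i'.
    apply: tab => //; exists x; split; rewrite /= in_itv/=.
      by rewrite (le_lt_trans (aA _) x1) (lt_le_trans x2 (Bb _)).
    by rewrite (le_lt_trans (aA _) x3) (lt_le_trans x4 (Bb _)).
  subst i'; congr existT; apply/val_inj => /=.
  have [kk|kk|//] := ltngtP k k'.
  + have := le_lt_trans _ (lt_trans x3 x2); rewrite /A /B/= => /(_ (nth (b i) (s i) k)).
    suff : nth (b i) (a i :: s i) k.+1 <= nth (b i) (a i :: s i) k' by move=> /= -> /(_ erefl); rewrite ltxx.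
    move: kk; rewrite leq_eqVlt => /predU1P[->//|kk].
    by apply/ltW/(itv_partition_ltn (ps i)); rewrite kk ltnW.
  + have := le_lt_trans _ (lt_trans x1 x4); rewrite /A /B/= => /(_ (nth (b i) (s i) k')).
    suff : nth (b i) (a i :: s i) k'.+1 <= nth (b i) (a i :: s i) k by move=> /= -> /(_ erefl); rewrite ltxx.
    move: kk; rewrite leq_eqVlt => /predU1P[->//|kk].
    by apply/ltW/(itv_partition_ltn (ps i)); rewrite kk ltnW.
- suff -> : \sum_p (B p - A p) = \sum_i (b i - a i) by [].
  transitivity (\sum_i \sum_(k < size (s i))
     (nth (b i) (a i :: s i) k.+1 - nth (b i) (a i :: s i) k)).
    by rewrite sig_big_dep.
  apply: eq_bigr => i _.
  rewrite -(big_mkord xpredT (fun k => nth (b i) (a i :: s i) k.+1 - nth (b i) (a i :: s i) k)).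
  rewrite telescope_sumr//=.
  by have := itv_partition_nth_size (b i) (ps i); rewrite /= => ->.
Qed.

Lemma total_variation_fin_num f T : 0 < T ->
  absolutely_small (fun a b => `|f b - f a|) T ->
  forall a b, 0 <= a -> a <= b -> b <= T -> total_variation a b f \is a fin_num.
Proof.
move=> T0 /(_ 1 ltr01)[delta d0 H].
have short a b : 0 <= a -> a <= b -> b <= T -> b - a < delta ->
    total_variation a b f \is a fin_num.
  move=> a0 ab bT abd; rewrite ge0_fin_numE ?total_variation_ge0//.
  apply: (@le_lt_trans _ _ 1%:E); last exact: ltry.
  apply: ge_ereal_sup => _ [_ [s ps <-] <-]; rewrite lee_fin.
  have := @variation_family f T 1 delta unit (fun=> a) (fun=> b) (fun=> s) H.
  rewrite !big_const /= card_unit /= !addr0; apply => //.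
  by move=> [] [].
(* An interval shorter than [delta] has variation at most 1; longer ones lose a last piece of length
   delta/2 at each induction step. *)
have step n a b : 0 <= a -> a <= b -> b <= T -> b - a <= n%:R * (delta / 2) ->
    total_variation a b f \is a fin_num.
  elim: n a b => [|n IHn] a b a0 ab bT; rewrite ?mul0r => abn.
    by apply: short => //; exact: le_lt_trans abn d0.
  have [abd|abd] := ltP (b - a) delta; first exact: short.
  have ac : a <= b - delta / 2 by lra.
  have cb : b - delta / 2 <= b by lra.
  rewrite (total_variationD f ac cb) fin_numD IHn//=; last 2 first.
  - by rewrite (le_trans cb).
  - by move: abn; rewrite -natr1 mulrDl mul1r; lra.
  by apply: short => //; [exact: le_trans ac|lra].
move=> a b a0 ab bT; apply: (step (Num.truncn ((b - a) / (delta / 2))).+1) => //.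
rewrite -ler_pdivrMr; last lra.
exact/ltW/truncnS_gt.
Qed.

(** Choose in each interval a partition that realises the variation up to eta / (#|I| + 1) and apply
    [variation_family]. *)
Lemma absolutely_small_total_variation f T : 0 < T ->
  absolutely_small (fun a b => `|f b - f a|) T ->
  absolutely_small (fun a b => fine (total_variation a b f)) T.
Proof.
move=> T0 smf e e0; have [delta d0 H] := smf e e0; exists delta => // I a b ab tab sab.
apply/ler_addgt0Pr => eta eta0.
pose c := eta / (#|I|.+1)%:R.
have c0 : 0 < c by rewrite divr_gt0.
have fin i : total_variation (a i) (b i) f \is a fin_num.
  by have [? ? ?] := ab i; exact: (total_variation_fin_num T0 smf).
have /choice[s ps] : forall i, exists s : seq R, itv_partition (a i) (b i) s /\
    fine (total_variation (a i) (b i) f) <= variation (a i) (b i) f s + c.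
  move=> i; have [_ [_ [s ps <-] <-]] := ub_ereal_sup_adherent c0 (fin i).
  rewrite -/(total_variation _ _ _) -[X in (X - _ < _)%E](fineK (fin i)).
  by rewrite -EFinB lte_fin => sc; exists s; split => //; lra.
apply: (@le_trans _ _ (\sum_i (variation (a i) (b i) f (s i) + c))).
  by apply: ler_sum => i _; exact: (ps i).2.
rewrite big_split/= lerD//.
  by apply: (@variation_family f T e delta) => // i; exact: (ps i).1.
rewrite sumr_const -mulr_natr /c -mulrA ler_piMr ?(ltW eta0)//.
by rewrite mulrC ler_pdivrMr ?ltr0n// mul1r ler_nat.
Qed.

End interval_families.

(** * Lebesgue density of an absolutely continuous Stieltjes measure *)

Section radon_nikodym_stieltjes.
Context {R : realType}.
Implicit Types (f F : R -> R) (T a b : R).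
Notation mu := (@lebesgue_measure R).

Lemma stieltjes_itvoc (F : cumulative R R) a b : a <= b ->
  lebesgue_stieltjes_measure F `]a, b] = (F b - F a)%:E.
Proof.
move=> ab; rewrite /lebesgue_stieltjes_measure /measure_extension/=.
by rewrite measurable_mu_extE/= ?wlength_itv_bnd//; exact: is_ocitv.
Qed.

Definition grid_cell T (p k : nat) : set R :=
  `](k%:R * T / (2 ^ p)%:R), (k.+1%:R * T / (2 ^ p)%:R)]%classic.

Definition grid_cell_inside T (U : set R) p k : set R :=
  if `[< grid_cell T p k `<=` U >] then grid_cell T p k else set0.

(** Inner approximation of an open set by dyadic cells: a finite disjoint family at each level [p],
    increasing in [p], which exhausts the part of [U] in ]0, T]. *)
Definition grid_inner T (U : set R) p : set R :=
  \big[setU/set0]_(k < 2 ^ p) grid_cell_inside T U p k.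

Lemma grid_innerP T U p x : grid_inner T U p x <->
  exists2 k, (k < 2 ^ p)%N /\ grid_cell T p k `<=` U & grid_cell T p k x.
Proof.
rewrite /grid_inner -bigcup_mkord; split.
  by move=> [k /= kp]; rewrite /grid_cell_inside; case: asboolP => // cU kx; exists k.
by move=> [k [kp cU] kx]; exists k => //=; rewrite /grid_cell_inside asboolT.
Qed.

Lemma grid_cell_disjoint T p k k' x : 0 < T ->
  grid_cell T p k x -> grid_cell T p k' x -> k = k'.
Proof.
move=> T0; have p0 : 0 < T / (2 ^ p)%:R by rewrite divr_gt0 ?ltr0n ?expn_gt0.
rewrite /grid_cell /= !in_itv/= -!mulrA => /andP[x1 x2] /andP[x3 x4].
have := lt_le_trans x1 x4; rewrite ltr_pM2r// ltr_nat ltnS => kk'.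
have := lt_le_trans x3 x2; rewrite ltr_pM2r// ltr_nat ltnS => k'k.
by apply/eqP; rewrite eqn_leq kk'.
Qed.

Lemma grid_inner_nondecreasing T U : 0 < T -> nondecreasing_seq (grid_inner T U).
Proof.
move=> T0; apply/nondecreasing_seqP => p; apply/subsetPset => x /grid_innerP[k [kp cU] kx].
have p0 : 0 < T / (2 ^ p.+1)%:R by rewrite divr_gt0 ?ltr0n ?expn_gt0.
have E n : n%:R * T / (2 ^ p)%:R = (2 * n)%:R * T / (2 ^ p.+1)%:R.
  by rewrite expnS !natrM; field; rewrite pnatr_eq0 expn_eq0.
move: cU kx; rewrite /grid_cell !E => cU; rewrite /= in_itv/= => /andP[x1 x2].
have [xm|xm] := leP x ((2 * k).+1%:R * T / (2 ^ p.+1)%:R).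
  apply/grid_innerP; exists (2 * k)%N; last by rewrite /grid_cell/= in_itv/= x1.
  split; first by rewrite expnS ltn_pmul2l.
  apply: subset_trans cU => y; rewrite /grid_cell/= !in_itv/= => /andP[->/= y2].
  by apply: le_trans y2 _; rewrite -!mulrA ler_pM2r// ler_nat mulnS.
apply/grid_innerP; exists (2 * k).+1; last first.
  by rewrite /grid_cell/= in_itv/= xm/= (le_trans x2)// mulnS.
split; first by rewrite expnS -ltnS -[(2 * k).+2]/(2 + 2 * k)%N -mulnS ltnS leq_mul2l.
apply: subset_trans cU => y; rewrite /grid_cell/= !in_itv/= => /andP[y1 y2].
rewrite (le_trans y2) ?mulnS// andbT (le_lt_trans _ y1)//.
by rewrite -!mulrA ler_pM2r// ler_nat.
Qed.

Lemma grid_inner_cover T U : 0 < T -> open U ->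
  U `&` `]0, T] `<=` \bigcup_p grid_inner T U p.
Proof.
move=> T0 oU x [Ux]; rewrite /= in_itv/= => /andP[x0 xT].
have [r r0 xrU] : exists2 r : R, 0 < r & ball x r `<=` U.
  by have /nbhs_ballP[r r0 H] := open_nbhs_nbhs (conj oU Ux); exists r.
pose p := Num.truncn (T / r).
have pr : T / r < (2 ^ p)%:R.
  apply: (lt_le_trans (truncnS_gt _)); rewrite ler_nat; exact: ltn_expl.
have p2 : 0 < (2 ^ p)%:R :> R by rewrite ltr0n expn_gt0.
have pT : T / (2 ^ p)%:R < r by rewrite ltr_pdivrMr// mulrC -ltr_pdivrMr.
have pT0 : 0 < T / (2 ^ p)%:R by rewrite divr_gt0.
have ex : exists k, x <= k.+1%:R * T / (2 ^ p)%:R.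
  exists (2 ^ p)%N; apply: (le_trans xT); rewrite ler_pdivlMr// mulrC ler_pM2r//.
  by rewrite ler_nat.
case: (ex_minnP ex) => k xk kmin.
have kx : k%:R * T / (2 ^ p)%:R < x.
  case: k kmin {xk} => [|k] kmin; first by rewrite !mul0r.
  by rewrite ltNge; apply/negP => /kmin; rewrite ltnn.
exists p => //; apply/grid_innerP; exists k; last by rewrite /grid_cell/= in_itv/= kx.
split.
  rewrite -(ltr_nat R) -(ltr_pM2r pT0) !mulrA (lt_le_trans kx)// (le_trans xT)//.
  by rewrite mulrC mulrA mulVf ?mul1r// gt_eqF.
move=> y; rewrite /grid_cell/= in_itv/= => /andP[y1 y2]; apply: xrU.
have e : k.+1%:R * T / (2 ^ p)%:R = k%:R * T / (2 ^ p)%:R + T / (2 ^ p)%:R.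
  by rewrite -natr1; field; rewrite gt_eqF.
rewrite e in xk y2.
rewrite /ball/= ltr_norml; apply/andP; split; lra.
Qed.

(** Outer regularity encloses a null set in an open set [U] of measure below [delta]. The dyadic
    cells inside [U] are finite disjoint families of total length below [delta], so their F-measure
    is at most [e]; let the level tend to infinity. *)
Lemma absolutely_small_dominated (F : cumulative R R) T : 0 < T ->
  absolutely_small (fun a b => F b - F a) T ->
  forall A, measurable A -> mu A = 0%E ->
    lebesgue_stieltjes_measure F (A `&` `]0, T]) = 0%E.
Proof.
move=> T0 smF A mA A0; apply/eqP; rewrite eq_le measure_ge0 andbT.
apply/lee_addgt0Pr => e e0; rewrite add0e.
have [delta d0 H] := smF e e0.
have Aoo : (mu A < +oo)%E by rewrite A0 ltry.
have [U [oU AU UA]] := lebesgue_regularity_outer mA Aoo d0.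
have mU : measurable U by exact: open_measurable.
have {UA} Ud : (mu U < delta%:E)%E.
  apply: le_lt_trans UA; rewrite -[X in (mu X <= _)%E](setDUK AU).
  apply: le_trans (measureU2 _ _ _) _ => //; first exact: measurableD.
  by rewrite [X in (X + _)%E]A0 add0e.
have mcell p k : measurable (grid_cell_inside T U p k).
  by rewrite /grid_cell_inside; case: ifP => // _; exact: measurable_itv.
have mI p : measurable (grid_inner T U p).
  by apply: bigsetU_measurable => k _; exact: mcell.
have ni : nondecreasing_seq (grid_inner T U) by exact: grid_inner_nondecreasing.
have Fp p : (lebesgue_stieltjes_measure F (grid_inner T U p) <= e%:E)%E.
  have p2 : 0 < (2 ^ p)%:R :> R by rewrite ltr0n expn_gt0.
  pose ca (k : nat) := k%:R * T / (2 ^ p)%:R.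
  pose cb (k : nat) := k.+1%:R * T / (2 ^ p)%:R.
  have cab k : ca k <= cb k.
    by rewrite /ca /cb -!mulrA ler_pM2r ?divr_gt0// ler_nat.
  (* Cells outside [U] become the empty interval ]0, 0], so that the family is indexed by all k <
     2^p. *)
  pose a (k : nat) := if `[< grid_cell T p k `<=` U >] then ca k else 0.
  pose b (k : nat) := if `[< grid_cell T p k `<=` U >] then cb k else 0.
  have ab (k : 'I_(2 ^ p)) : [/\ 0 <= a k, a k <= b k & b k <= T].
    rewrite /a /b; case: ifP => _; last by rewrite lexx ltW.
    split=> //; first by rewrite /ca divr_ge0 ?ler0n// mulr_ge0 ?ler0n// ltW.
    by rewrite /cb ler_pdivrMr// mulrC ler_pM2l// ler_nat.
  have cellE k : grid_cell_inside T U p k = `]a k, b k]%classic.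
    by rewrite /grid_cell_inside /a /b; case: ifP => // _; rewrite set_itvoc0.
  have tcell : trivIset setT (fun k => grid_cell_inside T U p k).
    move=> k k' _ _ [x []]; rewrite /grid_cell_inside.
    by case: ifP => // _ xk; case: ifP => // _ xk'; exact: (grid_cell_disjoint T0 xk xk').
  (* Used twice: with G = F for the Stieltjes measure, and with G = id for Lebesgue measure. *)
  have meas (m : {measure set (measurableTypeR R) -> \bar R}) (G : R -> R) :
      (forall a b, a <= b -> m `]a, b]%classic = (G b - G a)%:E) ->
      m (grid_inner T U p) = (\sum_(k < 2 ^ p) (G (b k) - G (a k)))%:E.
    move=> mG; rewrite /grid_inner measure_bigsetU//; last by move=> k; exact: mcell.
    rewrite -sumEFin; apply: eq_bigr => k _; rewrite cellE; apply: mG.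
    by have [] := ab k.
  rewrite (meas _ F); last by move=> x y; exact: stieltjes_itvoc.
  rewrite lee_fin; apply: H => //.
    move=> k k' _ _ [x [xk xk']]; apply/val_inj.
    by apply: (tcell k k') => //; exists x; rewrite !cellE; split;
      apply: subset_itv_oo_oc; [exact: xk|exact: xk'].
  rewrite -lte_fin -(meas mu id); last by move=> x y; exact: stieltjes_itvoc.
  apply: le_lt_trans Ud; apply: le_measure; rewrite ?inE; [exact: mI|exact: mU|].
  by move=> x; move=> /grid_innerP[k [_ +] kx]; apply.
have mUI : measurable (\bigcup_p grid_inner T U p) by exact: bigcupT_measurable.
have cvgI := @nondecreasing_cvg_mu _ _ _ (lebesgue_stieltjes_measure F) _ mI mUI ni.
apply: (@le_trans _ _ (lebesgue_stieltjes_measure F (\bigcup_p grid_inner T U p))).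
  apply: le_measure; rewrite ?inE.
  - by apply: measurableI => //; exact: measurable_itv.
  - exact: bigcupT_measurable.
  - by apply: subset_trans (grid_inner_cover T0 oU); exact: setSI.
rewrite -(cvg_lim _ cvgI)//; apply: lime_le; first by apply/cvg_ex; eexists; exact: cvgI.
by apply: nearW => p; exact: Fp.
Qed.

Lemma stieltjes_density (F : cumulative R R) T : 0 < T ->
  absolutely_small (fun a b => F b - F a) T ->
  exists g : R -> R, mu.-integrable setT (EFin \o g) /\
    forall a b, 0 <= a -> a <= b -> b <= T ->
      (F b - F a)%:E = (\int[mu]_(t in `]a, b]) (g t)%:E)%E.
Proof.
move=> T0 smF.
have mT : measurable (`]0, T]%classic : set (measurableTypeR R)).
  exact: measurable_itv.
have Too : (lebesgue_stieltjes_measure F `]0%R, T] < +oo)%E.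
  by rewrite stieltjes_itvoc ?ltW// ltry.
pose nu := mfrestr mT Too.
have dom : nu `<< mu.
  apply/null_content_dominatesP => A mA A0.
  exact: (absolutely_small_dominated T0 smF mA A0).
have [g [g0 gfin gint gE]] := radon_nikodym_sigma_finite dom.
exists (fine \o g); have gg : EFin \o (fine \o g) = g.
  by apply/funext => t /=; rewrite fineK.
split; first by rewrite gg.
move=> a b a0 ab bT.
have -> : (\int[mu]_(t in `]a, b]) ((fine \o g) t)%:E = \int[mu]_(t in `]a, b]) g t)%E.
  by apply: eq_integral => t _ /=; rewrite fineK.
have mab : measurable (`]a, b]%classic : set (measurableTypeR R)).
  exact: measurable_itv.
rewrite -gE//.
rewrite -stieltjes_itvoc// /nu /mfrestr /mrestr; congr (lebesgue_stieltjes_measure F _).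
apply/esym/setIidPl => t; rewrite /= !in_itv/= => /andP[at_ tb].
by rewrite (le_lt_trans a0 at_) (le_trans tb bT).
Qed.

End radon_nikodym_stieltjes.

(** * An absolutely continuous function is the integral of its derivative *)

Section absolutely_continuous_density.
Context {R : realType}.
Implicit Types (f F : R -> R) (T a b : R).
Notation mu := (@lebesgue_measure R).

Definition clamp T x : R := Num.max 0 (Num.min x T).

Lemma clamp_itv T x : 0 <= T -> 0 <= clamp T x <= T.
Proof. by move=> T0; rewrite /clamp le_max lexx ge_max T0 ge_min lexx orbT. Qed.

Lemma clamp_id T x : 0 <= x -> x <= T -> clamp T x = x.
Proof. by move=> x0 xT; rewrite /clamp (min_idPl xT) (max_idPr x0). Qed.

Lemma clamp_le T x y : x <= y -> clamp T x <= clamp T y.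
Proof. by move=> xy; rewrite /clamp le_max2 ?le_min2. Qed.

Lemma clamp_lipschitz T x y : x <= y -> clamp T y - clamp T x <= y - x.
Proof.
move=> xy; rewrite /clamp.
have [yT|yT] := leP y T; have [xT|xT] := leP x T;
 have [?|?] := leP 0 y; have [?|?] := leP 0 x; have [?|?] := leP 0 T; lra.
Qed.

(** Composing with the projection onto [0, T] extends F to a monotone continuous function on the
    line, the form needed for a Stieltjes measure. *)
Lemma absolutely_small_continuous F T : 0 < T ->
  absolutely_small (fun a b => F b - F a) T ->
  (forall a b, 0 <= a -> a <= b -> b <= T -> F a <= F b) ->
  {homo F \o clamp T : x y / x <= y} /\ continuous (F \o clamp T).
Proof.
move=> T0 smF ndF0.
have ndF u v : u <= v -> F (clamp T u) <= F (clamp T v).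
  move=> uv; have /andP[u0 uT] := clamp_itv u (ltW T0).
  by have /andP[v0 vT] := clamp_itv v (ltW T0); apply: ndF0 => //; exact: clamp_le.
split; first exact: ndF.
move=> x; apply/cvgrPdist_le => e e0.
have [delta d0 H] := smF e e0.
have step u v : u <= v -> v - u < delta -> F (clamp T v) - F (clamp T u) <= e.
  move=> uv uvd.
  have /andP[u0 uT] := clamp_itv u (ltW T0).
  have /andP[v0 vT] := clamp_itv v (ltW T0).
  have := H unit (fun=> clamp T u) (fun=> clamp T v).
  rewrite !big_const /= card_unit /= !addr0; apply => //.
  - by move=> _; split=> //; exact: clamp_le.
  - by move=> [] [].
  - exact: le_lt_trans (clamp_lipschitz _ uv) _.
near=> y.
have xy : `|x - y| < delta by near: y; exact: cvgr_dist_lt.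
have [le_xy|/ltW le_yx] := leP x y => /=.
  rewrite ler0_norm ?opprB; last by rewrite subr_le0; exact: ndF.
  by apply: step => //; move: xy; rewrite distrC ltr_norml => /andP[].
rewrite ger0_norm; last by rewrite subr_ge0; exact: ndF.
by apply: step => //; move: xy; rewrite ltr_norml => /andP[].
Unshelve. all: by end_near. Qed.

Lemma monotone_density F T : 0 < T ->
  absolutely_small (fun a b => F b - F a) T ->
  (forall a b, 0 <= a -> a <= b -> b <= T -> F a <= F b) ->
  exists g : R -> R, mu.-integrable setT (EFin \o g) /\
    forall a b, 0 <= a -> a <= b -> b <= T ->
      (F b - F a)%:E = (\int[mu]_(t in `]a, b]) (g t)%:E)%E.
Proof.
move=> T0 smF ndF; have [ndG cG] := absolutely_small_continuous T0 smF ndF.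
have rcG : right_continuous (F \o clamp T) by apply: right_continuousW => x; exact: cG.
pose G : cumulative R R := HB.pack (F \o clamp T)
  (isCumulative.Build R _ R (F \o clamp T) ndG rcG).
have smG : absolutely_small (fun a b => G b - G a) T.
  move=> e e0; have [delta d0 H] := smF e e0; exists delta => // I a b ab tab sab.
  rewrite /= (eq_bigr (fun i => F (b i) - F (a i))); first exact: H.
  move=> i _; have [ai0 aibi biT] := ab i.
  by rewrite !clamp_id// ?(le_trans aibi) ?(le_trans ai0).
have [g [gint gE]] := stieltjes_density T0 smG.
exists g; split => // a b a0 ab bT; rewrite -gE//= !clamp_id//.
- exact: le_trans bT.
- exact: le_trans ab.
Qed.

(** With V(x) the variation of f on [0, x], f = V - (V - f) is a difference of nondecreasing
    absolutely continuous functions; subtract their densities. The derivative is then identified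
    almost everywhere by Lebesgue differentiation ([FTC1]). *)
Lemma absolutely_continuous_density f T : absolutely_continuous f -> 0 < T ->
  exists g : R -> R, [/\ mu.-integrable setT (EFin \o g),
    forall a b, 0 <= a -> a <= b -> b <= T ->
      (f b - f a)%:E = (\int[mu]_(t in `]a, b]) (g t)%:E)%E &
    {ae mu, forall x, 0 < x < T -> derive1 f x = g x}].
Proof.
move=> acf T0.
have smf := absolutely_continuous_small acf T0.
have smTV := absolutely_small_total_variation T0 smf.
have TVfin := total_variation_fin_num T0 smf.
pose V x := fine (total_variation 0 x f).
have VE a b : 0 <= a -> a <= b -> b <= T -> V b - V a = fine (total_variation a b f).
  move=> a0 ab bT; rewrite /V (total_variationD f a0 ab) fineD ?TVfin//.
    by rewrite addrC addKr.
  exact: le_trans bT.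
have fTV a b : 0 <= a -> a <= b -> b <= T -> `|f b - f a| <= V b - V a.
  by move=> a0 ab bT; rewrite VE// -lee_fin fineK ?TVfin// total_variation_ge.
have smV : absolutely_small (fun a b => V b - V a) T.
  move=> e e0; have [delta d0 H] := smTV e e0; exists delta => // I a b ab tab sab.
  rewrite (eq_bigr (fun i => fine (total_variation (a i) (b i) f))); first exact: H.
  by move=> i _; have [? ? ?] := ab i; rewrite VE.
(* An increment of V - f is at most twice that of V, hence the call with e / 2. *)
have smW : absolutely_small (fun a b => (V b - f b) - (V a - f a)) T.
  move=> e e0; have e20 : 0 < e / 2 by rewrite divr_gt0.
  have [delta d0 H] := smV _ e20; exists delta => // I a b ab tab sab.
  apply: (@le_trans _ _ (\sum_i (V (b i) - V (a i)) *+ 2)).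
    apply: ler_sum => i _; have [? ? ?] := ab i.
    have := fTV (a i) (b i); move=> /(_ _ _ _)/ler_normlP[//|//|//|].
    by rewrite mulr2n; lra.
  by have := H I a b ab tab sab; rewrite sumrMnl mulr2n; lra.
have [|g1 [g1i g1E]] := monotone_density T0 smV.
  by move=> a b a0 ab bT; rewrite -subr_ge0 (le_trans _ (fTV a b a0 ab bT)).
have [|g2 [g2i g2E]] := monotone_density T0 smW.
  move=> a b a0 ab bT; have := fTV a b a0 ab bT; have := ler_norm (f b - f a); lra.
have mitv a b : measurable (`]a, b]%classic : set (measurableTypeR R)).
  exact: measurable_itv.
have gi : mu.-integrable setT (EFin \o (g1 \- g2)).
  rewrite (_ : EFin \o _ = (EFin \o g1) \- (EFin \o g2))%E; first exact: integrableB.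
  by apply/funext.
have gE a b : 0 <= a -> a <= b -> b <= T ->
    (f b - f a)%:E = (\int[mu]_(t in `]a, b]) ((g1 \- g2) t)%:E)%E.
  move=> a0 ab bT; under eq_integral do rewrite /= EFinB.
  rewrite integralB//; last 2 first.
  - exact: integrableS g1i.
  - exact: integrableS g2i.
  by rewrite -g1E// -g2E// -EFinB; congr EFin; ring.
exists (g1 \- g2); split => //.
have lg := open_integrable_locally openT gi.
have ig y : mu.-integrable [set` Interval (BRight 0) (BRight y)] (EFin \o (g1 \- g2)).
  by apply: integrableS gi => //; exact: measurable_itv.
have := FTC1 ig lg; apply: filterS; first exact: (ae_filter_ringOfSetsType mu).
move=> x + /andP[x0 xT].
move=> H; have {H}[_ <-] := H x0.
have -> : derive1 f x = derive1 (fun y => f y - f 0) x.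
  rewrite /derive1 (_ : (fun h => h^-1 *: (f (h + x) - f x)) =
    (fun h => h^-1 *: (f (h + x) - f 0 - (f x - f 0))))//.
  by apply/funext => h; rewrite opprB addrA subrK.
rewrite !derive1E; apply: near_eq_derive.
near=> y; rewrite /Rintegral -gE ?lexx//.
- by apply/ltW; near: y; exact: lt_nbhsr.
- by apply/ltW; near: y; exact: lt_nbhsl.
Unshelve. all: by end_near. Qed.

End absolutely_continuous_density.

(** * Energy of a path: integral of the squared derivative versus squared increments *)

Section lower_integral.
Context d (T : measurableType d) (R : realType).
Variable mu : {measure set T -> \bar R}.
Local Open Scope ereal_scope.

(** The integral of a nonnegative function is a supremum over simple functions below it, hence
    monotone for arbitrary functions. This covers [derive1 f], whose measurability is not
    established here. *)
Lemma le_integral_nomeas (D1 D2 : set T) (f1 f2 : T -> \bar R) :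
  (forall x, D1 x -> 0 <= f1 x) -> (forall x, D2 x -> 0 <= f2 x) ->
  D1 `<=` D2 -> (forall x, D1 x -> f1 x <= f2 x) ->
  \int[mu]_(x in D1) f1 x <= \int[mu]_(x in D2) f2 x.
Proof.
move=> f10 f20 D12 f12; rewrite !ge0_integralE//; apply: le_ereal_sup => _ [h hf <-].
exists h => // x; apply: le_trans (hf x) _; rewrite !patchE.
case: ifPn => [/set_mem Dx|_].
  by rewrite mem_set; [exact: f12|exact: D12].
by case: ifPn => // /set_mem; exact: f20.
Qed.

End lower_integral.

Section energy.
Context {R : realType}.
Implicit Types (f g : R -> R) (a b c t : R).
Notation mu := (@lebesgue_measure R).

Lemma derive1_not_derivable f t : ~ derivable f t 1 -> derive1 f t = 0.
Proof.
move=> nd; rewrite derive1E /derive; apply: xgetPN => l fl; apply: nd.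
by apply/cvg_ex; exists l.
Qed.

Lemma integral_shift (f : R -> \bar R) (D : set R) c : measurable D ->
  measurable_fun setT f -> (forall x, 0 <= f x)%E ->
  (\int[mu]_(x in [set y | D (y + c)%R]) f (x + c)%R = \int[mu]_(x in D) f x)%E.
Proof.
move=> mD mf f0.
have mc : measurable_fun setT (fun y : R => y + c : measurableTypeR R).
  by apply: measurable_funD.
transitivity (\int[pushforward mu (fun y : R => (y + c)%R : measurableTypeR R)]_(x in D) f x)%E.
  by rewrite ge0_integral_pushforward//; exact: measurable_funS mf.
apply: eq_measure_integral => A mA AD.
apply/esym/lebesgue_measure_unique => //= _ [[a b]] _ <-.
rewrite /pushforward.
have -> : (fun y => y + c) @^-1` `](a, b).1, (a, b).2] = `](a - c), (b - c)]%classic.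
  by apply/seteqP; split => y /=; rewrite !in_itv/= ltrBlDr lerBrDr.
rewrite !lebesgue_measure_itv/= !lte_fin ltrD2r; case: ifP => // _.
by rewrite -!EFinD; congr EFin; ring.
Qed.

(** Riesz's description of the paths with f(0) = 0 and integral of f'^2 at most [c]. It involves
    finitely many values of f at a time, so it is stable under pointwise limits. Degenerate
    intervals contribute 0, since x / 0 = 0. *)
Definition energy_le f c := f 0 = 0 /\
  forall m (a b : 'I_m -> R), (forall i, 0 <= a i /\ a i <= b i) ->
    trivIset setT (fun i => `]a i, b i[%classic) ->
    \sum_i (f (b i) - f (a i)) ^+ 2 / (b i - a i) <= c.

Lemma energy_le_holder f c a b : energy_le f c -> 0 <= a -> a <= b ->
  (f b - f a) ^+ 2 <= c * (b - a).
Proof.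
move=> [_ H] a0; rewrite le_eqVlt => /predU1P[->|ab].
  by rewrite !subrr expr0n mulr0.
have := H 1%N (fun=> a) (fun=> b) (fun=> conj a0 (ltW ab)).
rewrite big_ord1 ler_pdivrMr ?subr_gt0//; apply.
by move=> i j _ _ _; rewrite (ord1 i) (ord1 j).
Qed.

Lemma energy_le_ge0 f c : energy_le f c -> 0 <= c.
Proof.
move=> H; have := energy_le_holder H (lexx 0) ler01; rewrite subr0 mulr1.
exact/le_trans/sqr_ge0.
Qed.

Lemma energy_le_grid f c h s m : energy_le f c -> 0 < h -> 0 <= s ->
  \sum_(k < m) (f (s + k.+1%:R * h) - f (s + k%:R * h)) ^+ 2 <= c * h.
Proof.
move=> [_ H] h0 s0.
have := H m (fun k => s + k%:R * h) (fun k => s + k.+1%:R * h) _ _.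
rewrite -ler_pdivrMr// mulr_suml => le_c.
rewrite (eq_bigr (fun k : 'I_m => (f (s + k.+1%:R * h) - f (s + k%:R * h)) ^+ 2 /
    (s + k.+1%:R * h - (s + k%:R * h)))).
  apply: le_c => [k|k k' _ _ [x /= []]].
    by split; [rewrite addr_ge0// mulr_ge0// ltW|rewrite lerD2l ler_pM2r// ler_nat].
  rewrite !in_itv/= => /andP[x1 x2] /andP[x3 x4]; apply/val_inj/eqP.
  have := lt_trans x1 x4; rewrite ltrD2l ltr_pM2r// ltr_nat ltnS => kk'.
  have := lt_trans x3 x2; rewrite ltrD2l ltr_pM2r// ltr_nat ltnS => k'k.
  by rewrite eqn_leq kk'.
by move=> k _; rewrite -natr1; congr (_ / _); ring.
Qed.

(* AM-GM: |D| <= (s D^2 / l + l / s) / 2 for an increment D over a length l *)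
Lemma energy_le_absolutely_continuous f c : energy_le f c -> absolutely_continuous f.
Proof.
move=> ef T T0 e e0; have c0 := energy_le_ge0 ef.
pose s := e / (c + 1); have s0 : 0 < s by rewrite divr_gt0//; lra.
exists (s * e); first by rewrite mulr_gt0.
move=> m a b ab tab sab.
have amgm i : `|f (b i) - f (a i)| <=
    (s * ((f (b i) - f (a i)) ^+ 2 / (b i - a i)) + (b i - a i) / s) / 2.
  have [_ + _] := ab i; rewrite le_eqVlt => /predU1P[->|lt_ab].
    by rewrite !subrr normr0 expr0n/= !mul0r mulr0 addr0 mul0r.
  set D := `|_|; have -> : (f (b i) - f (a i)) ^+ 2 = D ^+ 2 by rewrite real_normK ?num_real.
  have l0 : 0 < b i - a i by rewrite subr_gt0.
  set l := b i - a i in l0 *; rewrite -subr_ge0.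
  have -> : (s * (D ^+ 2 / l) + l / s) / 2 - D = (s * D - l) ^+ 2 / (2 * (s * l)).
    by field; rewrite !gt_eqF.
  by rewrite divr_ge0 ?sqr_ge0// mulr_ge0// mulr_ge0 ?ltW.
apply: le_lt_trans (ler_sum _ (fun i _ => amgm i)) _.
rewrite -mulr_suml big_split/= -mulr_sumr -mulr_suml.
have E := ef.2 m a b (fun i => let: And3 x y _ := ab i in conj x y) tab.
have sc : s * \sum_i (f (b i) - f (a i)) ^+ 2 / (b i - a i) < e.
  apply: (@le_lt_trans _ _ (s * c)); first by rewrite ler_pM2l.
  by rewrite /s mulrAC ltr_pdivrMr; [rewrite ltr_pM2l//; lra|lra].
have : (\sum_i (b i - a i)) / s < e by rewrite ltr_pdivrMr// mulrC.
lra.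
Qed.

(** Cauchy-Schwarz, obtained by integrating g^2 >= 2 q g - q^2 with q the mean slope of f on
    [a, b]. *)
Lemma sqr_increment_le (g : R -> R) f a b : a <= b ->
  mu.-integrable setT (EFin \o g) ->
  (f b - f a)%:E = (\int[mu]_(t in `]a, b]) (g t)%:E)%E ->
  (((f b - f a) ^+ 2 / (b - a))%:E <= \int[mu]_(t in `]a, b[) (g t ^+ 2)%:E)%E.
Proof.
rewrite le_eqVlt => /predU1P[->|ab] gi fg.
  by rewrite !subrr invr0 mulr0; apply: integral_ge0 => t _; rewrite lee_fin sqr_ge0.
have l0 : 0 < b - a by rewrite subr_gt0.
have mg : measurable_fun setT g by apply/measurable_EFinP; exact: measurable_int gi.
have mab : measurable (`]a, b[%classic : set (measurableTypeR R)).
  exact: measurable_itv.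
have mg2 : measurable_fun setT (fun t => (g t ^+ 2)%:E).
  by apply/measurable_EFinP; exact: measurable_funX.
have [|g2oo] := leP +oo%E (\int[mu]_(t in `]a, b[) (g t ^+ 2)%:E)%E.
  by rewrite leye_eq => /eqP ->; rewrite leey.
pose q := (f b - f a) / (b - a).
have g2i : mu.-integrable `]a, b[ (fun t => (g t ^+ 2)%:E).
  apply/integrableP; split; first exact: measurable_funS mg2.
  by under eq_integral do rewrite /= ger0_norm ?sqr_ge0//.
have muab : mu `]a, b[ = (b - a)%:E.
  by rewrite lebesgue_measure_itv/= lte_fin ab -EFinB.
have ci : mu.-integrable `]a, b[ (cst (q ^+ 2)%:E).
  apply/integrableP; split; first exact: measurable_cst.
  by rewrite integral_cst// [X in (_ * X)%E]muab -EFinM ltry.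
have gi' : mu.-integrable `]a, b[ (EFin \o g) by exact: integrableS gi.
have : (\int[mu]_(t in `]a, b[) ((2 * q)%:E * (g t)%:E - (q ^+ 2)%:E) <=
    \int[mu]_(t in `]a, b[) (g t ^+ 2)%:E)%E.
  apply: le_integral => //.
    by apply: integrableB => //; exact: integrableZl.
  move=> t _; rewrite -EFinM -EFinB lee_fin -subr_ge0.
  have -> : g t ^+ 2 - (2 * q * g t - q ^+ 2) = (g t - q) ^+ 2 by ring.
  exact: sqr_ge0.
rewrite integralB//; last exact: integrableZl.
rewrite integralZl// integral_cst// [X in (_ - _ * X)%E]muab.
rewrite (@integral_itv_bndo_bndc _ _ b (fun t => (g t)%:E)); last first.
  by apply/measurable_EFinP; exact: measurable_funS mg.
rewrite -fg -!EFinM -EFinB; apply: le_trans; rewrite lee_fin.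
rewrite le_eqVlt; apply/orP; left; apply/eqP; rewrite /q; field.
by rewrite gt_eqF.
Qed.

Lemma integral_derive_energy_le f c : f 0 = 0 -> absolutely_continuous f ->
  (\int[mu]_(t in `[0%R, +oo[) (derive1 f t ^+ 2)%:E <= c%:E)%E -> energy_le f c.
Proof.
move=> f0 acf ifc; split => // m a b ab tab.
(* A horizon containing all the intervals; the 1 keeps it positive for an empty family. *)
pose T := 1 + \sum_i b i.
have b0 i : 0 <= b i by have [? ?] := ab i; exact: le_trans (ab i).2.
have T0 : 0 < T by rewrite ltr_pwDl// sumr_ge0.
have bT i : b i <= T.
  by rewrite /T (bigD1 i)//= addrCA lerDl addr_ge0// sumr_ge0.
have [g [gi fg aeg]] := absolutely_continuous_density acf T0.
have mg : measurable_fun setT g by apply/measurable_EFinP; exact: measurable_int gi.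
have mg2 : measurable_fun setT (fun t => (g t ^+ 2)%:E).
  by apply/measurable_EFinP; exact: measurable_funX.
have mitv u v : measurable (`]u, v[%classic : set (measurableTypeR R)).
  exact: measurable_itv.
rewrite -lee_fin -sumEFin.
apply: (@le_trans _ _ (\sum_i \int[mu]_(t in `]a i, b i[) (g t ^+ 2)%:E)%E).
  apply: lee_sum => i _; have [ai aibi] := ab i.
  by apply: sqr_increment_le => //; exact: fg.
have [N [mN N0 subN]] := aeg.
pose F i : set (measurableTypeR R) := `]a i, b i[%classic.
rewrite -(@ge0_integral_bigsetU _ _ _ mu _ F (fun t => (g t ^+ 2)%:E) (index_enum _)); first last.
- by move=> t _; rewrite lee_fin sqr_ge0.
- exact: measurable_funS mg2.
- exact: sub_trivIset tab.
- exact: index_enum_uniq.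
- by move=> i; exact: mitv.
apply: (@le_trans _ _ (\int[mu]_(t in `]0%R, T[) (g t ^+ 2)%:E)%E).
  apply: le_integral_nomeas => //; [by move=> t _; rewrite lee_fin sqr_ge0..|].
  rewrite -bigcup_seq => t [i _]; rewrite /F/= !in_itv/= => /andP[at_ tb].
  by rewrite (le_lt_trans (ab i).1 at_) (lt_le_trans tb (bT i)).
(* Discard the null set [N], outside which the density [g] is [derive1 f]. *)
rewrite (@ge0_negligible_integral _ _ _ mu _ N)//; last 2 first.
- exact: measurable_funS mg2.
- by move=> t _; rewrite lee_fin sqr_ge0.
apply: le_trans ifc; apply: le_integral_nomeas.
- by move=> t _; rewrite lee_fin sqr_ge0.
- by move=> t _; rewrite lee_fin sqr_ge0.
- by move=> t [/=]; rewrite !in_itv/= => /andP[/ltW-> _].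
- move=> t [/=]; rewrite in_itv/= => t0T Nt; rewrite lee_fin.
  suff -> : derive1 f t = g t by [].
  by apply: contrapT => fgt; apply: Nt; apply: subN => H; apply: fgt; exact: H.
Qed.

(** Cut the half-line into cells of length h and translate them all to [0, h[. For each t there, the
    squared increments along the grid t + k h sum to at most c h; divide by h^2 and integrate over a
    set of length h. *)
Lemma integral_difference_quotient_le f c h : continuous f -> energy_le f c ->
  0 < h ->
  (\int[mu]_(t in `[0%R, +oo[) (((f (h + t)%R - f t) / h) ^+ 2)%:E <= c%:E)%E.
Proof.
move=> cf ef h0.
pose q t := (((f (h + t) - f t) / h) ^+ 2)%:E.
have mf : measurable_fun setT f by exact: continuous_measurable_fun.
have mq : measurable_fun setT q.
  apply/measurable_EFinP; apply: measurable_funX; apply: measurable_funM => //.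
  by apply: measurable_funB => //; apply: measurableT_comp => //; exact: measurable_funD.
have q0 t : (0 <= q t)%E by rewrite lee_fin sqr_ge0.
have mitv x u v : measurable ([set` Interval (BSide x u) (BSide true v)] : set (measurableTypeR R)).
  exact: measurable_itv.
pose F k : set (measurableTypeR R) := `[(k%:R * h), (k.+1%:R * h)[%classic.
have FE : `[0%R, +oo[%classic = \bigcup_k F k.
  apply/seteqP; split => [t|t [k _]]; rewrite /F /= !in_itv/= ?andbT.
    move=> t0; exists (Num.truncn (t / h)) => //=; rewrite in_itv/=.
    have /andP[t1 t2] := truncn_itv (divr_ge0 t0 (ltW h0)).
    by rewrite -ler_pdivlMr// t1 -ltr_pdivrMr.
  by move=> /andP[+ _]; apply: le_trans; rewrite mulr_ge0// ltW.
have tF : trivIset setT F.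
  move=> k k' _ _ [t []]; rewrite /F /= !in_itv/= => /andP[t1 t2] /andP[t3 t4].
  have := le_lt_trans t1 t4; rewrite ltr_pM2r// ltr_nat ltnS => kk'.
  have := le_lt_trans t3 t2; rewrite ltr_pM2r// ltr_nat ltnS => k'k.
  by apply/eqP; rewrite eqn_leq kk'.
have mF k : measurable (F k) by exact: mitv.
rewrite -[leLHS]/(\int[mu]_(t in `[0%R, +oo[) q t)%E FE ge0_integral_bigcup//; last first.
  exact: measurable_funS mq.
apply: lime_le; first by apply: is_cvg_nneseries => k _ _; exact: integral_ge0.
apply: nearW => m.
have shift k : (\int[mu]_(t in F k) q t = \int[mu]_(t in `[0%R, h[) q (t + k%:R * h)%R)%E.
  rewrite -(@integral_shift q (F k) (k%:R * h) (mF k) mq q0).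
  congr (integral mu _ _); apply/seteqP; split => t; rewrite /F/= !in_itv/=.
    by rewrite lerDr -natr1 mulrDl mul1r addrC ltrD2l.
  by rewrite lerDr -natr1 mulrDl mul1r [t + _]addrC ltrD2l.
have mqk k : measurable_fun setT (fun t => q (t + k%:R * h)).
  by apply: measurableT_comp => //; exact: measurable_funD.
under eq_bigr => k _ do rewrite shift.
rewrite big_mkord -ge0_integral_sum//; last first.
  by move=> k; exact: measurable_funS (mqk k).
apply: (@le_trans _ _ (\int[mu]_(t in `[0%R, h[) (c / h)%:E)%E).
  apply: ge0_le_integral => //.
  - by move=> t _; exact: sume_ge0.
  - by apply: emeasurable_sum => k; exact: measurable_funS (mqk k).
  - move=> t; rewrite /= in_itv/= => /andP[t0 _].
    rewrite /q sumEFin lee_fin -(ler_pM2r (exprn_gt0 2 h0)) mulr_suml.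
    have -> : c / h * h ^+ 2 = c * h by field; rewrite gt_eqF.
    apply: le_trans (energy_le_grid m ef h0 t0); rewrite le_eqVlt; apply/orP; left.
    apply/eqP/eq_bigr => k _; rewrite -exprMn mulfVK ?gt_eqF//.
    by congr ((f _ - _) ^+ 2); rewrite -natr1; ring.
rewrite integral_cst//= lebesgue_measure_itv/= lte_fin h0 -EFinB subr0 -EFinM lee_fin.
by rewrite mulfVK// gt_eqF.
Qed.

Lemma derive1_seq f t : derivable f t 1 ->
  (fun n : nat => (f (n.+1%:R^-1 + t) - f t) / n.+1%:R^-1) @ \oo --> derive1 f t.
Proof.
move=> ft; pose h n : R := n.+1%:R^-1.
have hc : h @ \oo --> 0^'.
  move=> A [e /= e0 HA]; have := near_infty_natSinv_lt (PosNum e0).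
  apply: filterS => n /= hn; apply: HA; last by rewrite /= gt_eqF ?invr_gt0.
  by rewrite /ball_/= sub0r normrN gtr0_norm ?invr_gt0.
have fc : (fun u => u^-1 *: (f (u + t) - f t)) @ 0^' --> derive1 f t.
  move: ft; rewrite /derivable /derive1; under eq_fun do rewrite [_%:A]mulr1.
  by [].
have := cvg_comp _ _ hc fc; apply: cvg_trans.
by apply: near_eq_cvg; apply: nearW => n /=; rewrite /GRing.scale/= mulrC.
Qed.

(** Fatou's lemma for the difference quotients of step 1/(n+1). Where f has no derivative
    [derive1 f] takes the default value 0, so the squared derivative is below the lower limit
    everywhere. *)
Lemma energy_le_integral_derive f c : continuous f -> energy_le f c ->
  (\int[mu]_(t in `[0%R, +oo[) (derive1 f t ^+ 2)%:E <= c%:E)%E.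
Proof.
move=> cf ef; pose h n : R := n.+1%:R^-1.
have h0 n : 0 < h n by rewrite invr_gt0.
pose q n t := (((f (h n + t) - f t) / h n) ^+ 2)%:E.
have mf : measurable_fun setT f by exact: continuous_measurable_fun.
have mq n : measurable_fun setT (q n).
  apply/measurable_EFinP; apply: measurable_funX; apply: measurable_funM => //.
  by apply: measurable_funB => //; apply: measurableT_comp => //; exact: measurable_funD.
have q0 n t : (0 <= q n t)%E by rewrite lee_fin sqr_ge0.
apply: (@le_trans _ _ (\int[mu]_(t in `[0%R, +oo[) limn_einf (q ^~ t))%E).
  have einf0 t : (0 <= limn_einf (q ^~ t))%E.
    rewrite limn_einf_lim; apply: lime_ge; first exact: is_cvg_einfs.
    by apply: nearW => n; apply: le_ereal_inf_tmp => _ [k _ <-].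
  apply: le_integral_nomeas => // [t _|t _]; first by rewrite lee_fin sqr_ge0.
  have [ft|/derive1_not_derivable->] := pselect (derivable f t 1); last first.
    by rewrite expr0n.
  have cq := derive1_seq ft.
  have cq2 : (fun n => q n t) @ \oo --> (derive1 f t ^+ 2)%:E.
    apply: cvg_EFin; first exact: nearW.
    by apply: (@cvg_trans _ _ _ _ _ (cvgM cq cq)).
  by rewrite (cvg_limn_einf_sup cq2).1.
apply: le_trans (fatou _ _ _ _) _ => //.
- by move=> n; exact: measurable_funS (mq n).
rewrite limn_einf_lim; apply: lime_le; first exact: is_cvg_einfs.
apply: nearW => n; apply: (@le_trans _ _ (\int[mu]_(t in `[0%R, +oo[) q n t)%E).
  by apply: ereal_inf_lbound; exists n => /=.
exact: integral_difference_quotient_le.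
Qed.

End energy.

(** * Level sets of the rate function in the weighted uniform topology *)

Section rate_function.
Context {R : realType}.
Implicit Types (c e t : R).
Notation mu := (@lebesgue_measure R).
Notation C := (Cspace (0 : R)).

Lemma rate_I0P (sigma2 : R) (f : halfline_fun R) r : 0 < sigma2 ->
  (rate_I0 sigma2 f <= r%:E)%E <-> energy_le f (2 * sigma2 * r).
Proof.
move=> s0; have s20 : 0 < 2 * sigma2 by rewrite mulr_gt0.
rewrite /rate_I0; split.
  case: asboolP => // -[f0 acf]; rewrite lee_pdivrMl// -EFinM.
  exact: integral_derive_energy_le.
move=> ef; rewrite asboolT; last first.
  by split; [exact: ef.1|exact: energy_le_absolutely_continuous ef].
rewrite lee_pdivrMl// -EFinM.
apply: energy_le_integral_derive ef; exact: halfline_continuous.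
Qed.

Lemma rate_I0_ge0 (sigma2 : R) (f : halfline_fun R) : 0 < sigma2 ->
  (0 <= rate_I0 sigma2 f)%E.
Proof.
move=> s0; rewrite /rate_I0; case: asboolP => // _.
apply: mule_ge0; first by rewrite lee_fin invr_ge0 mulr_ge0// ltW.
by apply: integral_ge0 => t _; rewrite lee_fin sqr_ge0.
Qed.

Lemma rho0_lt (f g : halfline_fun R) e t : (rho 0 f g < e%:E)%E -> 0 <= t ->
  `|f t - g t| < e * (1 + t).
Proof.
move=> fg t0; have t1 : 0 < 1 + t by rewrite ltr_pwDl.
rewrite -ltr_pdivrMr// -lte_fin; apply: le_lt_trans fg.
apply: ereal_sup_ubound; exists t => /=; first by rewrite in_itv/= t0.
by rewrite addr0 powRr1.
Qed.

Lemma rho0_le (f g : halfline_fun R) e : (forall t, 0 <= t -> `|f t - g t| <= e * (1 + t)) ->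
  (rho 0 f g <= e%:E)%E.
Proof.
move=> H; apply: ge_ereal_sup => _ [t /= t0 <-]; rewrite in_itv/= andbT in t0.
by rewrite addr0 powRr1// lee_fin ler_pdivrMr ?H// ltr_pwDl.
Qed.

Lemma Cspace_ballP (f g : C) e : ball f e g <-> (rho 0 f g < e%:E)%E.
Proof. by []. Qed.

Lemma evaluation_continuous t : 0 <= t -> continuous (fun f : C => (f : halfline_fun R) t).
Proof.
move=> t0 f; have FF : Filter (nbhs (f : C)) by exact: nbhs_filter.
apply/cvgrPdist_lt => e e0; have t1 : 0 < 1 + t by rewrite ltr_pwDl.
have e1 : 0 < e / (1 + t) by rewrite divr_gt0.
apply: filterS (nbhsx_ballx (f : C) _ e1) => g /Cspace_ballP fg.
have := rho0_lt fg t0.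
by rewrite mulfVK// gt_eqF.
Qed.

Lemma holder_half_continuous (g : R -> R) c :
  (forall u v, u <= v -> (g v - g u) ^+ 2 <= c * (v - u)) -> continuous g.
Proof.
move=> H x; apply/cvgrPdist_lt => e e0.
have c0 : 0 <= c by have := H 0 1 ler01; rewrite subr0 mulr1; exact/le_trans/sqr_ge0.
have c1 : 0 < c + 1 by lra.
near=> y.
have xy : `|x - y| < e ^+ 2 / (c + 1).
  by near: y; apply: cvgr_dist_lt => //; rewrite divr_gt0// exprn_gt0.
have key : (g x - g y) ^+ 2 <= c * `|x - y|.
  have [le_xy|/ltW le_yx] := leP x y.
    by rewrite distrC ger0_norm ?subr_ge0// -sqrrN opprB H.
  by rewrite ger0_norm ?subr_ge0// H.
rewrite -(ltr_pXn2r (n := 2)) ?nnegrE ?(ltW e0)// real_normK ?num_real//.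
apply: le_lt_trans key _; apply: (@le_lt_trans _ _ ((c + 1) * `|x - y|)).
  by rewrite ler_wpM2r//; lra.
by rewrite mulrC -ltr_pdivlMr.
Unshelve. all: by end_near. Qed.

Lemma holder_abs_le c t y : 0 <= t -> y ^+ 2 <= c * t -> `|y| <= 1 + c * t.
Proof.
move=> t0 yc; have : `|y| ^+ 2 <= c * t by rewrite real_normK ?num_real.
have : 0 <= (`|y| - 1) ^+ 2 by exact: sqr_ge0.
have := normr_ge0 y; rewrite !expr2; nra.
Qed.

Lemma energy_le_family_cvg (T : Type) (F : set_system T) (FF : ProperFilter F)
    (phi : T -> R -> R) (g : R -> R) c :
  (forall t, 0 <= t -> (phi f t) @[f --> F] --> g t) ->
  F [set f | energy_le (phi f) c] -> energy_le g c.
Proof.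
move=> cg Fe; split.
  apply: (@cvg_unique _ (@Rhausdorff R) _ _ _ _ (cg 0 (lexx _))).
  apply: cvg_near_cst; apply: filterS Fe => f ef; exact: ef.1.
move=> m a b ab tab.
have cs : (\sum_i (phi f (b i) - phi f (a i)) ^+ 2 / (b i - a i)) @[f --> F] -->
    \sum_i (g (b i) - g (a i)) ^+ 2 / (b i - a i).
  apply: (cvg_big (op := +%R)) => [|i _]; first exact: add_continuous.
  apply: cvgM; last exact: cvg_cst.
  have [ai aibi] := ab i.
  have cd : (phi f (b i) - phi f (a i)) @[f --> F] --> g (b i) - g (a i).
    by apply: cvgB; apply: cg => //; exact: le_trans aibi.
  rewrite expr2; under eq_fun do rewrite expr2; exact: cvgM.
apply: (cvgr_to_le cs); apply: filterS Fe => f ef; exact: ef.2.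
Qed.

Lemma norm_le_of_sqr (y z : R) : 0 <= z -> y ^+ 2 <= z ^+ 2 -> `|y| <= z.
Proof. by move=> z0; rewrite -[leLHS]real_normK ?num_real// ler_pXn2r ?nnegrE. Qed.

(** The Hoelder bound from the origin gives f(t)^2 <= c t <= (e t)^2: a level set is uniformly small
    at infinity relative to the weight 1 + t. *)
Lemma energy_le_tail (f : R -> R) c e t : energy_le f c -> 0 < e -> 0 <= t ->
  c <= e ^+ 2 * t -> `|f t| <= e * (1 + t).
Proof.
move=> ef e0 t0 ct; apply: norm_le_of_sqr.
  by rewrite mulr_ge0 ?(ltW e0)// addr_ge0.
have := energy_le_holder ef (lexx 0) t0; rewrite ef.1 !subr0 => /le_trans; apply.
rewrite exprMn; apply: (@le_trans _ _ (e ^+ 2 * t * t)); first by rewrite ler_wpM2r.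
by rewrite -mulrA ler_wpM2l ?sqr_ge0// expr2 ler_pM// lerDr.
Qed.

(** Equicontinuity: both functions move by at most [eta] within a grid cell, so closeness at the
    nodes gives closeness in between. *)
Lemma energy_le_grid_close (f g : R -> R) c (h eta : R) (N : nat) t :
  energy_le f c -> energy_le g c -> 0 < h -> 0 <= eta -> c * h <= eta ^+ 2 ->
  (forall k, (k <= N)%N -> `|f (k%:R * h) - g (k%:R * h)| <= eta) ->
  0 <= t -> t <= N%:R * h -> `|f t - g t| <= 3 * eta.
Proof.
move=> ef eg h0 eta0 ch fg t0 tN.
pose k := Num.truncn (t / h).
have /andP[k1 k2] := truncn_itv (divr_ge0 t0 (ltW h0)).
have kt : k%:R * h <= t by rewrite -ler_pdivlMr.
have kN : (k <= N)%N by rewrite -(ler_nat R) -(ler_pM2r h0) (le_trans kt).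
have tk : t - k%:R * h <= h.
  by move: k2; rewrite ltr_pdivrMr// -natr1 mulrDl mul1r -/k => k2; lra.
have near u : energy_le u c -> `|u t - u (k%:R * h)| <= eta.
  move=> eu; apply: norm_le_of_sqr => //; apply: le_trans ch.
  apply: le_trans (energy_le_holder eu _ kt) _; first by rewrite mulr_ge0// ltW.
  by rewrite ler_wpM2l// (energy_le_ge0 ef).
have -> : f t - g t = (f t - f (k%:R * h)) + (f (k%:R * h) - g (k%:R * h))
   - (g t - g (k%:R * h)) by ring.
apply: le_trans (ler_normB _ _) _; apply: le_trans (lerD (ler_normD _ _) (lexx _)) _.
by have := near f ef; have := near g eg; have := fg k kN; lra.
Qed.

(** Arzela-Ascoli with ultrafilters: point values are bounded and so converge; the limit inherits
    the energy bound and is therefore continuous. Closeness at finitely many grid points, the common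
    modulus and [energy_le_tail] upgrade this to convergence in [rho]. *)
Lemma energy_level_compact c : compact [set f : C | energy_le f c].
Proof.
rewrite compact_ultra => F FU FK.
have PF : ProperFilter F by exact: ultra_proper.
have evalc t : exists y : R, (f : C) t @[f --> F] --> y.
  have [M HM] : exists M, F [set f : C | `|f t| <= M].
    exists (1 + c * `|t|); apply: filterS FK => f ef /=.
    have [t0|t0] := leP 0 t.
      apply: holder_abs_le => //; have := energy_le_holder ef (lexx 0) t0.
      by rewrite ef.1 !subr0 ger0_norm.
    rewrite halfline_lt0// ef.1 normr0 addr_ge0// mulr_ge0//.
    exact: energy_le_ge0 ef.
  have HM' : F ((fun f : C => f t) @^-1` `[- M, M]).
    by apply: filterS HM => f; rewrite /= ler_norml in_itv.
  (* The image filter clusters in a compact segment, and for an ultrafilter a cluster point is a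
     limit. *)
  have [|y [_ Fy]] := @segment_compact R (- M) M ((fun f : C => f t) @ F) _.
    exact: HM'.
  exists y => U /= yU; have [//|nU] := in_ultra_setVsetC ((fun f : C => f t) @^-1` U) FU.
  by have [z [nUz /nUz]] := Fy (~` U) U nU yU.
have [g Fg] := choice evalc.
have g_lt0 t : t < 0 -> g t = g 0.
  move=> t0; apply: (@cvg_unique _ (@Rhausdorff R) _ _ _ _ (Fg t)).
  have : f 0 @[f --> F] --> g 0 by exact: Fg.
  by apply: cvg_trans; apply: near_eq_cvg; apply: nearW => f /=; rewrite halfline_lt0.
have eg : energy_le g c.
  by apply: (@energy_le_family_cvg C F PF (fun f : C => f)) => //.
have c0 := energy_le_ge0 eg.
have gc : continuous g.
  apply: (@holder_half_continuous _ c) => u v uv.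
  have [u0|u0] := leP 0 u; first exact: energy_le_holder.
  have [v0|v0] := leP 0 v.
    rewrite (g_lt0 _ u0); apply: le_trans (energy_le_holder eg (lexx 0) v0) _.
    by rewrite ler_wpM2l// lerD2l lerN2 ltW.
  by rewrite (g_lt0 _ u0) (g_lt0 _ v0) subrr expr0n mulr_ge0// subr_ge0.
pose G : C := HalflineFun gc g_lt0.
exists G; split; first exact: eg.
apply/cvg_ballP => e e0.
(* The mesh [h] makes the oscillation per cell at most [e8], and beyond N h every path of the level
   set is below e8 (1 + t); 3 e8 on the grid and 2 e8 beyond both stay below e / 2. *)
pose e8 := e / 8; have e80 : 0 < e8 by rewrite divr_gt0.
pose h := e8 ^+ 2 / (c + 1); have h0 : 0 < h by rewrite divr_gt0 ?exprn_gt0//; lra.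
have ch : c * h <= e8 ^+ 2.
  by rewrite /h mulrA ler_pdivrMr; [rewrite mulrC ler_wpM2l ?sqr_ge0//; lra|lra].
pose N := (Num.truncn (c / e8 ^+ 2 / h)).+1.
have Nh t : N%:R * h <= t -> c <= e8 ^+ 2 * t.
  move=> Nt; rewrite mulrC -ler_pdivrMr ?exprn_gt0//; apply: le_trans Nt.
  by rewrite -ler_pdivrMr// ltW// truncnS_gt.
have : \forall f \near F, forall k : 'I_N.+1, `|(f : C) (k%:R * h) - g (k%:R * h)| <= e8.
  apply: filter_forall => k; have := Fg (k%:R * h) => /cvgrPdist_le/(_ _ e80).
  by apply: filterS => f; rewrite distrC.
move=> Fk; apply: filterS2 FK Fk => f ef fg.
apply/Cspace_ballP; apply: (@le_lt_trans _ _ (e / 2)%:E); last by rewrite lte_fin; lra.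
apply: rho0_le => t t0 /=; have [tN|tN] := leP t (N%:R * h).
  rewrite distrC; apply: le_trans (energy_le_grid_close ef eg h0 (ltW e80) ch _ t0 tN) _.
    by move=> k kN; exact: (fg (Ordinal (kN : (k < N.+1)%N))).
  by rewrite /e8; nra.
apply: le_trans (ler_normB _ _) _.
have := energy_le_tail eg e80 t0 (Nh _ (ltW tN)).
by have := energy_le_tail ef e80 t0 (Nh _ (ltW tN)); rewrite /e8; nra.
Qed.

Lemma energy_level_closed c : closed [set f : C | energy_le f c].
Proof.
move=> f /within_nbhs_proper PF.
apply: (@energy_le_family_cvg C (within [set f : C | energy_le f c] (nbhs (f : C)))
  PF (fun f : C => f)).
  by move=> t t0; apply: cvg_within_filter; exact: evaluation_continuous.
by rewrite /within/=; apply: filterE.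
Qed.

Lemma rate_I0_good (sigma2 : R) : 0 < sigma2 ->
  good_rate_function (E := C) (rate_I0 sigma2).
Proof.
move=> s0; have levelE r : [set f : C | (rate_I0 sigma2 f <= r%:E)%E] =
    [set f : C | energy_le f (2 * sigma2 * r)].
  by apply/seteqP; split => f /= /rate_I0P; exact.
split.
- by move=> f; exact: rate_I0_ge0.
- move=> f a af; exists [set g : C | (a%:E < rate_I0 sigma2 g)%E] => //.
  have -> : [set g : C | (a%:E < rate_I0 sigma2 g)%E] =
      ~` [set g : C | energy_le g (2 * sigma2 * a)].
    rewrite -levelE; apply/seteqP; split => g /=; rewrite leNgt.
      by move=> ag; apply/negP; rewrite negbK.
    by move/negP; rewrite negbK.
  apply: open_nbhs_nbhs; split.
    by apply: closed_openC; exact: energy_level_closed.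
  by rewrite -levelE /= leNgt => /negP; rewrite af.
- by move=> r r0; rewrite levelE; exact: energy_level_compact.
Qed.

(** Each point of [K] has a ball missing [B]; halving the radius makes the choice locally uniform,
    and compactness makes it uniform. *)
Lemma compact_ball_separated (K B : set C) : compact K ->
  (forall f, K f -> ~ closure B f) ->
  exists2 e, 0 < e & forall f g, K f -> B g -> ~ ball (f : C) e g.
Proof.
move=> /compact_near_coveringP cK KB.
have He : \forall e \near (0 : R)^'+, K `<=` (fun f => forall g, B g -> ~ ball (f : C) e g).
  apply: cK => f Kf; have := KB f Kf => /existsNP[V /not_implyP[fV nBV]].
  have /nbhs_ballP[e0 /= e00 He] := fV.
  have e20 : 0 < e0 / 2 by rewrite divr_gt0.
  near=> f' e => g Bg f'g; apply: nBV; exists g; split => //; apply: He.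
  have ff' : ball (f : C) (e0 / 2) f' by near: f'; exact: nbhsx_ballx.
  have ee : e <= e0 / 2 by near: e; apply: nbhs_right_le.
  rewrite [e0]splitr; apply: ball_triangle ff' _; exact: le_ball ee _ f'g.
near (0 : R)^'+ => e; exists e => // f g Kf Bg.
have : K `<=` (fun f => forall g, B g -> ~ ball (f : C) e g) by near: e.
by move=> /(_ f Kf g Bg).
Unshelve. all: by end_near. Qed.

(** * Polylines on a uniform grid and their energy *)

(** [d k] is the increment over [k h, (k+1) h], and the function is constant before 0 and after m h.
    As a sum of ramps it is continuous and Lipschitz term by term. *)
Definition polyline (h : R) (m : nat) (d : nat -> R) t : R :=
  \sum_(k < m) d k * (clamp h (t - k%:R * h) / h).

Lemma clamp_continuous (h : R) : continuous (clamp h).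
Proof.
move=> u; apply: (@continuous_max _ _ (cst 0) (fun u => Num.min u h)).
  exact: cst_continuous.
by apply: (@continuous_min _ _ id (cst h)); [exact: cvg_id|exact: cst_continuous].
Qed.

Lemma polyline_continuous h m d : continuous (polyline h m d).
Proof.
move=> t; apply: (cvg_big (op := +%R)) => [|k _]; first exact: add_continuous.
apply: cvgM; first exact: cvg_cst.
apply: cvgM; last exact: cvg_cst.
apply: (@continuous_comp _ _ _ (fun u => u - k%:R * h) (clamp h)).
  by apply: cvgB; [exact: cvg_id|exact: cvg_cst].
exact: clamp_continuous.
Qed.

Lemma clamp_le0 (h u : R) : u <= 0 -> clamp h u = 0.
Proof. by move=> u0; rewrite /clamp (max_idPl _)// ge_min u0. Qed.

Lemma clamp_ge (h u : R) : 0 <= h -> h <= u -> clamp h u = h.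
Proof. by move=> h0 hu; rewrite /clamp (min_idPr hu) (max_idPr h0). Qed.

Lemma polyline_le0 h m d t : 0 < h -> t <= 0 -> polyline h m d t = 0.
Proof.
move=> h0 t0; rewrite /polyline big1// => k _.
rewrite clamp_le0 ?mul0r ?mulr0// subr_le0 (le_trans t0)// mulr_ge0//.
exact: ltW.
Qed.

Lemma polyline_itv h m d t j : 0 < h -> (j < m)%N ->
  j%:R * h <= t -> t <= j.+1%:R * h ->
  polyline h m d t = \sum_(k < j) d k + d j * ((t - j%:R * h) / h).
Proof.
move=> h0 jm jt tj; rewrite /polyline.
rewrite -(big_mkord xpredT (fun k => d k * (clamp h (t - k%:R * h) / h))).
rewrite (big_cat_nat (leq0n j) (ltnW jm))/= (big_ltn jm) [X in _ + (_ + X)]big_nat.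
rewrite [X in _ + (_ + X)]big1 ?addr0; last first.
  move=> k /andP[jk _]; rewrite clamp_le0 ?mul0r ?mulr0// subr_le0.
  by rewrite (le_trans tj)// ler_pM2r// ler_nat.
congr (_ + d j * (_ / h)); last first.
  rewrite clamp_id ?subr_ge0//; move: tj; rewrite -natr1; lra.
rewrite -[RHS](big_mkord xpredT d) big_nat [RHS]big_nat.
apply: eq_bigr => k /andP[_ kj]; rewrite clamp_ge ?(ltW h0) ?divff ?mulr1 ?gt_eqF//.
rewrite lerBrDr -[X in X + _]mul1r -mulrDl addrC natr1 (le_trans _ jt)//.
by rewrite ler_pM2r// ler_nat.
Qed.

Lemma polyline_ge h m d t : 0 < h -> m%:R * h <= t ->
  polyline h m d t = \sum_(k < m) d k.
Proof.
move=> h0 mt; apply: eq_bigr => k _.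
rewrite clamp_ge ?(ltW h0) ?divff ?mulr1 ?gt_eqF//.
rewrite lerBrDr -[X in X + _]mul1r -mulrDl addrC natr1 (le_trans _ mt)//.
by rewrite ler_pM2r// ler_nat ltn_ord.
Qed.

Lemma lipschitz_absolutely_continuous (f : R -> R) (M : R) :
  (forall u t, u <= t -> `|f t - f u| <= M * (t - u)) -> absolutely_continuous f.
Proof.
move=> H T T0 e e0.
have M0 : 0 <= M by have := H 0 1 ler01; rewrite subr0 mulr1; exact: le_trans.
exists (e / (M + 1)); first by rewrite divr_gt0//; lra.
move=> m a b ab tab sab.
apply: (@le_lt_trans _ _ (\sum_i M * (b i - a i))).
  by apply: ler_sum => i _; have [_ ? _] := ab i; exact: H.
rewrite -mulr_sumr; move: sab; rewrite ltr_pdivlMr; last by lra.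
have : 0 <= \sum_i (b i - a i).
  by apply: sumr_ge0 => i _; have [_ ? _] := ab i; rewrite subr_ge0.
nra.
Qed.

Lemma polyline_lipschitz h m d u t : 0 < h -> u <= t ->
  `|polyline h m d t - polyline h m d u| <= (\sum_(k < m) `|d k| / h) * (t - u).
Proof.
move=> h0 ut; rewrite /polyline -sumrB mulr_suml.
apply: le_trans (ler_norm_sum _ _ _) _; apply: ler_sum => k _.
rewrite -mulrBr -mulrBl normrM -mulrA ler_wpM2l//.
have le1 : u - k%:R * h <= t - k%:R * h by rewrite lerD2r.
rewrite ger0_norm; last by rewrite divr_ge0 ?subr_ge0 ?clamp_le// ltW.
rewrite mulrC ler_wpM2l ?invr_ge0 ?(ltW h0)//.
by apply: le_trans (clamp_lipschitz h le1) _; lra.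
Qed.

Lemma polyline_derive h m d t j : 0 < h -> j%:R * h <= t -> t < j.+1%:R * h ->
  derivable (polyline h m d) t 1 ->
  derive1 (polyline h m d) t = if (j < m)%N then d j / h else 0.
Proof.
(* A derivative that exists is the limit of right difference quotients, and these equal the slope of
   the cell [j h, (j+1) h[, also at its left node. *)
move=> h0 jt tj /derive1_seq c1; apply: (@cvg_unique _ (@Rhausdorff R) _ _ _ _ c1).
apply: cvg_near_cst; near=> n.
have n0 : 0 < n.+1%:R^-1 :> R by rewrite invr_gt0.
have tn : n.+1%:R^-1 + t <= j.+1%:R * h.
  rewrite -lerBrDr; apply/ltW; near: n.
  have e0 : 0 < j.+1%:R * h - t by rewrite subr_gt0.
  exact: (near_infty_natSinv_lt (PosNum e0)).
have jn : j%:R * h <= n.+1%:R^-1 + t by rewrite ler_wpDl// ltW.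
case: ltnP => jm.
  rewrite !(polyline_itv d h0 jm)// ?(ltW tj)//; field.
  by rewrite !gt_eqF//= addrC natr1 pnatr_eq0.
by rewrite !polyline_ge// ?subrr ?mul0r//; [apply: le_trans jt|apply: le_trans jn];
  rewrite ler_pM2r// ler_nat.
Unshelve. all: by end_near. Qed.

(** By [integral_derive_energy_le] it is enough to integrate the squared derivative, which lies
    below the step function with value (d k / h)^2 on the k-th cell. *)
Lemma polyline_energy h m (d : nat -> R) c : 0 < h -> \sum_(k < m) d k ^+ 2 <= c * h ->
  energy_le (polyline h m d) c.
Proof.
move=> h0 dc; apply: integral_derive_energy_le.
- exact: polyline_le0.
- by apply: lipschitz_absolutely_continuous => u t ut; exact: polyline_lipschitz.
pose F k : set (measurableTypeR R) := `[(k%:R * h), (k.+1%:R * h)[%classic.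
have mF k : measurable (F k) by exact: measurable_itv.
pose s (k : 'I_m) t := (((d k / h) ^+ 2)%:E * (\1_(F k) t)%:E)%E.
have ms k : measurable_fun setT (s k).
  by apply: measurable_funeM; apply/measurable_EFinP; apply: measurable_indic; exact: mF.
have s0 k t : (0 <= s k t)%E by rewrite /s -EFinM lee_fin mulr_ge0 ?sqr_ge0.
have m0 : measurable (`[0%R, +oo[%classic : set (measurableTypeR R)).
  exact: measurable_itv.
apply: (@le_trans _ _ (\int[mu]_(t in `[0%R, +oo[) (\sum_(k < m) s k t))%E).
  apply: le_integral_nomeas => //.
  - by move=> t _; rewrite lee_fin sqr_ge0.
  - by move=> t _; exact: sume_ge0.
  move=> t; rewrite /= in_itv/= andbT => t0.
  have [ft|/derive1_not_derivable->] := pselect (derivable (polyline h m d) t 1); last first.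
    by rewrite expr0n; exact: sume_ge0.
  have /andP[] := truncn_itv (divr_ge0 t0 (ltW h0)); set j := Num.truncn _.
  rewrite ler_pdivlMr// ltr_pdivrMr// => jt tj.
  rewrite (polyline_derive h0 jt tj ft); case: ltnP => jm; last first.
    by rewrite expr0n; exact: sume_ge0.
  apply: (@le_trans _ _ (s (Ordinal jm) t)).
    rewrite /s -EFinM lee_fin indicE mem_set ?mulr1//.
    by rewrite /F/= in_itv/= jt.
  by rewrite (bigD1 (Ordinal jm))//= leeDl// sume_ge0.
rewrite ge0_integral_sum//; last by move=> k; exact: measurable_funS (ms k).
apply: (@le_trans _ _ (\sum_(k < m) ((d k / h) ^+ 2 * h)%:E)%E).
  apply: lee_sum => k _.
  have mk : measurable_fun (`[0%R, +oo[%classic : set (measurableTypeR R))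
      (fun t => (\1_(F k) t : R)%:E).
    by apply/measurable_EFinP/measurable_funTS; apply: measurable_indic; exact: mF.
  rewrite /s ge0_integralZl_EFin ?sqr_ge0//.
  rewrite integral_indic// [X in (_ <= X)%E]EFinM lee_wpmul2l ?lee_fin ?sqr_ge0//.
  apply: (@le_trans _ _ (mu (F k))).
    by apply: le_measure; rewrite ?inE//; exact: measurableI.
  rewrite lebesgue_measure_itv/= lte_fin; case: ifPn => [_|_]; last by rewrite lee_fin ltW.
  by rewrite -EFinB lee_fin -natr1 mulrDl mul1r addrC addKr.
rewrite sumEFin lee_fin -mulr_suml.
have -> : \sum_(k < m) (d k / h) ^+ 2 = (\sum_(k < m) d k ^+ 2) / h ^+ 2.
  by rewrite mulr_suml; apply: eq_bigr => k _; rewrite expr_div_n.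
rewrite expr2 invfM mulrA mulfVK ?gt_eqF//.
by rewrite ler_pdivrMr.
Qed.

Lemma polyline_lt0 h m d : 0 < h -> forall t, t < 0 ->
  polyline h m d t = polyline h m d 0.
Proof. by move=> h0 t t0; rewrite !polyline_le0// ltW. Qed.

Definition polyline_fun h m d (h0 : 0 < h) : halfline_fun R :=
  HalflineFun (@polyline_continuous h m d) (@polyline_lt0 h m d h0).

End rate_function.

(** * Taylor remainders of the exponential *)

Section taylor.
Context {R : realType}.
Implicit Types y z u s c : R.

Lemma expR_taylor1 y : 0 <= expR y - 1 - y <= y ^+ 2 * expR `|y|.
Proof.
have H1 : 1 + y <= expR y by exact: expR_ge1Dx.
have H2 : 1 - y <= expR (- y) by exact: expR_ge1Dx.
have E0 : 0 < expR y by exact: expR_gt0.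
have E1 : expR y * expR (- y) = 1 by rewrite -expRD subrr expR0.
have H3 : expR y - 1 <= y * expR y.
  rewrite -subr_ge0 (_ : _ - _ = expR y * (expR (- y) - (1 - y))); last first.
    by rewrite mulrBr E1; ring.
  by rewrite mulr_ge0 ?expR_ge0 ?subr_ge0.
apply/andP; split; first by lra.
have [y0|y0] := leP 0 y.
  by rewrite ger0_norm//; nra.
have : 1 <= expR `|y| by rewrite -[leLHS]expR0 ler_expR.
by nra.
Qed.

(** The sign [s] treats both signs of the argument, the sign [c] both sides of the bound. The
    expression vanishes at 0, and [expR_taylor1] shows that its derivative in z is nonnegative. *)
Lemma expR_taylor2_signed s c z : s ^+ 2 = 1 -> c ^+ 2 = 1 -> 0 <= z ->
  0 <= z ^+ 3 * expR z + c * (expR (s * z) - 1 - s * z - z ^+ 2 / 2).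
Proof.
move=> s2 c2 z0.
have ns (a : R) : a ^+ 2 = 1 -> `|a| = 1.
  by move=> a2; apply/eqP; rewrite -sqr_norm_eq1 a2.
pose F z := z ^+ 3 * expR z + c * (expR (s * z) - 1 - s * z - z ^+ 2 / 2).
pose dF z := 3 * z ^+ 2 * expR z + z ^+ 3 * expR z + c * (s * (expR (s * z) - 1 - s * z)).
have dE y : is_derive y 1 F (dF y).
  rewrite /F /dF; apply: is_derive_eq.
  rewrite /GRing.scale /=.
  have -> : s * (expR (s * y) - 1 - s * y) = s * expR (s * y) - s - y.
    by rewrite 2!mulrBr mulr1 mulrA -expr2 s2 mul1r.
  by field.
have F0 : F 0 = 0 by rewrite /F mulr0 expR0; field.
rewrite -F0 -/(F z); apply: (@ger0_derive1_ndecr _ F 0 z) => //.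
- move=> y; rewrite in_itv/= => /andP[y0 _].
  rewrite derive1E (_ : 'D_1 F y = dF y) /dF; last by have := dE y; case.
  have /andP[H1 H2] := expR_taylor1 (s * y).
  have := @ler_norm _ (- (c * (s * (expR (s * y) - 1 - s * y)))).
  rewrite normrN [(`|c * _|)]normrM [(`|s * _|)]normrM (ns _ s2) (ns _ c2) !mul1r ger0_norm// => H3.
  move: H2; rewrite exprMn s2 mul1r normrM (ns _ s2) mul1r (ger0_norm (ltW y0)) => H2.
  have : 0 <= y ^+ 2 * expR y by rewrite mulr_ge0 ?sqr_ge0 ?expR_ge0.
  have : 0 <= y ^+ 3 * expR y by rewrite mulr_ge0 ?exprn_ge0 ?expR_ge0 ?ltW.
  lra.
- apply: continuous_subspaceT => y.
  apply: differentiable_continuous; apply/derivable1_diffP; by have := dE y; case.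
Qed.

Lemma expR_taylor2 y : `|expR y - 1 - y - y ^+ 2 / 2| <= `|y| ^+ 3 * expR `|y|.
Proof.
have [s s2 ->] : exists2 s, s ^+ 2 = 1 & y = s * `|y|.
  have [y0|y0] := leP 0 y; first by exists 1; rewrite ?expr1n// mul1r ger0_norm.
  by exists (- 1); rewrite ?sqrrN ?expr1n// ltr0_norm// mulN1r opprK.
have z0 : 0 <= `|y| by [].
rewrite normrM normr_id (_ : `|s| = 1) ?mul1r; last first.
  by apply/eqP; rewrite -sqr_norm_eq1 s2.
rewrite exprMn s2 mul1r.
have := @expR_taylor2_signed s 1 `|y| s2 (expr1n _ _) z0.
have := @expR_taylor2_signed s (-1) `|y| s2 _ z0.
rewrite sqrrN expr1n => /(_ erefl) H1 H2.
by rewrite ler_norml; apply/andP; split; lra.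
Qed.

Lemma pow_expR_le (a y : R) (n : nat) : 0 < a -> 0 <= y ->
  y ^+ n.+1 * expR (a * y) <= (n.+1)`!%:R / a ^+ n.+1 * expR (2 * a * y).
Proof.
move=> a0 y0.
have /(expR_ge1Dxn n) H : 0 <= a * y by rewrite mulr_ge0// ltW.
rewrite (_ : 2 * a * y = a * y + a * y); last by ring.
rewrite expRD mulrA ler_pM2r ?expR_gt0//.
rewrite mulrAC ler_pdivlMr ?exprn_gt0// -exprMn [y * a]mulrC.
rewrite [leRHS]mulrC -ler_pdivrMr ?ltr0n ?fact_gt0//.
by apply: le_trans H; rewrite lerDr.
Qed.

End taylor.

(** * Moment generating function and tilted mean of one step *)

Section exponential_moments.
Context d (T : measurableType d) (R : realType) (P : probability T R).
Variables (X : T -> R) (mX : measurable_fun setT X) (delta : R).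
Hypothesis delta0 : 0 < delta.
Hypothesis cramer : (\int[P]_w (expR (delta * `|X w|))%:E < +oo)%E.

(** Tilts use at most half of [delta]; the other half absorbs powers of |X| up to the third, at the
    price of the constant [K]. *)
Let a := delta / 2.
Let D w := expR (delta * `|X w|).
Let K : R := 1 + (1 / a + 2 / a ^+ 2 + 6 / a ^+ 3).
Let a0 : 0 < a. Proof. by rewrite /a divr_gt0. Qed.

Let K1 : 1 <= K.
Proof. by rewrite /K lerDl !addr_ge0// divr_ge0// ?exprn_ge0// ltW. Qed.

Let mD : measurable_fun setT D.
Proof.
apply: measurableT_comp => //; apply: measurable_funM => //.
exact: measurableT_comp.
Qed.

Let iD : P.-integrable setT (EFin \o D).
Proof.
apply/integrableP; split; first exact/measurable_EFinP.
by under eq_integral do rewrite /= ger0_norm ?expR_ge0//.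
Qed.

Lemma cramer_integrable (c : R) (f : T -> R) : measurable_fun setT f ->
  (forall w, `|f w| <= c * D w) -> P.-integrable setT (EFin \o f).
Proof.
move=> mf fD; apply: (@le_integrable _ _ _ P _ _ _ (fun w => (c%:E * (EFin \o D) w)%E)) => //.
- exact/measurable_EFinP.
- move=> w _ /=; rewrite lee_fin; apply: le_trans (fD w) _; exact: ler_norm.
- exact: integrableZl.
Qed.

Lemma cramer_dominates (k : nat) (l w : R) : (k <= 3)%N -> `|l| <= a ->
  `|w| ^+ k * expR `|l * w| <= K * expR (delta * `|w|).
Proof.
move=> k3 la.
have ea : expR `|l * w| <= expR (a * `|w|) by rewrite ler_expR normrM ler_wpM2r.
apply: le_trans (ler_wpM2l (exprn_ge0 _ (normr_ge0 _)) ea) _.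
case: k k3 => [_|k k3].
  rewrite expr0 mul1r; apply: (@le_trans _ _ (expR (delta * `|w|))).
    by rewrite ler_expR ler_wpM2r// /a ler_pdivrMr// mulr_natr mulr2n lerDl ltW.
  by rewrite ler_peMl ?expR_ge0.
apply: le_trans (pow_expR_le k a0 (normr_ge0 w)) _.
rewrite (_ : 2 * a = delta); last by rewrite /a; field.
rewrite ler_wpM2r ?expR_ge0//.
have H1 : 0 <= 1 / a by rewrite divr_ge0// ltW.
have H2 : 0 <= 2 / a ^+ 2 by rewrite divr_ge0// exprn_ge0// ltW.
have H3 : 0 <= 6 / a ^+ 3 by rewrite divr_ge0// exprn_ge0// ltW.
move: k3; rewrite /K; case: k => [|[|[|//]]] _; rewrite ?expr1.
- rewrite (_ : 1`! = 1)%N//; lra.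
- rewrite (_ : 2`! = 2)%N//; lra.
- rewrite (_ : 3`! = 6)%N//; lra.
Qed.

Lemma cramer_monomial_integrable (k : nat) (l : R) : (k <= 3)%N -> `|l| <= a ->
  P.-integrable setT (EFin \o (fun w => X w ^+ k * expR (l * X w))).
Proof.
move=> k3 la; apply: (@cramer_integrable K).
  apply: measurable_funM; first exact: measurable_funX.
  by apply: measurableT_comp => //; exact: measurable_funM.
move=> w; rewrite normrM normrX (ger0_norm (expR_ge0 _)).
apply: le_trans (cramer_dominates (X w) k3 la).
by rewrite ler_wpM2l ?exprn_ge0// ler_expR ler_norm.
Qed.

Let E (f : T -> R) : R := \int[P]_w f w.
Definition mgf l := E (fun w => expR (l * X w)).
(** The derivative of [mgf], written directly as an expectation. *)
Definition mgf1 l := E (fun w => X w * expR (l * X w)).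
Definition cramer_constant := K * E D.

Let Ecst c : E (cst c) = c.
Proof.
rewrite /E Rintegral_cst// -[RHS]mulr1; congr (_ * _).
exact: (congr1 fine (probability_setT P)).
Qed.

Let imgf l : `|l| <= a -> P.-integrable setT (EFin \o (fun w => expR (l * X w))).
Proof.
move=> /(@cramer_monomial_integrable 0 _ isT).
by apply: eq_integrable => // w _; rewrite /= expr0 mul1r.
Qed.

Let imgf1 l : `|l| <= a -> P.-integrable setT (EFin \o (fun w => X w * expR (l * X w))).
Proof.
move=> /(@cramer_monomial_integrable 1 _ isT).
by apply: eq_integrable => // w _; rewrite /= expr1.
Qed.


Lemma mgfE l : `|l| <= a -> (\int[P]_w (expR (l * X w))%:E = (mgf l)%:E)%E.
Proof.
move=> la; rewrite /mgf /E /Rintegral fineK//.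
exact: integrable_fin_num (imgf la).
Qed.

Lemma cramer_constant_gt0 : 0 < cramer_constant.
Proof.
rewrite /cramer_constant mulr_gt0 ?(lt_le_trans ltr01)//.
rewrite -(Ecst 1); apply: le_Rintegral => //.
  by apply: (@cramer_integrable 1) => // w; rewrite normr1 mul1r -[leLHS]expR0 ler_expR mulr_ge0// ltW.
by move=> w _; rewrite -[leLHS]expR0 ler_expR mulr_ge0// ltW.
Qed.

Let le_E (f g : T -> R) : P.-integrable setT (EFin \o f) ->
  P.-integrable setT (EFin \o g) -> (forall w, f w <= g w) -> E f <= E g.
Proof. by move=> ? ? fg; apply: le_Rintegral. Qed.

Let E_D c : E (fun w => c * (K * D w)) = c * cramer_constant.
Proof.
rewrite /cramer_constant mulrA /E; under eq_Rintegral do rewrite mulrA.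
by rewrite RintegralZl.
Qed.

Let integrable_scale (c : R) (f : T -> R) : P.-integrable setT (EFin \o f) ->
  P.-integrable setT (EFin \o (fun w => c * f w)).
Proof. by move=> /(integrableZl measurableT c). Qed.

Let integrable_add (f g : T -> R) : P.-integrable setT (EFin \o f) ->
  P.-integrable setT (EFin \o g) -> P.-integrable setT (EFin \o (fun w => f w + g w)).
Proof. by move=> fi gi; exact: (integrableD measurableT fi gi). Qed.

Let integrable_sub (f g : T -> R) : P.-integrable setT (EFin \o f) ->
  P.-integrable setT (EFin \o g) -> P.-integrable setT (EFin \o (fun w => f w - g w)).
Proof. by move=> fi gi; exact: (integrableB measurableT fi gi). Qed.

(* The remainder of the second-order Taylor expansion in u at l is dominated
   uniformly in l and u. *)
Lemma mgf_expand l u : `|l| + `|u| <= a ->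
  mgf (l + u) <= mgf l + u * mgf1 l + u ^+ 2 * cramer_constant.
Proof.
move=> lua.
have la : `|l| <= a by apply: le_trans lua; rewrite lerDl.
have lu : `|l + u| <= a by apply: le_trans lua; exact: ler_normD.
rewrite -E_D /mgf1 /mgf.
have i1 := imgf la; have i2 := integrable_scale u (imgf1 la).
have i3 := integrable_scale (u ^+ 2) (integrable_scale K iD).
rewrite {2 3 4}/E -RintegralZl//; last exact: imgf1.
rewrite -RintegralD// -RintegralD//; last exact: integrable_add.
apply: le_E; [exact: imgf|by apply: integrable_add => //; exact: integrable_add|].
move=> w; set y := X w.
have /andP[_ H] := expR_taylor1 (u * y).
have e0 : 0 <= expR (l * y) by exact: expR_ge0.
have HD : expR (l * y) * expR `|u * y| * y ^+ 2 <= K * D w.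
  have na : `|(`|l| + `|u|)| <= a by rewrite ger0_norm ?addr_ge0.
  apply: le_trans (@cramer_dominates 2 _ y isT na).
  rewrite mulrC real_normK ?num_real// ler_wpM2l ?sqr_ge0// -expRD ler_expR.
  rewrite normrM [in leRHS]normrM (@ger0_norm _ (`|l| + `|u|)) ?addr_ge0// mulrDl lerD2r.
  by rewrite -normrM ler_norm.
rewrite mulrDl expRD.
have H1 := ler_wpM2l e0 H.
have H2 := ler_wpM2l (sqr_ge0 u) HD.
move: H1 H2; rewrite exprMn; lra.
Qed.

Let norm_E_le (f : T -> R) c : P.-integrable setT (EFin \o f) ->
  (forall w, `|f w| <= c * (K * D w)) -> `|E f| <= c * cramer_constant.
Proof.
move=> fi fD; rewrite -E_D; apply: le_trans (le_normr_Rintegral _ fi) _ => //.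
apply: le_E => //; last by apply: integrable_scale; exact: integrable_scale.
exact: (integrable_abse fi).
Qed.

Hypotheses (X1 : E X = 0) (sigma2 : R) (X2 : E (fun w => X w ^+ 2) = sigma2).

Let iX k : (0 < k <= 3)%N -> P.-integrable setT (EFin \o (fun w => X w ^+ k)).
Proof.
move=> /andP[_ k3]; have := @cramer_monomial_integrable k 0 k3.
rewrite normr0 => /(_ (ltW a0)).
by apply: eq_integrable => // w _; rewrite /= mul0r expR0 mulr1.
Qed.

Let iX1 : P.-integrable setT (EFin \o X).
Proof. exact: (@iX 1 isT). Qed.

Let icst c : P.-integrable setT (EFin \o (fun _ : T => c)).
Proof.
apply: (@cramer_integrable `|c|) => // w.
by rewrite ler_peMr// -[leLHS]expR0 ler_expR mulr_ge0// ltW.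
Qed.

Lemma mgf_quadratic l : `|l| <= a ->
  `|mgf l - 1 - l ^+ 2 / 2 * sigma2| <= `|l| ^+ 3 * cramer_constant.
Proof.
move=> la.
have i1 := imgf la; have i2 := integrable_scale l iX1.
have i3 := integrable_scale (l ^+ 2 / 2) (@iX 2 isT).
have j1 := integrable_sub i1 (icst 1).
have j2 := integrable_sub j1 i2.
have j3 := integrable_sub j2 i3.
have -> : mgf l - 1 - l ^+ 2 / 2 * sigma2 =
   E (fun w => expR (l * X w) - 1 - l * X w - l ^+ 2 / 2 * X w ^+ 2).
  rewrite /E RintegralB// RintegralB// RintegralB//.
  rewrite RintegralZl// [X in _ = _ - _ * X - _]X1 RintegralZl//; last exact: (@iX 2 isT).
  by rewrite [X in _ = _ - _ * X]X2 mulr0 subr0 [X in _ = _ - X - _](Ecst 1).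
apply: norm_E_le => // w.
have := expR_taylor2 (l * X w).
rewrite exprMn (_ : l ^+ 2 * X w ^+ 2 / 2 = l ^+ 2 / 2 * X w ^+ 2); last by ring.
move=> /le_trans; apply.
by rewrite normrM exprMn -mulrA ler_wpM2l ?exprn_ge0// -normrM; exact: cramer_dominates.
Qed.



Lemma mgf1_linear l : `|l| <= a -> `|mgf1 l - l * sigma2| <= l ^+ 2 * cramer_constant.
Proof.
move=> la.
have i1 := imgf1 la; have i3 := integrable_scale l (@iX 2 isT).
have j2 := integrable_sub i1 iX1.
have j3 := integrable_sub j2 i3.
have -> : mgf1 l - l * sigma2 =
   E (fun w => X w * expR (l * X w) - X w - l * X w ^+ 2).
  rewrite /E RintegralB// RintegralB// RintegralZl//; last exact: (@iX 2 isT).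
  by rewrite [X in _ = _ - _ * X]X2 [X in _ = _ - X - _]X1 subr0.
apply: norm_E_le => // w.
have /andP[H1 H2] := expR_taylor1 (l * X w).
have H3 := cramer_dominates (X w) (leqnn 3) la.
rewrite (_ : _ - _ - _ = X w * (expR (l * X w) - 1 - l * X w)); last by ring.
rewrite normrM (ger0_norm H1).
apply: le_trans (ler_wpM2l (normr_ge0 _) H2) _.
apply: le_trans (ler_wpM2l (sqr_ge0 l) H3).
by rewrite exprMn -[in leLHS](@real_normK _ (X w)) ?num_real// [leLHS](_ : _ = l ^+ 2 * (`|X w| ^+ 3 * expR `|l * X w|))//; ring.
Qed.

Lemma mgf_ge1 l : `|l| <= a -> 1 <= mgf l.
Proof.
move=> la.
have i2 := integrable_scale l iX1; have j := integrable_add (icst 1) i2.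
have {1}-> : 1 = E (fun w => 1 + l * X w).
  rewrite /E RintegralD// RintegralZl// [X in _ = _ + _ * X]X1 mulr0 addr0.
  by rewrite [RHS](Ecst 1).
by apply: le_E => //; [exact: imgf|move=> w; exact: expR_ge1Dx].
Qed.

(** Mean of X under the density exp(l X) / mgf(l), that is, the logarithmic derivative of [mgf]. *)
Definition tilted_mean l := mgf1 l / mgf l.

Lemma mgf0 : mgf 0 = 1.
Proof.
rewrite /mgf -[RHS](Ecst 1); congr E; apply/funext => w.
by rewrite mul0r expR0.
Qed.

Lemma tilted_mean0 : tilted_mean 0 = 0.
Proof.
have := @mgf1_linear 0; rewrite normr0 => /(_ (ltW a0)).
rewrite mul0r subr0 expr0n mul0r normr_le0 => /eqP.
by rewrite /tilted_mean => ->; rewrite mul0r.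
Qed.

(** The integral is exp(-u m) mgf(l + u) / mgf(l), with m the tilted mean. Expand mgf(l + u) to
    second order, use mgf(l) >= 1 (X is centred), and conclude by 1 + y <= exp(y). *)
Lemma tilted_mgf_le l u : `|l| + `|u| <= a ->
  (\int[P]_w (expR (l * X w) / mgf l * expR (u * (X w - tilted_mean l)))%:E
    <= (expR (cramer_constant * u ^+ 2))%:E)%E.
Proof.
move=> lua.
have la : `|l| <= a by apply: le_trans lua; rewrite lerDl.
have lu : `|l + u| <= a by apply: le_trans lua; exact: ler_normD.
have p1 := mgf_ge1 la; have p0 : 0 < mgf l by exact: lt_le_trans p1.
under eq_integral => w _.
  rewrite (_ : _ * _ = expR (- (u * tilted_mean l)) / mgf l * expR ((l + u) * X w)); last first.
    rewrite mulrBr mulrDl !expRD; ring.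
  rewrite EFinM; over.
rewrite integralZl//; last exact: imgf.
rewrite mgfE// -EFinM lee_fin mulrAC ler_pdivrMr//.
rewrite -ler_pdivlMl ?expR_gt0// -expRN opprK mulrA -expRD.
apply: le_trans (mgf_expand lua) _.
have H := expR_ge1Dx (u * tilted_mean l + cramer_constant * u ^+ 2).
rewrite [leRHS]mulrC; apply: le_trans (ler_wpM2l (ltW p0) H).
have -> : mgf l * (1 + (u * tilted_mean l + cramer_constant * u ^+ 2)) =
    mgf l + u * mgf1 l + mgf l * (u ^+ 2 * cramer_constant).
  by rewrite /tilted_mean; field; rewrite gt_eqF.
by rewrite lerD2l ler_peMl// mulr_ge0 ?sqr_ge0// ltW// cramer_constant_gt0.
Qed.

Lemma mgf_asymptotics (eta : R) : 0 < sigma2 -> 0 < eta -> exists2 l0, 0 < l0 &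
  forall l, `|l| <= l0 -> [/\ expR ((sigma2 / 2 - eta) * l ^+ 2) <= mgf l,
    mgf l <= expR ((sigma2 / 2 + eta) * l ^+ 2) &
    `|tilted_mean l - sigma2 * l| <= eta * `|l|].
Proof.
move=> s0 e0; set M := cramer_constant; have M0 : 0 < M := cramer_constant_gt0.
(* Dominates all constants below, so that |l| M and |l| sigma2^2 are at most eta / 2 and |l| M is at
   most sigma2 / 2. *)
pose k := 1 + 2 * M + sigma2 + sigma2 ^+ 2 + sigma2 * M.
have s20 : 0 <= sigma2 ^+ 2 by exact: sqr_ge0.
have sM0 : 0 <= sigma2 * M by rewrite mulr_ge0// ltW.
have k0 : 0 < k by rewrite /k; lra.
exists (Num.min (Num.min a 1) (Num.min eta sigma2 / (2 * k))).
  by rewrite !lt_min a0 ltr01 divr_gt0 ?lt_min ?e0 ?s0// mulr_gt0.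
move=> l; rewrite !le_min => /andP[/andP[la l1]].
rewrite ler_pdivlMr ?mulr_gt0// le_min => /andP[le ls].
have := mgf_quadratic la; have := mgf1_linear la; have := mgf_ge1 la.
rewrite -/M /tilted_mean; set p := mgf l; set q := mgf1 l; set z := `|l| in la l1 le ls *.
have z0 : 0 <= z by exact: normr_ge0.
have -> : l ^+ 2 = z ^+ 2 by rewrite real_normK ?num_real.
move=> p1.
rewrite !ler_norml => /andP[q1 q2] /andP[p2 p3].
have z2 : 0 <= z ^+ 2 by exact: sqr_ge0.
have zM : z * M <= eta / 2 /\ z * M <= sigma2 / 2 by rewrite /k in le ls; split; nra.
have zs : z * sigma2 ^+ 2 <= eta / 2 by rewrite /k in le; nra.
have P3 : p <= 1 + (sigma2 / 2 + z * M) * z ^+ 2 by move: p3; rewrite exprS; lra.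
have P2 : 1 + (sigma2 / 2 - z * M) * z ^+ 2 <= p by move: p2; rewrite exprS; lra.
split.
- pose s := (sigma2 / 2 - z * M) * z ^+ 2.
  have s_0 : 0 <= s by rewrite mulr_ge0// subr_ge0; case: zM.
  (* From 1 + s >= exp(s / (1 + s)); the loss s^2 is of order l^4 and fits into eta l^2 / 2. *)
  have H : expR (s - s ^+ 2) <= 1 + s.
    have := expR_ge1Dx (- (s / (1 + s))) => H1.
    have s1 : 0 < 1 + s by lra.
    apply: (@le_trans _ _ (expR (s / (1 + s)))).
      rewrite ler_expR ler_pdivlMr//; have := exprn_ge0 3 s_0; rewrite !exprS; nra.
    rewrite -[leLHS]invrK -expRN invf_ple ?posrE ?expR_gt0//.
    apply: le_trans H1; rewrite -[leLHS]mul1r ler_pdivrMr// mulrDl mulNr divfK ?gt_eqF//; lra.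
  apply: le_trans (le_trans H P2); rewrite ler_expR.
  have s_1 : s <= sigma2 / 2 * z ^+ 2 by rewrite /s; case: zM; nra.
  have : s ^+ 2 <= (sigma2 / 2 * z ^+ 2) ^+ 2 by rewrite lerXn2r ?nnegrE// mulr_ge0// divr_ge0// ltW.
  have : (sigma2 / 2 * z ^+ 2) ^+ 2 <= eta / 2 * z ^+ 2.
    rewrite (_ : (sigma2 / 2 * z ^+ 2) ^+ 2 = sigma2 ^+ 2 * z ^+ 2 / 4 * z ^+ 2); last by field.
    by rewrite ler_wpM2r//; nra.
  rewrite {2}/s; case: zM; nra.
- apply: le_trans P3 _; apply: le_trans (expR_ge1Dx _) _.
  by rewrite ler_expR ler_wpM2r//; case: zM; lra.
- have p0 : 0 < p by exact: lt_le_trans p1.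
  have -> : q / p - sigma2 * l = ((q - l * sigma2) - sigma2 * l * (p - 1)) / p.
    by field; rewrite gt_eqF.
  rewrite -ler_norml normrM normfV (gtr0_norm p0) ler_pdivrMr//.
  apply: (@le_trans _ _ (eta * z)); last by rewrite ler_peMr// mulr_ge0// ltW.
  apply: le_trans (ler_normB _ _) _.
  rewrite !normrM (gtr0_norm s0) (@ger0_norm _ (p - 1)) ?subr_ge0//.
  have H1 : `|q - l * sigma2| <= z ^+ 2 * M by rewrite ler_norml q1.
  have H2 : p - 1 <= sigma2 * z ^+ 2 by case: zM => _ zM; nra.
  have H3 : sigma2 * z * (p - 1) <= sigma2 * z * (sigma2 * z ^+ 2).
    by rewrite ler_wpM2l// mulr_ge0// ltW.
  have H4 : sigma2 * z * (sigma2 * z ^+ 2) <= eta / 2 * z.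
    rewrite (_ : _ * (_ * _) = z * (z * sigma2 ^+ 2) * z); last by ring.
    rewrite ler_wpM2r//; apply: le_trans zs.
    by rewrite ler_piMl// mulr_ge0.
  by move: zM H1 H3 H4 => [zM _]; rewrite -/z; nra.
Qed.

End exponential_moments.

(** * The properties of one step used for the walk *)

Section step_distribution.
Context d (T : measurableType d) (R : realType) (P : probability T R).

(* phi and m stand for the moment generating function and its logarithmic
   derivative. *)
Definition light_tailed (X : T -> R) (sigma2 V u0 : R) (phi m : R -> R) :=
  [/\ [/\ 0 < V, 0 < u0, phi 0 = 1 & m 0 = 0],
      forall l, `|l| <= u0 -> (\int[P]_w (expR (l * X w))%:E = (phi l)%:E)%E /\ 1 <= phi l,
      forall l u, `|l| <= u0 -> `|u| <= u0 ->
        (\int[P]_w (expR (l * X w) / phi l * expR (u * (X w - m l)))%:E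
           <= (expR (V * u ^+ 2))%:E)%E &
      forall eta, 0 < eta -> exists2 l0, 0 < l0 & forall l, `|l| <= l0 ->
        [/\ expR ((sigma2 / 2 - eta) * l ^+ 2) <= phi l,
            phi l <= expR ((sigma2 / 2 + eta) * l ^+ 2) &
            `|m l - sigma2 * l| <= eta * `|l|] ].

Lemma cramer_light_tailed (X : {RV P >-> R}) (delta sigma2 : R) :
  0 < delta -> ('E_P[(fun w => expR (delta * `|X w|))%R] < +oo)%E ->
  ('E_P[X] = 0)%E -> ('E_P[(fun w => X w ^+ 2)%R] = sigma2%:E)%E -> 0 < sigma2 ->
  exists V u0 phi m, light_tailed X sigma2 V u0 phi m.
Proof.
move=> delta0 cramer X1 X2 s0.
have mX : measurable_fun setT X by exact: measurable_funPT.
rewrite unlock in cramer X1 X2.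
have X1' : \int[P]_w X w = 0 by rewrite /Rintegral X1.
have X2' : \int[P]_w (X w ^+ 2) = sigma2 by rewrite /Rintegral X2.
(* With |l| and |u| at most delta / 4, the sum |l| + |u| stays within delta / 2. *)
exists (cramer_constant P X delta), (delta / 2 / 2), (mgf P X), (tilted_mean P X).
have le2 l : `|l| <= delta / 2 / 2 -> `|l| <= delta / 2.
  by move=> /le_trans; apply; lra.
split.
- split; first exact: cramer_constant_gt0.
  + by rewrite !divr_gt0.
  + exact: mgf0.
  + by apply: (@tilted_mean0 _ _ _ _ _ mX delta _ _ _ sigma2).
- move=> l /le2 la; split; first exact: (mgfE mX delta0).
  exact: (mgf_ge1 mX delta0).
- move=> l u la ua; apply: (tilted_mgf_le mX delta0) => //; lra.
- by move=> eta; apply: (mgf_asymptotics mX delta0).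
Qed.

Lemma nondegenerate_variance_gt0 (X : {RV P >-> R}) (sigma2 : R) : ~ degenerate X ->
  ('E_P[(fun w => X w ^+ 2)%R] = sigma2%:E)%E -> 0 < sigma2.
Proof.
move=> nd; rewrite unlock => X2.
have mX : measurable_fun setT X by exact: measurable_funPT.
have s0 : 0 <= sigma2.
  by rewrite -lee_fin -X2; apply: integral_ge0 => w _; rewrite lee_fin sqr_ge0.
rewrite lt_neqAle s0 andbT; apply/eqP => s00; apply: nd; exists 0.
have m2 : measurable_fun setT (fun w => (X w ^+ 2)%:E).
  by apply/measurable_EFinP; exact: measurable_funX.
have /(ae_eq_integral_abs P measurableT m2) : (\int[P]_w `|(X w ^+ 2)%:E| = 0)%E.
  transitivity (sigma2%:E)%E; last by rewrite -s00.
  rewrite -X2; apply: eq_integral => w _.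
  by rewrite gee0_abs// lee_fin sqr_ge0.
apply: filterS => w /(_ I) [] /eqP; rewrite sqrf_eq0 => /eqP//.
Qed.

Lemma same_law_integral (X Y : {RV P >-> R}) (f : R -> R) : same_law X Y ->
  measurable_fun setT f -> (forall y, 0 <= f y) ->
  (\int[P]_w (f (X w))%:E = \int[P]_w (f (Y w))%:E)%E.
Proof.
move=> XY mf f0.
have mfE : measurable_fun setT (EFin \o f) by exact/measurable_EFinP.
have f0' : forall y, (0 <= (EFin \o f) y)%E by move=> y; rewrite lee_fin.
rewrite -[LHS](@ge0_integral_distribution _ _ _ _ _ _ X (EFin \o f) mfE f0').
rewrite -[RHS](@ge0_integral_distribution _ _ _ _ _ _ Y (EFin \o f) mfE f0').
by apply: eq_measure_integral => A mA _; exact: XY.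
Qed.

Lemma light_tailed_same_law (X Y : {RV P >-> R}) sigma2 V u0 phi m :
  same_law X Y -> light_tailed Y sigma2 V u0 phi m -> light_tailed X sigma2 V u0 phi m.
Proof.
move=> XY [H1 H2 H3 H4]; split => //.
  move=> l /H2 [H ?]; split => //; rewrite -H.
  by apply: (same_law_integral (f := fun y => expR (l * y)) XY) => [|y];
    [apply: measurableT_comp => //; exact: measurable_funM|exact: expR_ge0].
move=> l u la ua; apply: le_trans (H3 _ _ la ua); rewrite le_eqVlt; apply/orP; left; apply/eqP.
apply: (same_law_integral (f := fun y => expR (l * y) / phi l * expR (u * (y - m l))) XY) => [|y].
  apply: measurable_funM; first apply: measurable_funM => //.
    by apply: measurableT_comp => //; exact: measurable_funM.
  by apply: measurableT_comp => //; apply: measurable_funM => //; exact: measurable_funB.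
have [_ p1] := H2 _ la.
by rewrite mulr_ge0 ?expR_ge0// divr_ge0 ?expR_ge0// (le_trans ler01).
Qed.

End step_distribution.

(** * Bounding the law of the path by measurable events *)

Section walk_law.
Context d (T : measurableType d) (R : realType) (P : probability T R).
Local Open Scope ereal_scope.

Lemma mutually_independentW (xis : nat -> {RV P >-> R}) : mutually_independent xis ->
  independent P xis.
Proof.
move=> H; split => [i|n A mA]; first exact: measurable_funPT.
pose J := [fset i in iota 0 n]%fset.
have JE i : (i \in J) = (i < n)%N by rewrite inE mem_iota add0n.
have <- : \bigcap_(j in [set` J]) (xis j @^-1` A j) = \bigcap_(i < n) xis i @^-1` A i.
  by apply/seteqP; split => w Hw i /= iJ; apply: Hw; rewrite /= ?JE// -JE.
rewrite H// -(big_mkord xpredT (fun i => P (xis i @^-1` A i))) /index_iota subn0.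
apply: perm_big; apply: uniq_perm; rewrite ?fset_uniq ?iota_uniq// => i.
by rewrite JE mem_iota.
Qed.

(** The completion is given by an outer measure, which is monotone on all sets and agrees with [P]
    on measurable ones. *)
Lemma walk_law_le kappa (xis : nat -> {RV P >-> R}) x n (B : set (Cspace kappa)) A :
  measurable A -> (forall w, B (walk_path xis x n w) -> A w) ->
  walk_law xis x n B <= P A.
Proof.
move=> mA BA; rewrite -(measurable_mu_extE P mA).
exact: le_outer_measure.
Qed.

Lemma walk_law_ge kappa (xis : nat -> {RV P >-> R}) x n (B : set (Cspace kappa)) A :
  measurable A -> (forall w, A w -> B (walk_path xis x n w)) ->
  P A <= walk_law xis x n B.
Proof.
move=> mA BA; rewrite -(measurable_mu_extE P mA).
exact: le_outer_measure.
Qed.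

End walk_law.

(** * From exponential bounds to logarithmic limits *)

Section logarithmic_limits.
Context {R : realType}.
Implicit Types (p u : nat -> \bar R) (v : nat -> R).
Local Open Scope ereal_scope.

Lemma limn_esup_le_near u l : (\forall n \near \oo, u n <= l) -> limn_esup u <= l.
Proof.
move=> [N _ uN]; rewrite limn_esup_lim; apply: lime_le; first exact: is_cvg_esups.
exists N => // n /= Nn; apply: ge_ereal_sup => _ [k /= nk <-].
exact/uN/(leq_trans Nn).
Qed.

Lemma limn_einf_ge_near u l : (\forall n \near \oo, l <= u n) -> l <= limn_einf u.
Proof.
move=> [N _ uN]; rewrite limn_einf_lim; apply: lime_ge; first exact: is_cvg_einfs.
exists N => // n /= Nn; apply: le_ereal_inf_tmp => _ [k /= nk <-].
exact/uN/(leq_trans Nn).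
Qed.

Lemma le_lne (a b : \bar R) : a <= b -> lne a <= lne b.
Proof.
move=> ab; have [b0|b0] := leP b 0.
  by rewrite !le0_lneNy// (le_trans ab).
have [a0|a0] := leP a 0; first by rewrite (le0_lneNy a0) leNye.
by rewrite lee_lne// in_itv/= ltW// leey.
Qed.

(** The constant [C] costs ln(C) / v, which tends to 0: it is paid by the gap between s and some s'
    in ]s, r[. *)
Lemma limn_esup_lne_le p v (r : \bar R) : (v n @[n --> \oo] --> +oo)%R ->
  (forall s : R, s%:E < r -> exists C : R,
     \forall n \near \oo, p n <= (C * expR (- (v n * s)))%:E) ->
  limn_esup (fun n => (v n)^-1%:E * lne (p n)) <= - r.
Proof.
move=> vy Hp.
have H s : s%:E < r -> limn_esup (fun n => (v n)^-1%:E * lne (p n)) <= - s%:E.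
  move=> sr; have [s' ss' s'r] : exists2 s' : R, (s < s')%R & s'%:E < r.
    case: r sr {Hp} => [r| |//]; last by exists (s + 1)%R; rewrite ?ltry// ltrDl.
    by rewrite lte_fin => sr; exists ((s + r) / 2)%R; rewrite ?lte_fin; lra.
  have [C HC] := Hp _ s'r.
  apply: limn_esup_le_near.
  have v1 : \forall n \near \oo, (Num.max 1 (ln (Num.max 1 C) / (s' - s)) < v n)%R.
    by move/cvgryPgt : vy; apply.
  near=> n.
  have : (Num.max 1 (ln (Num.max 1 C) / (s' - s)) < v n)%R by near: n.
  rewrite gt_max => /andP[vn1 vn]; have v0 : (0 < v n)%R by apply: lt_trans vn1.
  have C1 : (0 < Num.max 1 C)%R by rewrite lt_max ltr01.
  have pn : p n <= (Num.max 1 C * expR (- (v n * s')))%:E.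
    apply: le_trans (_ : (C * expR (- (v n * s')))%:E <= _); first by near: n.
    by rewrite lee_fin ler_wpM2r ?expR_ge0// le_max lexx orbT.
  have := le_lne pn; rewrite lne_EFin ?mulr_gt0 ?expR_gt0// lnM ?posrE ?expR_gt0// expRK => pn'.
  apply: (@le_trans _ _ ((v n)^-1%:E * (ln (Num.max 1 C) + - (v n * s'))%:E)).
    by rewrite lee_wpmul2l// lee_fin invr_ge0 ltW.
  rewrite -EFinM lee_fin ler_pdivrMl//.
  move: vn; rewrite ltr_pdivrMr ?subr_gt0//; lra.
case: r H {Hp} => [r| |] H; last by rewrite leey.
  apply/lee_addgt0Pr => e e0; rewrite -EFinN -EFinD.
  rewrite (_ : (- r + e)%R = - (r - e))%R; last by ring.
  by apply: H; rewrite lte_fin ltrBlDr ltrDl.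
set L := limn_esup _ in H *; case: L H => [l| |//] H.
  have : l%:E <= (- (1 - l)%R)%:E by exact: H (ltry _).
  by rewrite lee_fin => ?; exfalso; lra.
by have := H 0%R (ltry _); rewrite leye_eq.
Unshelve. all: by end_near. Qed.

Lemma limn_einf_lne_ge p v (r : \bar R) : (v n @[n --> \oo] --> +oo)%R ->
  (forall s : R, r < s%:E ->
     \forall n \near \oo, (expR (- (v n * s)))%:E <= p n) ->
  - r <= limn_einf (fun n => (v n)^-1%:E * lne (p n)).
Proof.
move=> vy Hp.
have H s : r < s%:E -> - s%:E <= limn_einf (fun n => (v n)^-1%:E * lne (p n)).
  move=> rs; have Hs := Hp _ rs.
  apply: limn_einf_ge_near.
  have v1 : \forall n \near \oo, (0 < v n)%R.
    by move/cvgryPgt : vy; apply.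
  near=> n.
  have v0 : (0 < v n)%R by near: n.
  have /le_lne : (expR (- (v n * s)))%:E <= p n by near: n.
  rewrite lne_EFin ?expR_gt0// expRK => pn.
  apply: (@le_trans _ _ ((v n)^-1%:E * (- (v n * s))%:E)).
    by rewrite -EFinM -EFinN lee_fin mulrN mulKf// gt_eqF.
  by rewrite lee_wpmul2l// lee_fin invr_ge0 ltW.
case: r H {Hp} => [r| |] H; last first.
- set L := limn_einf _ in H *; case: L H => [l| |] H.
  + have : (- (- l - 1)%R)%:E <= l%:E by exact: H (ltNyr _).
    by rewrite lee_fin => ?; exfalso; lra.
  + by rewrite leey.
  + by have := H 0%R (ltNyr _); rewrite leeNy_eq.
- by rewrite leNye.
- apply/lee_subgt0Pr => e e0; rewrite -EFinN -EFinB.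
  rewrite (_ : (- r - e)%R = - (r + e))%R; last by ring.
  by rewrite EFinN; apply: H; rewrite lte_fin ltrDl.
Unshelve. all: by end_near. Qed.

End logarithmic_limits.

(** * Deterministic comparison of polygons, polylines and smooth paths *)

Section polygon.
Context {R : realType}.
Implicit Types (a : nat -> R) (n : nat) (t : R).

(** The value at t is a convex combination of two neighbouring nodes, so a ball containing both
    nodes contains it. *)
Lemma polygon_convex a n t : 0 <= t -> exists2 k : nat, k%:R <= n%:R * t < k.+1%:R &
  forall y e, `|a k - y| <= e -> `|a k.+1 - y| <= e -> `|polygon a n t - y| <= e.
Proof.
move=> t0; have nt0 : 0 <= n%:R * t by rewrite mulr_ge0.
exists (Num.truncn (n%:R * t)); first exact: truncn_itv.
move=> y e; rewrite /polygon/= /interpolate (max_idPr t0).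
have /andP[] := truncn_itv nt0; set k := Num.truncn _; set u := n%:R * t.
rewrite -natr1 => ku uk H1 H2.
have -> : a k + (u - k%:R) * (a k.+1 - a k) - y =
  (1 - (u - k%:R)) * (a k - y) + (u - k%:R) * (a k.+1 - y) by ring.
apply: le_trans (ler_normD _ _) _; rewrite !normrM.
rewrite (@ger0_norm _ (u - _)) ?subr_ge0// (@ger0_norm _ (1 - _)); last by lra.
have := @ler_wpM2l _ (1 - (u - k%:R)) ltac:(lra) _ _ H1.
have := @ler_wpM2l _ (u - k%:R) ltac:(lra) _ _ H2.
lra.
Qed.

(** Inside the m blocks both curves stay within [e] of the value at the start of the block; after
    them the polyline is constant and both are controlled by the linear bound on the nodes. *)
Lemma polygon_close_polyline a n (L m : nat) e t : (0 < n)%N -> (0 < L)%N -> a 0 = 0 ->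
  0 <= e ->
  (forall k j, (k < m)%N -> (j <= L)%N -> `|a (k * L + j)%N - a (k * L)%N| <= e) ->
  (forall j, `|a j| <= e * ((j + m * L)%:R / n%:R)) -> 0 <= t ->
  `|polyline (L%:R / n%:R) m (fun k => a (k.+1 * L)%N - a (k * L)%N) t - polygon a n t|
    <= 4 * e * (1 + t).
Proof.
move=> n0 L0 a0 e0 win far t0.
have [nR0 LR0] : 0 < n%:R :> R /\ 0 < L%:R :> R by rewrite !ltr0n.
have h0 : 0 < L%:R / n%:R :> R by rewrite divr_gt0.
have [k /andP[kt tk] conv] := polygon_convex a n t0.
have tele j : \sum_(i < j) (a (i.+1 * L)%N - a (i * L)%N) = a (j * L)%N.
  rewrite -(big_mkord xpredT (fun i => a (i.+1 * L)%N - a (i * L)%N)).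
  by rewrite telescope_sumr// mul0n a0 subr0.
have et0 : 0 <= e * t by rewrite mulr_ge0.
have [km|mk] := ltnP k (m * L).
  set w := (k %/ L)%N; set r := (k %% L)%N.
  have wm : (w < m)%N by rewrite ltn_divLR.
  have kE : k = (w * L + r)%N by exact: divn_eq.
  have rL : (r < L)%N by rewrite ltn_mod.
  have wt : w%:R * (L%:R / n%:R) <= t.
    rewrite mulrA ler_pdivrMr// [leRHS]mulrC (le_trans _ kt)// -natrM ler_nat kE.
    exact: leq_addr.
  have tw : t <= w.+1%:R * (L%:R / n%:R).
    rewrite mulrA ler_pdivlMr// [leLHS]mulrC (le_trans (ltW tk))// -natrM ler_nat kE.
    by rewrite mulSn addnC ltn_add2r.
  rewrite (polyline_itv _ h0 wm wt tw) tele.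
  set th := (t - _) / _.
  have /andP[th0 th1] : 0 <= th <= 1.
    rewrite /th divr_ge0 ?subr_ge0 ?(ltW h0)//= ler_pdivrMr// mul1r lerBlDl.
    by move: tw; rewrite -natr1 mulrDl mul1r.
  have H1 : `|polygon a n t - a (w * L)%N| <= e.
    by apply: conv; rewrite kE -?addnS win// ltnW.
  have H2 : `|a (w.+1 * L)%N - a (w * L)%N| <= e by rewrite mulSn addnC win.
  rewrite (_ : _ - _ = (a (w.+1 * L)%N - a (w * L)%N) * th - (polygon a n t - a (w * L)%N)); last by ring.
  apply: le_trans (ler_normB _ _) _; rewrite normrM (ger0_norm th0).
  have : `|a (w.+1 * L)%N - a (w * L)%N| * th <= e * 1 by rewrite ler_pM.
  lra.
have mt : m%:R * (L%:R / n%:R) <= t.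
  by rewrite mulrA ler_pdivrMr// [leRHS]mulrC (le_trans _ kt)// -natrM ler_nat.
rewrite polyline_ge// tele.
have bound j : (j <= k.+1)%N -> `|a j - 0| <= e * (2 * t + 1).
  move=> jk; rewrite subr0; apply: le_trans (far j) _; rewrite ler_wpM2l//.
  rewrite ler_pdivrMr// natrD natrM.
  have : j%:R <= k%:R + 1 :> R by rewrite natr1 ler_nat.
  have : 1 <= n%:R :> R by rewrite ler1n.
  have : m%:R * L%:R <= k%:R :> R by rewrite -natrM ler_nat.
  lra.
have H1 := conv _ _ (bound _ (leqnSn k)) (bound _ (leqnn _)).
have H2 : `|a (m * L)%N| <= e * (2 * t).
  apply: le_trans (far _) _; rewrite ler_wpM2l// natrD mulrDl natrM -mulrA.
  by lra.
apply: le_trans (ler_normB _ _) _; rewrite subr0 in H1; lra.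
Qed.

Lemma polygon_close_fun a n (f : R -> R) c e t : (0 < n)%N -> energy_le f c -> 0 <= e ->
  c <= e ^+ 2 * n%:R -> (forall j, `|a j - f (j%:R / n%:R)| <= e * (1 + j%:R / n%:R)) ->
  0 <= t -> `|polygon a n t - f t| <= 3 * e * (1 + t).
Proof.
move=> n0 ef e0 cn af t0; have nR0 : 0 < n%:R :> R by rewrite ltr0n.
have [k /andP[kt tk] conv] := polygon_convex a n t0.
have et0 : 0 <= e * t by rewrite mulr_ge0.
have n1 : n%:R^-1 <= 1 :> R by rewrite invf_le1// ler1n.
have kn : k%:R / n%:R <= t by rewrite ler_pdivrMr// mulrC.
have nk : t <= k.+1%:R / n%:R by rewrite ler_pdivlMr// mulrC ltW.
have kS : k.+1%:R / n%:R = k%:R / n%:R + n%:R^-1 :> R by rewrite -natr1 mulrDl mul1r.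
have cn' : c * n%:R^-1 <= e ^+ 2 by rewrite ler_pdivrMr.
have c0 : 0 <= c by exact: energy_le_ge0 ef.
have close u v : 0 <= u -> u <= v -> v - u <= n%:R^-1 -> `|f v - f u| <= e.
  move=> u0 uv vu; apply: norm_le_of_sqr => //.
  apply: le_trans (energy_le_holder ef u0 uv) _; apply: le_trans cn'.
  by rewrite ler_wpM2l.
have kn0 : 0 <= k%:R / n%:R :> R by rewrite divr_ge0.
apply: conv.
  rewrite (_ : _ - _ = (a k - f (k%:R / n%:R)) - (f t - f (k%:R / n%:R))); last by ring.
  apply: le_trans (ler_normB _ _) _.
  have := af k; have := close _ _ kn0 kn ltac:(lra).
  have : e * (k%:R / n%:R) <= e * t by rewrite ler_wpM2l.
  lra.
rewrite (_ : _ - _ = (a k.+1 - f (k.+1%:R / n%:R)) + (f (k.+1%:R / n%:R) - f t)); last by ring.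
apply: le_trans (ler_normD _ _) _.
have := af k.+1; have := close _ _ t0 nk ltac:(lra).
have : e * (k.+1%:R / n%:R) <= e * (t + 1) by rewrite ler_wpM2l// kS lerD.
lra.
Qed.

Lemma block_sum (F : nat -> R) (L w r : nat) : (0 < L)%N -> (r <= L)%N ->
  \sum_(i < w * L + r) F (i %/ L)%N = L%:R * \sum_(k < w) F k + r%:R * F w.
Proof.
move=> L0 rL; elim: w F => [|w IH] F.
  rewrite mul0n add0n big_ord0 mulr0 add0r (eq_bigr (fun=> F 0%N)) => [|i _].
    by rewrite sumr_const card_ord mulr_natl.
  by rewrite divn_small// (leq_trans (ltn_ord i)).
rewrite mulSn -addnA big_split_ord/=.
rewrite (eq_bigr (fun=> F 0%N)) => [|i _]; last by rewrite divn_small.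
rewrite (eq_bigr (fun i : 'I_(w * L + r) => F (i %/ L).+1)) => [|i _]; last first.
  by rewrite divnDl ?divnn// ?L0 ?add1n.
rewrite (IH (fun k => F k.+1)) sumr_const card_ord big_ord_recl mulrDr -addrA.
by rewrite [_ * F ord0]mulr_natl.
Qed.

(** The drift of a walk whose step mean is constant on blocks and close to xn D / L follows f. The
    relative error [eta] contributes at most eta e per block, hence at most [e] over m blocks as eta
    m <= 1; the Hoelder bound covers the inside of a block, and the energy tail the times after the
    last one. *)
Lemma drift_close (f : R -> R) (kap : nat -> R) (c e eta xn : R) (n L m j : nat) :
  (0 < n)%N -> (0 < L)%N -> 0 < xn -> energy_le f c -> 0 <= e -> 0 <= eta ->
  c * (L%:R / n%:R) <= e ^+ 2 -> c <= e ^+ 2 * (m%:R * (L%:R / n%:R)) ->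
  eta <= 1 -> eta * m%:R <= 1 ->
  (forall k, (m <= k)%N -> kap k = 0) ->
  (forall k, (k < m)%N -> let D := f (k.+1%:R * (L%:R / n%:R)) - f (k%:R * (L%:R / n%:R)) in
     `|kap k - xn / L%:R * D| <= eta * (xn / L%:R * `|D|)) ->
  `|(\sum_(i < j) kap (i %/ L)%N) / xn - f (j%:R / n%:R)| <= 4 * e * (1 + j%:R / n%:R).
Proof.
move=> n0 L0 x0 ef e0 eta0 ch ct eta1 etam kap0 kapD.
have [nR0 LR0] : 0 < n%:R :> R /\ 0 < L%:R :> R by rewrite !ltr0n.
set h := L%:R / n%:R in ch ct kapD *.
have h0 : 0 < h by rewrite divr_gt0.
have c0 : 0 <= c by exact: energy_le_ge0 ef.
pose D k := f (k.+1%:R * h) - f (k%:R * h).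
have kh0 k : 0 <= k%:R * h by rewrite mulr_ge0// ltW.
have khS k : k.+1%:R * h = k%:R * h + h by rewrite -natr1 mulrDl mul1r.
have De k : `|D k| <= e.
  apply: norm_le_of_sqr => //; apply: le_trans (energy_le_holder ef (kh0 k) _) _.
    by rewrite khS lerDl ltW.
  by rewrite khS addrAC subrr add0r.
have sumD w : \sum_(k < w) D k = f (w%:R * h).
  rewrite -(big_mkord xpredT D) /D telescope_sumr// mul0r ef.1 subr0//.
have Ls k : (k < m)%N -> `|L%:R / xn * kap k - D k| <= eta * e.
  move=> km; rewrite (_ : _ - _ = L%:R / xn * (kap k - xn / L%:R * D k)); last first.
    by field; rewrite !gt_eqF.
  rewrite normrM gtr0_norm ?divr_gt0//.
  rewrite -ler_pdivlMl ?divr_gt0// invf_div.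
  apply: le_trans (kapD _ km) _; rewrite -/(D k) mulrCA.
  by rewrite ler_pM2l ?divr_gt0// ler_wpM2l.
have sumle w : (w <= m)%N -> `|L%:R / xn * \sum_(k < w) kap k - f (w%:R * h)| <= e.
  move=> wm; rewrite -sumD mulr_sumr -sumrB.
  apply: le_trans (ler_norm_sum _ _ _) _.
  apply: (@le_trans _ _ (\sum_(k < w) eta * e)).
    by apply: ler_sum => k _; apply: Ls; rewrite (leq_trans (ltn_ord k)).
  rewrite sumr_const card_ord -[leLHS]mulr_natr mulrAC -[leRHS]mul1r ler_wpM2r//.
  by apply: le_trans etam; rewrite ler_wpM2l// ler_nat.
have j0 : 0 <= j%:R / n%:R :> R by rewrite divr_ge0.
have ej0 : 0 <= e * (j%:R / n%:R) by rewrite mulr_ge0.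
have [jm|mj] := ltnP j (m * L).
  set w := (j %/ L)%N; set r := (j %% L)%N.
  have wm : (w < m)%N by rewrite ltn_divLR.
  have jE : j = (w * L + r)%N by exact: divn_eq.
  have rL : (r < L)%N by rewrite ltn_mod.
  have -> : \sum_(i < j) kap (i %/ L)%N = L%:R * \sum_(k < w) kap k + r%:R * kap w.
    by rewrite -block_sum ?(ltnW rL)// -jE.
  have jn : j%:R / n%:R = w%:R * h + r%:R / n%:R.
    by rewrite {1}jE natrD natrM mulrDl mulrA.
  have H1 := sumle _ (ltnW wm).
  have r1 : 0 <= (r%:R / L%:R : R) <= 1.
    by rewrite divr_ge0//= ler_pdivrMr// mul1r ler_nat ltnW.
  have H2 : `|r%:R / xn * kap w| <= 2 * e.
    rewrite (_ : _ * _ = r%:R / L%:R * (L%:R / xn * kap w)); last first.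
      by field; rewrite !gt_eqF.
    case/andP: r1 => r0 r1; rewrite normrM (ger0_norm r0).
    apply: (@le_trans _ _ (1 * (2 * e))); last by rewrite mul1r.
    apply: ler_pM => //.
    rewrite -[_ * kap w](subrK (D w)) (le_trans (ler_normD _ _))//.
    have := Ls _ wm; have := De w.
    have : eta * e <= 1 * e by rewrite ler_wpM2r.
    lra.
  have H3 : `|f (j%:R / n%:R) - f (w%:R * h)| <= e.
    apply: norm_le_of_sqr => //; apply: le_trans (energy_le_holder ef (kh0 _) _) _.
      by rewrite jn lerDl divr_ge0.
    apply: le_trans ch; rewrite ler_wpM2l// jn addrAC subrr add0r.
    by rewrite ler_pM2r ?invr_gt0// ler_nat ltnW.
  set Sk := \sum_(k < w) _ in H1 *.
  rewrite (_ : _ - _ = (L%:R / xn * Sk - f (w%:R * h)) + r%:R / xn * kap w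
      - (f (j%:R / n%:R) - f (w%:R * h))); last by field; rewrite gt_eqF.
  apply: le_trans (ler_normB _ _) _.
  have := ler_normD (L%:R / xn * Sk - f (w%:R * h)) (r%:R / xn * kap w).
  lra.
have mhj : m%:R * h <= j%:R / n%:R.
  by rewrite mulrA ler_pM2r ?invr_gt0// -natrM ler_nat.
have -> : \sum_(i < j) kap (i %/ L)%N = L%:R * \sum_(k < m) kap k.
  rewrite -(subnKC mj) big_split_ord/= [X in _ + X]big1 ?addr0 => [|i _].
    by have := block_sum kap m L0 (leq0n L); rewrite addn0 mul0r addr0.
  by rewrite kap0// divnMDl ?leq_addr.
have ct' : c <= e ^+ 2 * (j%:R / n%:R) by apply: le_trans ct _; rewrite ler_wpM2l ?sqr_ge0.
(* If e = 0 then c = 0 and f vanishes; [energy_le_tail] handles only e > 0. *)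
move: e0; rewrite le_eqVlt => /predU1P[e00|e0].
  have cz : c = 0.
    by apply/eqP; rewrite eq_le c0 andbT; move: ct; rewrite -e00 expr0n mul0r.
  have fz t : 0 <= t -> f t = 0.
    move=> t0; have := energy_le_holder ef (lexx 0) t0; rewrite cz mul0r ef.1 !subr0.
    by rewrite le_eqVlt ltNge sqr_ge0 orbF sqrf_eq0 => /eqP.
  have := sumle _ (leqnn m); rewrite -e00 !fz// mulr0 mul0r !subr0.
  by rewrite mulrAC.
have H1 := sumle _ (leqnn m).
have H2 := energy_le_tail ef e0 (kh0 m) ct.
have H3 := energy_le_tail ef e0 j0 ct'.
set Sk := \sum_(k < m) _ in H1 *.
rewrite (_ : _ - _ = (L%:R / xn * Sk - f (m%:R * h)) + f (m%:R * h)
      - f (j%:R / n%:R)); last by field; rewrite gt_eqF.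
apply: le_trans (ler_normB _ _) _.
have := ler_normD (L%:R / xn * Sk - f (m%:R * h)) (f (m%:R * h)).
have : e * (m%:R * h) <= e * (j%:R / n%:R) by rewrite ler_wpM2l// ltW.
lra.
Qed.

End polygon.

(** * Covering the outside of a ball by finitely many half-spaces *)

Section quantize.
Context {R : realType}.

(** Round y towards 0 on the grid of mesh [dl], capped at p dl. Then z and y have the same sign and
    |z| <= |y|, whence z^2 <= z y; either the square drops by at most 2 p dl^2 or the cap is
    attained. *)
Lemma quantize1 (p : nat) (dl y : R) : 0 < dl -> exists kap : 'I_p.+1 * bool,
  let z := (-1) ^+ kap.2 * (kap.1%:R * dl) in
  z ^+ 2 <= z * y /\ (y ^+ 2 - 2 * p%:R * dl ^+ 2 <= z ^+ 2 \/ (p%:R * dl) ^+ 2 <= z ^+ 2).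
Proof.
move=> d0.
have yd0 : 0 <= `|y| / dl by rewrite divr_ge0// ltW.
have /andP[] := truncn_itv yd0; set i := Num.truncn _.
rewrite ler_pdivlMr// ltr_pdivrMr// => iy yi.
pose j := minn p i; have jp : (j < p.+1)%N by rewrite ltnS geq_minl.
have ji : j%:R * dl <= `|y|.
  by apply: le_trans iy; rewrite ler_pM2r// ler_nat geq_minr.
exists (Ordinal jp, y < 0) => /=; set z := _ * _.
have s2 : ((-1) ^+ (y < 0)%R) ^+ 2 = 1 :> R by rewrite sqrr_sign.
have zE : z ^+ 2 = (j%:R * dl) ^+ 2 by rewrite /z exprMn s2 mul1r.
have j0 : 0 <= j%:R * dl by rewrite mulr_ge0// ltW.
split.
  have -> : z * y = j%:R * dl * `|y| by rewrite normrEsign /z; ring.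
  by rewrite zE expr2 ler_wpM2l.
rewrite zE; have [pi|ip] := leqP p i; first by right; rewrite /j (minn_idPl pi).
left; rewrite /j (minn_idPr (ltnW ip)).
have yp : `|y| <= p%:R * dl.
  by apply: le_trans (ltW yi) _; rewrite ler_pM2r// ler_nat.
have -> : y ^+ 2 = `|y| ^+ 2 by rewrite real_normK// num_real.
rewrite -natr1 mulrDl mul1r in yi.
have i0 : 0 <= i%:R * dl by rewrite mulr_ge0// ltW.
have : (`|y| - i%:R * dl) * (`|y| + i%:R * dl) <= dl * (2 * p%:R * dl).
  apply: ler_pM; lra.
rewrite expr2; nra.
Qed.

(** Puts y in the half-space of normal z given by <z, y> >= |z|^2, with |z|^2 nearly q or more. If
    some coordinate attains the cap, that coordinate alone contributes (p dl)^2 >= q. *)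
Lemma quantize (m p : nat) (dl q : R) (y : 'I_m -> R) : 0 < dl ->
  q <= (p%:R * dl) ^+ 2 -> q < \sum_k y k ^+ 2 ->
  exists kap : {ffun 'I_m -> 'I_p.+1 * bool},
    let z k := (-1) ^+ (kap k).2 * ((kap k).1%:R * dl) in
    q - 2 * m%:R * p%:R * dl ^+ 2 <= \sum_k z k ^+ 2 /\
    \sum_k z k ^+ 2 <= \sum_k z k * y k.
Proof.
move=> d0 qp qy.
have [F HF] := choice (fun k => @quantize1 p dl (y k) d0).
exists [ffun k => F k] => /=; split; last first.
  by apply: ler_sum => k _; rewrite ffunE; have [] := HF k.
have mp0 : 0 <= m%:R * p%:R * dl ^+ 2 :> R by rewrite mulr_ge0 ?sqr_ge0// mulr_ge0.
have [[k Hk]|Hn] := pselect (exists k, (p%:R * dl) ^+ 2 <= ((-1) ^+ (F k).2 * ((F k).1%:R * dl)) ^+ 2).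
  rewrite (bigD1 k)//= ffunE.
  have : 0 <= \sum_(i < m | i != k) ((-1) ^+ ([ffun k => F k] i).2 * (([ffun k => F k] i).1%:R * dl)) ^+ 2.
    by apply: sumr_ge0 => i _; rewrite sqr_ge0.
  lra.
apply: (@le_trans _ _ (\sum_k (y k ^+ 2 - 2 * p%:R * dl ^+ 2))).
  rewrite sumrB sumr_const card_ord -mulr_natl; lra.
apply: ler_sum => k _; rewrite ffunE; have [_ [//|H]] := HF k.
by exfalso; apply: Hn; exists k.
Qed.

End quantize.

Section union_bound.
Context d (T : measurableType d) (R : realType) (P : probability T R).

Lemma union_bound (K : finType) (A : K -> set T) (a : R) :
  (forall k, measurable (A k)) -> (forall k, P (A k) <= a%:E)%E ->
  (P (\bigcup_k A k) <= (#|K|%:R * a)%:E)%E.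
Proof.
move=> mA PA.
have -> : \bigcup_k A k = \big[setU/set0]_(k <- enum K) A k.
  rewrite -bigcup_seq; apply/seteqP; split => w [k _ Ak]; exists k => //=.
  by rewrite mem_enum.
have -> : #|K| = size (enum K) by rewrite cardE.
suff [] : measurable (\big[setU/set0]_(k <- enum K) A k) /\
  (P (\big[setU/set0]_(k <- enum K) A k) <= ((size (enum K))%:R * a)%:E)%E by [].
elim: (enum K) => [|k s [ms IH]]; first by rewrite big_nil measure0 mul0r.
rewrite big_cons; split; first exact: measurableU.
apply: le_trans (measureU2 _ _ _) _ => //.
by rewrite /= -natr1 mulrDl mul1r EFinD addeC leeD.
Qed.

End union_bound.

Lemma block_weighted_sum (R : realType) (F Y : nat -> R) (L w : nat) : (0 < L)%N ->
  \sum_(i < w * L) F (i %/ L)%N * Y i =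
  \sum_(k < w) F k * (\sum_(i < k.+1 * L) Y i - \sum_(i < k * L) Y i).
Proof.
move=> L0; elim: w => [|w IH]; first by rewrite mul0n !big_ord0.
rewrite big_ord_recr/= -IH mulSnr !big_split_ord/= (addrC (\sum_(i < w * L) Y i)) addrK.
congr (_ + _); rewrite mulr_sumr; apply: eq_bigr => i _.
by rewrite divnMDl// divn_small// addn0.
Qed.

(** * Exponential inequalities for the walk *)

Section light_tailed_walk.
Context d (T : measurableType d) (R : realType) (P : probability T R).
Variables (X : nat -> T -> R) (iX : independent P X).
Variables (sigma2 V u0 : R) (phi m : R -> R).
Hypothesis lX : forall k, light_tailed P (X k) sigma2 V u0 phi m.

Lemma light_tailed_tail (j N : nat) (a u : R) : (j <= N)%N -> 0 <= u <= u0 ->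
  (P [set w | (a <= `|partial_sum X N w - partial_sum X j w|)%R] <=
   (2 * expR (V * u ^+ 2 * N%:R - u * a))%:E)%E.
Proof.
move=> jN uu0; have [[V0 u00 phi0 m0] H1 H2 _] := lX 0%N.
(* The trivial tilt: the tilted law is [P], so [tilted_tail] applies to the walk itself. *)
pose g (i : nat) (y : R) : R := 1.
have mg i : measurable_fun setT (g i) by exact: measurable_cst.
have g0 i y : 0 <= g i y by [].
have g1 i : (\int[P]_w (g i (X i w))%:E = 1)%E.
  transitivity (\int[P]_w (cst 1 w))%E; first exact: eq_integral.
  by rewrite integral_cst// mul1e; exact: probability_setT.
have gM i y : (0 <= i)%N -> g i y = 1 by [].
have := @tilted_tail _ _ _ P X iX g 0 mg g0 g1 gM (fun=> 0) V u0 a u j N (ltW V0).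
have -> : (fun i w => X i w - 0) = X by apply/funext => i; apply/funext => w; rewrite subr0.
move=> H; have {}H := H _ jN uu0.
have mA : measurable [set w | a <= `|partial_sum X N w - partial_sum X j w|].
  apply: measurable_norm_ge; apply: measurable_funB; apply: measurable_partial_sum; exact: iX.1.
rewrite tiltedE// in H.
have E : (\int[P]_w (tilt_weight X g 0 w * \1_[set w | a <= `|partial_sum X N w - partial_sum X j w|] w)%:E
    = P [set w | (a <= `|partial_sum X N w - partial_sum X j w|)%R])%E.
  rewrite -[X in _ = P X]setIT -integral_indic//; apply: eq_integral => w _.
  by rewrite /tilt_weight big_ord0 mul1r.
rewrite -E; apply: H => i u' u'0.
have [_ _ H2' _] := lX i; have := H2' 0 u'; rewrite normr0 => /(_ (ltW u00) u'0).
apply: le_trans; rewrite le_eqVlt; apply/orP; left; apply/eqP.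
by apply: eq_integral => w _; rewrite /g m0 phi0 mul0r expR0 divr1 !subr0.
Qed.

Lemma light_tailed_line_crossing (b w : R) (N0 : nat) : 0 < b -> b <= 8 * V * u0 ->
  w = N0%:R * b ^+ 2 / (64 * V) -> 3 <= w ->
  (P [set w | exists j, (b * (j + N0)%:R <= `|partial_sum X j w|)%R] <=
   (8 * expR (- w))%:E)%E.
Proof.
move=> b0 bu wE w3; have [[V0 _ _ _] _ _ _] := lX 0%N.
by apply: (line_crossing iX V0 _ b0 bu wE w3) => j N a u; exact: light_tailed_tail.
Qed.

Lemma chernoff (M : nat) (l : nat -> R) (s : R) : (forall i, `|l i| <= u0) ->
  (P [set w | (s <= \sum_(i < M) l i * X i w)%R] <=
   (expR (- s) * \prod_(i < M) phi (l i))%:E)%E.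
Proof.
move=> lu0.
have ml i : measurable_fun setT (fun y : R => expR (l i * y)).
  by apply: measurableT_comp => //; exact: measurable_funM.
have mS : measurable_fun setT (fun w => \sum_(i < M) l i * X i w).
  by apply: measurable_sum => i; apply: measurable_funM => //; exact: iX.1.
have mA : measurable [set w | s <= \sum_(i < M) l i * X i w].
  rewrite (_ : [set _ | _] = (fun w => \sum_(i < M) l i * X i w) @^-1` `[s, +oo[%classic).
    by apply: measurable_preimage => //.
  by apply/seteqP; split => w /=; rewrite in_itv/= andbT.
have mprod : measurable_fun setT (fun w => \prod_(i < M) expR (l i * X i w)).
  by apply: measurable_prod => i _; apply: (measurableT_comp (ml i)); exact: iX.1.
rewrite -[X in (P X <= _)%E]setIT -integral_indic//.
apply: (@le_trans _ _ (\int[P]_w ((expR (- s))%:E * (\prod_(i < M) expR (l i * X i w))%:E))%E).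
  apply: ge0_le_integral => //.
  - by apply/measurable_EFinP; exact: measurable_indic.
  - by apply/measurable_EFinP; apply: measurable_funM.
  move=> w _; rewrite -EFinM lee_fin indicE -expR_sum -expRD.
  have [ws|] := boolP (w \in _); last by rewrite expR_ge0.
  move: ws; rewrite inE/= => ws; rewrite -[leLHS]expR0 ler_expR; lra.
rewrite ge0_integralZl//; last 2 first.
- exact/measurable_EFinP.
- by move=> w _; rewrite lee_fin prodr_ge0// => i _; exact: expR_ge0.
rewrite (@expectation_prod _ _ _ P X M (fun i y => expR (l i * y)))//.
rewrite EFinM lee_wpmul2l ?lee_fin ?expR_ge0//.
rewrite (eq_bigr (fun i : 'I_M => (phi (l i))%:E)) => [|i _]; last first.
  by have [_ /(_ _ (lu0 i)) [-> _] _ _] := lX i.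
by rewrite prodEFin.
Qed.


Lemma measurable_squared_increments (L mm : nat) (xn : R) :
  measurable_fun setT
    (fun w => \sum_(k < mm) ((partial_sum X (k.+1 * L) w - partial_sum X (k * L) w) / xn) ^+ 2).
Proof.
apply: measurable_sum => k; apply: measurable_funX; apply: measurable_funM => //.
by apply: measurable_funB; apply: measurable_partial_sum; exact: iX.1.
Qed.

Lemma measurable_gt d' (T' : measurableType d') (f : T' -> R) (a : R) :
  measurable_fun setT f -> measurable [set w | a < f w].
Proof.
move=> mf; rewrite (_ : [set _ | _] = f @^-1` `]a, +oo[%classic).
  exact: measurable_preimage.
by apply/seteqP; split => w /=; rewrite in_itv/= andbT.
Qed.

Lemma measurable_ge d' (T' : measurableType d') (f : T' -> R) (a : R) :
  measurable_fun setT f -> measurable [set w | a <= f w].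
Proof.
move=> mf; rewrite (_ : [set _ | _] = f @^-1` `[a, +oo[%classic).
  exact: measurable_preimage.
by apply/seteqP; split => w /=; rewrite in_itv/= andbT.
Qed.

(* Each cell of a finite grid lies in a half-space on which the exponential
   Chebyshev inequality applies. *)
Lemma squared_increments_tail (L mm p : nat) (xn dl eta l0 q q' : R) :
  (0 < L)%N -> 0 < xn -> 0 < sigma2 -> 0 < dl ->
  (forall l, `|l| <= l0 -> phi l <= expR ((sigma2 / 2 + eta) * l ^+ 2)) -> l0 <= u0 ->
  xn * (p%:R * dl) / (sigma2 * L%:R) <= l0 ->
  q <= (p%:R * dl) ^+ 2 -> q' <= q - 2 * mm%:R * p%:R * dl ^+ 2 ->
  0 <= (2 * sigma2)^-1 - eta / sigma2 ^+ 2 ->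
  (P [set w | (q < \sum_(k < mm)
        ((partial_sum X (k.+1 * L) w - partial_sum X (k * L) w) / xn) ^+ 2)%R] <=
   (#|{ffun 'I_mm -> 'I_p.+1 * bool}|%:R *
    expR (- (xn ^+ 2 / L%:R * q' * ((2 * sigma2)^-1 - eta / sigma2 ^+ 2))))%:E)%E.
Proof.
move=> L0 x0 s0 d0 phil lu0 xl qp qq kap0.
have LR0 : 0 < L%:R :> R by rewrite ltr0n.
pose K : finType := ({ffun 'I_mm -> 'I_p.+1 * bool} : finType).
pose z (kap : K) (k : 'I_mm) : R := (-1) ^+ (kap k).2 * ((kap k).1%:R * dl).
pose zz kap (k : nat) : R := if insub k is Some j then z kap j else 0.
have zzE kap (k : 'I_mm) : zz kap k = z kap k by rewrite /zz valK.
have zp kap k : `|zz kap k| <= p%:R * dl.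
  rewrite /zz; case: insubP => [j _ _|_]; last by rewrite normr0 mulr_ge0// ltW.
  rewrite /z normrM normr_sign mul1r ger0_norm; last by rewrite mulr_ge0// ltW.
  by rewrite ler_pM2r// ler_nat -ltnS ltn_ord.
(* Optimal parameter for a Gaussian block sum of variance sigma2 L at the value xn z. *)
pose lam kap k : R := xn * zz kap k / (sigma2 * L%:R).
have lam_le kap k : `|lam kap k| <= l0.
  have sL0 : 0 < sigma2 * L%:R by rewrite mulr_gt0.
  apply: le_trans xl; rewrite /lam normrM normfV (gtr0_norm sL0).
  by rewrite ler_pM2r ?invr_gt0// normrM (gtr0_norm x0) ler_pM2l.
pose Q kap := \sum_k z kap k ^+ 2.
(* The half-space attached to the grid point; grid points with small norm are never selected by
   [quantize] and get the empty event. *)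
pose A kap := if q' <= Q kap
  then [set w | xn ^+ 2 * Q kap / (sigma2 * L%:R) <= \sum_(i < mm * L) lam kap (i %/ L)%N * X i w]
  else set0.
have mA kap : measurable (A kap).
  rewrite /A; case: (q' <= Q kap) => //; apply: measurable_ge.
  by apply: measurable_sum => i; apply: measurable_funM => //; exact: iX.1.
have mE := measurable_squared_increments L mm xn.
apply: (@le_trans _ _ (P (\bigcup_kap A kap))).
  apply: le_measure; rewrite ?inE.
  - exact: measurable_gt.
  - apply: fin_bigcup_measurable => //; exact: finite_finset.
  move=> w /= qw; have [kap [H1 H2]] := quantize d0 qp qw.
  exists kap => //; rewrite /A ifT ?(le_trans qq)//=.
  rewrite (block_weighted_sum (lam kap) (fun i => X i w))//.
  rewrite (_ : \sum_(k < mm) _ = xn ^+ 2 / (sigma2 * L%:R) * \sum_k z kap k *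
    ((partial_sum X (k.+1 * L) w - partial_sum X (k * L) w) / xn)); last first.
    rewrite mulr_sumr; apply: eq_bigr => k _; rewrite /lam zzE /partial_sum.
    by field; rewrite !gt_eqF.
  by rewrite mulrAC ler_pM2l// divr_gt0 ?exprn_gt0 ?mulr_gt0.
apply: union_bound => // kap; rewrite /A; case: ifPn => [qQ|_]; last by rewrite measure0 lee_fin expR_ge0.
apply: le_trans (@chernoff (mm * L) (fun i => lam kap (i %/ L)%N) _ _) _.
  by move=> i; apply: le_trans lu0; exact: lam_le.
rewrite lee_fin.
apply: (@le_trans _ _ (expR (- (xn ^+ 2 * Q kap / (sigma2 * L%:R))) *
   \prod_(i < mm * L) expR ((sigma2 / 2 + eta) * lam kap (i %/ L)%N ^+ 2))).
  rewrite ler_wpM2l ?expR_ge0//; apply: ler_prod => i _; rewrite phil ?lam_le// andbT.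
  have [_ H _ _] := lX 0%N; have [] := H (lam kap (i %/ L)%N).
    by apply: le_trans lu0; exact: lam_le.
  by move=> _; exact: le_trans.
rewrite -expR_sum -expRD ler_expR -mulr_sumr.
have := block_sum (fun k => lam kap k ^+ 2) mm L0 (leq0n L).
rewrite addn0 mul0r addr0 => ->.
have -> : \sum_(k < mm) lam kap k ^+ 2 = xn ^+ 2 / (sigma2 * L%:R) ^+ 2 * Q kap.
  rewrite mulr_sumr; apply: eq_bigr => k _; rewrite /lam zzE !exprMn exprVn exprMn.
  by field; rewrite !gt_eqF.
rewrite (_ : _ + _ = - (xn ^+ 2 / L%:R * Q kap * ((2 * sigma2)^-1 - eta / sigma2 ^+ 2))); last first.
  by field; rewrite !gt_eqF.
rewrite lerN2 ler_wpM2r// ler_wpM2l// divr_ge0// ?sqr_ge0// ltW.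
Qed.

End light_tailed_walk.

(** * The large deviation upper bound *)

Section upper_bound.
Context d (T : measurableType d) (R : realType) (P : probability T R).
Variables (xis : nat -> {RV P >-> R}) (x : nat -> R).
Hypothesis iX : independent P xis.
Variables (sigma2 V u0 : R) (phi m : R -> R).
Hypothesis lX : forall k, light_tailed P (xis k) sigma2 V u0 phi m.
Hypothesis sigma2_gt0 : 0 < sigma2.

Lemma measurable_line_crossing (X : nat -> T -> R) (b : R) (N0 : nat) :
  (forall i, measurable_fun setT (X i)) ->
  measurable [set w | exists j, b * (j + N0)%:R <= `|partial_sum X j w|].
Proof.
move=> mX; rewrite (_ : [set _ | _] =
  \bigcup_j [set w | b * (j + N0)%:R <= `|partial_sum X j w|]).
  by apply: bigcupT_measurable => j; apply: measurable_norm_ge; exact: measurable_partial_sum.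
by apply/seteqP; split => w [j]; [exists j|exists j].
Qed.

(** Outside three bad events the block polyline has energy at most [c] and lies within 4 e of the
    path, which a path in [B] cannot satisfy. The three terms bound the probabilities of these
    events. *)
Lemma walk_law_upper (n L mm p : nat) (e c dl eta l0 q' b1 w1 w2 : R)
    (B : set (Cspace (0 : R))) :
  (0 < n)%N -> (0 < L)%N -> 0 < x n -> 0 < e -> 0 < dl ->
  (forall f g : Cspace (0 : R), energy_le (f : halfline_fun R) c -> B g -> ~ ball f (8 * e) g) ->
  b1 = e * x n / (2 * L%:R) -> b1 <= 8 * V * u0 ->
  w1 = L%:R * b1 ^+ 2 / (64 * V) -> 3 <= w1 ->
  e * (x n / n%:R) <= 8 * V * u0 ->
  w2 = (mm * L)%:R * (e * (x n / n%:R)) ^+ 2 / (64 * V) -> 3 <= w2 ->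
  (forall l, `|l| <= l0 -> phi l <= expR ((sigma2 / 2 + eta) * l ^+ 2)) -> l0 <= u0 ->
  x n * (p%:R * dl) / (sigma2 * L%:R) <= l0 ->
  c * (L%:R / n%:R) <= (p%:R * dl) ^+ 2 ->
  q' <= c * (L%:R / n%:R) - 2 * mm%:R * p%:R * dl ^+ 2 ->
  0 <= (2 * sigma2)^-1 - eta / sigma2 ^+ 2 ->
  (walk_law xis x n B <= (mm%:R * (8 * expR (- w1)) + 8 * expR (- w2) +
     #|{ffun 'I_mm -> 'I_p.+1 * bool}|%:R *
     expR (- (x n ^+ 2 / L%:R * q' * ((2 * sigma2)^-1 - eta / sigma2 ^+ 2))))%:E)%E.
Proof.
move=> n0 L0 x0 e0 d0 HB b1E b1u w1E w13 b2u w2E w23 phil lu0 xl qp qq kap0.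
have [nR0 LR0] : 0 < n%:R :> R /\ 0 < L%:R :> R by rewrite !ltr0n.
have h0 : 0 < L%:R / n%:R :> R by rewrite divr_gt0.
set b2 := e * (x n / n%:R) in b2u w2E *.
have b1_gt0 : 0 < b1 by rewrite b1E divr_gt0 ?mulr_gt0.
have b2_gt0 : 0 < b2 by rewrite mulr_gt0 ?divr_gt0.
have mX i : measurable_fun setT (xis i) by exact: measurable_funPT.
pose Y k i := xis (k * L + i)%N : T -> R.
(* [E1 k]: large excursion in block k, where j <= L gives b1 (j + L) <= e x. [E2]: too much growth
   after the blocks. [E3]: polyline energy above [c]. *)
pose E1 (k : 'I_mm) := [set w | exists j, b1 * (j + L)%:R <= `|partial_sum (Y k) j w|].
pose E2 := [set w | exists j, b2 * (j + mm * L)%:R <= `|partial_sum xis j w|].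
pose E3 := [set w | c * (L%:R / n%:R) < \sum_(k < mm)
        ((partial_sum xis (k.+1 * L) w - partial_sum xis (k * L) w) / x n) ^+ 2].
have mE1 k : measurable (E1 k) by apply: measurable_line_crossing => i; exact: mX.
have mE2 : measurable E2 by exact: measurable_line_crossing.
have mE3 : measurable E3 by apply: measurable_gt; exact: (measurable_squared_increments iX).
have mE1' : measurable (\bigcup_k E1 k).
  by apply: fin_bigcup_measurable => //; exact: finite_finset.
apply: (@le_trans _ _ (P ((\bigcup_k E1 k `|` E2) `|` E3))).
  apply: walk_law_le; first by apply: measurableU => //; exact: measurableU.
  move=> w Bw; apply: contrapT => /not_orP[/not_orP[nE1 nE2] nE3].
  pose a k := walk xis k w / x n.
  pose dd k := a (k.+1 * L)%N - a (k * L)%N.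
  apply: (HB (polyline_fun mm dd h0) (walk_path xis x n w) _ Bw).
    apply: polyline_energy => //; rewrite leNgt; apply/negP => H; apply: nE3.
    rewrite /E3/=; apply: lt_le_trans H _; rewrite le_eqVlt; apply/orP; left; apply/eqP.
    by apply: eq_bigr => k _; rewrite mulrBl.
  apply/Cspace_ballP.
  apply: (@le_lt_trans _ _ (4 * e)%:E); last by rewrite lte_fin; lra.
  apply: rho0_le => t t0; apply: polygon_close_polyline => //.
  - by rewrite /a /walk big_ord0 mul0r.
  - exact: ltW.
  - move=> k j km jL; rewrite /a -mulrBl normrM normfV (gtr0_norm x0) ler_pdivrMr//.
    have -> : walk xis (k * L + j) w - walk xis (k * L) w = partial_sum (Y k) j w.
      by rewrite /walk big_split_ord/= addrAC subrr add0r.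
    rewrite leNgt; apply/negP => H; apply: nE1; exists (Ordinal km) => //.
    exists j; apply: le_trans (ltW H).
    rewrite b1E (_ : _ * _ = e * x n * ((j + L)%:R / (2 * L%:R))); last first.
      by field; rewrite !gt_eqF.
    have ex0 : 0 <= e * x n by rewrite mulr_ge0// ltW.
    rewrite ler_piMr// ler_pdivrMr ?mulr_gt0// mul1r.
    rewrite natrD; have : j%:R <= L%:R :> R by rewrite ler_nat.
    lra.
  - move=> j; rewrite /a normrM normfV (gtr0_norm x0) ler_pdivrMr//.
    rewrite leNgt; apply/negP => H; apply: nE2; exists j.
    apply: le_trans (ltW H); rewrite le_eqVlt; apply/orP; left; apply/eqP.
    by rewrite /b2; field; rewrite gt_eqF.
apply: le_trans (measureU2 _ _ _) _ => //; first exact: measurableU.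
rewrite EFinD leeD//; last exact: (squared_increments_tail iX lX L0 x0 sigma2_gt0 d0 phil lu0 xl qp qq kap0).
apply: le_trans (measureU2 _ _ _) _ => //.
rewrite EFinD leeD//; last exact: (light_tailed_line_crossing iX lX b2_gt0 b2u w2E w23).
rewrite -[X in (X%:R * _)%R]card_ord; apply: union_bound => // k.
apply: (light_tailed_line_crossing _ _ b1_gt0 b1u w1E w13).
  exact: (independent_shift (k * L)%N iX).
by move=> i; exact: lX.
Qed.

End upper_bound.

Lemma archi_mul (R : realType) (a b : R) : 0 < b -> a <= (Num.truncn (a / b)).+1%:R * b.
Proof. by move=> b0; rewrite -ler_pdivrMr//; apply/ltW; exact: truncnS_gt. Qed.

Lemma near_window (R : realType) (h : R) : 0 < h -> \forall n \near \oo,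
  [/\ (0 < n)%N, h * n%:R <= (Num.truncn (h * n%:R)).+1%:R &
      (Num.truncn (h * n%:R)).+1%:R <= 2 * h * n%:R].
Proof.
move=> h0; near=> n.
have n1 : h^-1 <= n%:R by near: n; exact: nbhs_infty_ger.
have n0 : (0 < n)%N by near: n; exact: nbhs_infty_gt.
have hn1 : 1 <= h * n%:R by rewrite -ler_pdivrMl// mulr1.
have hn0 : 0 <= h * n%:R by exact: le_trans hn1.
have /andP[H1 H2] := truncn_itv hn0.
split=> //; first exact: ltW.
by rewrite -natr1; lra.
Unshelve. all: by end_near. Qed.

Lemma walk_law_le1 d (T : measurableType d) (R : realType) (P : probability T R)
    (xis : nat -> {RV P >-> R}) (x : nat -> R) n (B : set (Cspace (0 : R))) :
  (walk_law xis x n B <= 1)%E.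
Proof.
by rewrite -(@probability_setT _ _ _ P); apply: walk_law_le.
Qed.

(** Fixes the parameters of [walk_law_upper] independently of n, except for the block length L in
    [h n, 2 h n], so that all three terms are at most a constant times exp(-v s). *)
Lemma walk_law_upper_rate d (T : measurableType d) (R : realType) (P : probability T R)
    (xis : nat -> {RV P >-> R}) (x : nat -> R) (sigma2 V u0 : R) (phi m : R -> R) (v : nat -> R)
    (B : set (Cspace (0 : R))) (s : R) :
  independent P xis -> (forall k, light_tailed P (xis k) sigma2 V u0 phi m) ->
  0 < sigma2 -> (forall n, (0 < n)%N -> 0 < x n) ->
  (fun n => x n / n%:R) @ \oo --> 0 ->
  (forall n, v n = x n ^+ 2 / n%:R) -> v n @[n --> \oo] --> +oo ->
  (s%:E < rate_of (rate_I0 sigma2 : Cspace (0 : R) -> \bar R) (closure B))%E ->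
  exists C : R, \forall n \near \oo, (walk_law xis x n B <= (C * expR (- (v n * s)))%:E)%E.
Proof.
move=> iX lX sigma2_gt0 x_gt0 x_small vdef v_large.
have vge a : \forall n \near \oo, a <= v n by move/cvgryPge : v_large; apply.
(* For s < 0 the bound exceeds 1 as soon as v >= 0. *)
have [s0|s0] := ltP s 0 => sB.
  exists 1; near=> n; rewrite mul1r; apply: le_trans (walk_law_le1 _ _ _ _) _.
  rewrite lee_fin -[leLHS]expR0 ler_expR oppr_ge0 mulr_ge0_le0 ?(ltW s0)//.
  by near: n; exact: vge.
have [r sr rB] : exists2 r : R, s < r & (r%:E < rate_of (rate_I0 sigma2 : Cspace (0 : R) -> \bar R) (closure B))%E.
  move: sB; set I := rate_of _ _; case: I => [I| |//].
    by rewrite lte_fin => sI; exists ((s + I) / 2); rewrite ?lte_fin; lra.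
  by move=> _; exists (s + 1); rewrite ?ltry// ltrDl.
have r0 : 0 < r by exact: le_lt_trans sr.
pose K := [set f : Cspace (0 : R) | (rate_I0 sigma2 f <= r%:E)%E].
have [_ _ /(_ r (ltW r0)) cK] := rate_I0_good sigma2_gt0.
have [e8 e80 He] : exists2 e : R, 0 < e & forall f g : Cspace (0 : R), K f -> B g -> ~ ball f e g.
  apply: compact_ball_separated => // f Kf Bf.
  move: rB; rewrite ltNge => /negP; apply; apply: le_trans Kf.
  by apply: ereal_inf_lbound; exists f.
pose e : R := e8 / 8; have e0 : 0 < e by rewrite divr_gt0.
have [[V0 u00 _ _] _ _ asym] := lX 0%N.
(* Two losses of relative size [theta] are allowed, one from quantization and one from the error in
   [phi]: r (1 - theta)^2 >= r - 2 theta r = s. *)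
pose theta : R := (r - s) / (2 * r).
have th0 : 0 < theta by rewrite divr_gt0 ?subr_gt0 ?mulr_gt0.
have thr : theta * r = (r - s) / 2 by rewrite /theta; field; rewrite gt_eqF.
have th1 : theta < 1 by rewrite -(ltr_pM2r r0) thr; lra.
have eta0 : 0 < theta * sigma2 / 2 by rewrite divr_gt0// mulr_gt0.
have [l1 l10 Hl] := asym _ eta0.
pose l0 : R := Num.min l1 u0.
have l00 : 0 < l0 by rewrite lt_min l10.
pose c : R := 2 * sigma2 * r; have c0 : 0 < c by rewrite /c !mulr_gt0.
have [W W0 WE] : exists2 W, 0 < W & W = 64 * V by exists (64 * V) => //; lra.
(* Blocks short enough that w1 >= v (s + 1); [mm] below gives w2 >= v (s + 1). With s + 1 in place
   of s, both exponents are at least 3 once v >= 3, even if s = 0. *)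
pose h : R := e ^+ 2 / (8 * W * (s + 1)).
have s1_gt0 : 0 < s + 1 by rewrite ltr_wpDl.
have h0 : 0 < h by rewrite divr_gt0 ?exprn_gt0 ?mulr_gt0.
pose mm := (Num.truncn (W * (s + 1) / (h * e ^+ 2))).+1.
have mmE : W * (s + 1) <= mm%:R * (h * e ^+ 2).
  by apply: archi_mul; rewrite mulr_gt0// exprn_gt0.
(* The cap p dl of the grid, with A^2 >= c L / n. For fixed A a large p makes the quantization loss
   2 mm A^2 / p at most c theta h. *)
pose A : R := 2 * c * h + 1.
have A1 : 1 <= A by rewrite lerDr; apply: mulr_ge0; [apply: mulr_ge0|] => //; exact: ltW.
have A0 : 0 < A by exact: lt_le_trans A1.
pose p := (Num.truncn (2 * mm%:R * A ^+ 2 / (c * theta * h))).+1.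
have pE : 2 * mm%:R * A ^+ 2 <= p%:R * (c * theta * h).
  by apply: archi_mul; exact: mulr_gt0 (mulr_gt0 c0 th0) h0.
have p0 : 0 < p%:R :> R by rewrite ltr0n.
pose dl : R := A / p%:R; have dl0 : 0 < dl by rewrite divr_gt0.
have pdl : p%:R * dl = A by rewrite /dl mulrC divfK// gt_eqF.
exists (mm%:R * 8 + 8 + #|{ffun 'I_mm -> 'I_p.+1 * bool}|%:R).
have e4 : 0 < 4 * e by lra.
have e8' : 0 < 8 * e by lra.
have sh0 : 0 < sigma2 * h by exact: mulr_gt0.
have hE : h * (8 * W * (s + 1)) = e ^+ 2.
  rewrite /h divfK// gt_eqF//; apply: mulr_gt0 => //; lra.
(* Bound on x / n under which the slopes b1 and b2 and the tilts are admissible. *)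
pose rho0 : R := Num.min (W * h * u0 / (4 * e))
  (Num.min (W * u0 / (8 * e)) (l0 * (sigma2 * h) / A)).
have rho00 : 0 < rho0.
  rewrite !lt_min (divr_gt0 (mulr_gt0 (mulr_gt0 W0 h0) u00) e4).
  by rewrite (divr_gt0 (mulr_gt0 W0 u00) e8') (divr_gt0 (mulr_gt0 l00 sh0) A0).
have l0E : l0 = Num.min l1 u0 by [].
have AE : A = 2 * c * h + 1 by [].
have HB f g : energy_le (f : halfline_fun R) c -> B g -> ~ ball (f : Cspace (0 : R)) (8 * e) g.
  rewrite (_ : 8 * e = e8); last by rewrite /e; field.
  by move=> /(rate_I0P f r sigma2_gt0) Kf; exact: He.
have rho0E : rho0 = Num.min (W * h * u0 / (4 * e))
  (Num.min (W * u0 / (8 * e)) (l0 * (sigma2 * h) / A)) by [].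
clearbody h mm p rho0 l0 A theta e.
suff core n : [/\ (0 < n)%N, h * n%:R <= (Num.truncn (h * n%:R)).+1%:R &
      (Num.truncn (h * n%:R)).+1%:R <= 2 * h * n%:R] -> 3 <= v n ->
    `|x n / n%:R| < rho0 -> (walk_law xis x n B <= ((mm%:R * 8 + 8 + #|{ffun 'I_mm -> 'I_p.+1 * bool}|%:R) *
    expR (- (v n * s)))%:E)%E.
  near=> n; apply: core; near: n; [exact: near_window|exact: vge|].
  by move/cvgr0_norm_lt : x_small; apply.
move=> [n0 hL Lh] v3 xs.
have xn0 := x_gt0 _ n0; have nR0 : 0 < n%:R :> R by rewrite ltr0n.
rewrite gtr0_norm ?divr_gt0// in xs.
set L := (Num.truncn _).+1 in hL Lh.
have LR0 : 0 < L%:R :> R by rewrite ltr0n.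
have [rho rhoE] : exists rho : R, rho = x n / n%:R by exists (x n / n%:R).
move: xs; rewrite -rhoE rho0E !lt_min !ltr_pdivlMr// => /andP[x1 /andP[x2 x3]].
have rho_gt0 : 0 < rho by rewrite rhoE divr_gt0.
have xE : x n = rho * n%:R by rewrite rhoE divfK// gt_eqF.
have vE : v n = rho ^+ 2 * n%:R by rewrite vdef xE; field; rewrite gt_eqF.
pose b1 := e * x n / (2 * L%:R).
pose w1 := L%:R * b1 ^+ 2 / W.
pose w2 := (mm * L)%:R * (e * rho) ^+ 2 / W.
have v0 : 0 < v n by exact: lt_le_trans v3.
have vs1 : v n * (s + 1) <= w1.
  have -> : w1 = v n * (e ^+ 2 * n%:R / (4 * L%:R * W)).
    by rewrite /w1 /b1 vE xE; field; rewrite !gt_eqF.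
  rewrite ler_pM2l// ler_pdivlMr ?mulr_gt0//.
  have : (4 * W * (s + 1)) * L%:R <= (4 * W * (s + 1)) * (2 * h * n%:R).
    by rewrite ler_pM2l ?mulr_gt0.
  rewrite -hE; clear; lra.
have vs2 : v n * (s + 1) <= w2.
  have -> : w2 = rho ^+ 2 * (mm%:R * e ^+ 2 * L%:R) / W.
    by rewrite /w2 natrM; field; rewrite !gt_eqF.
  rewrite ler_pdivlMr// vE.
  suff : W * (s + 1) * n%:R <= mm%:R * e ^+ 2 * L%:R.
    by move/(ler_wpM2l (sqr_ge0 rho)); clear; lra.
  have : mm%:R * e ^+ 2 * (h * n%:R) <= mm%:R * e ^+ 2 * L%:R.
    by rewrite ler_wpM2l// mulr_ge0// ?sqr_ge0.
  have : W * (s + 1) * n%:R <= mm%:R * (h * e ^+ 2) * n%:R by rewrite ler_wpM2r.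
  clear; lra.
have vs : v n * s <= v n * (s + 1) by rewrite ler_wpM2l ?lerDl// ltW.
have vs3 : 3 <= v n * (s + 1) by apply: le_trans v3 _; rewrite ler_peMr ?lerDr// ltW.
have b1u : b1 <= 8 * V * u0.
  rewrite /b1 ler_pdivrMr ?mulr_gt0// xE.
  have : V * u0 * (h * n%:R) <= V * u0 * L%:R by rewrite ler_wpM2l// mulr_ge0// ltW.
  have : rho * (4 * e) * n%:R <= W * h * u0 * n%:R by rewrite ler_wpM2r// ltW.
  rewrite WE; clear; lra.
have b2u : e * rho <= 8 * V * u0 by move: x2; rewrite WE; clear; lra.
have phil l : `|l| <= l0 -> phi l <= expR ((sigma2 / 2 + theta * sigma2 / 2) * l ^+ 2).
  by rewrite l0E le_min => /andP[/Hl[]].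
have lu0 : l0 <= u0 by rewrite l0E ge_min lexx orbT.
have xl : x n * (p%:R * dl) / (sigma2 * L%:R) <= l0.
  rewrite pdl ler_pdivrMr ?mulr_gt0// xE.
  have : l0 * sigma2 * (h * n%:R) <= l0 * sigma2 * L%:R.
    by rewrite ler_wpM2l// mulr_ge0// ltW.
  have : rho * A * n%:R <= l0 * (sigma2 * h) * n%:R by rewrite ler_wpM2r// ltW.
  clear; lra.
have Lnh : h <= L%:R / n%:R by rewrite ler_pdivlMr.
have Lnh2 : L%:R / n%:R <= 2 * h by rewrite ler_pdivrMr.
have qp : c * (L%:R / n%:R) <= (p%:R * dl) ^+ 2.
  rewrite pdl; have : c * (L%:R / n%:R) <= c * (2 * h) by rewrite ler_pM2l.
  have : A <= A ^+ 2 by rewrite expr2 ler_peMr// ltW.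
  rewrite {1}AE; clear; lra.
pose q' := c * (1 - theta) * (L%:R / n%:R).
have qq : q' <= c * (L%:R / n%:R) - 2 * mm%:R * p%:R * dl ^+ 2.
  have -> : 2 * mm%:R * p%:R * dl ^+ 2 = 2 * mm%:R * A ^+ 2 / p%:R.
    by rewrite /dl; field; rewrite gt_eqF.
  have : 2 * mm%:R * A ^+ 2 / p%:R <= c * theta * h by rewrite ler_pdivrMr// [leRHS]mulrC.
  have : c * theta * h <= c * theta * (L%:R / n%:R) by rewrite ler_pM2l// mulr_gt0.
  rewrite /q'; clear; lra.
have kapE : (2 * sigma2)^-1 - theta * sigma2 / 2 / sigma2 ^+ 2 = (1 - theta) / (2 * sigma2).
  by field; rewrite gt_eqF.
have kap0 : 0 <= (2 * sigma2)^-1 - theta * sigma2 / 2 / sigma2 ^+ 2.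
  by rewrite kapE; apply: divr_ge0; [rewrite subr_ge0 ltW|rewrite mulr_ge0// ltW].
have H := @walk_law_upper _ _ _ P xis x iX sigma2 V u0 phi m lX sigma2_gt0 n L mm p e c dl
  (theta * sigma2 / 2) l0 q' b1 w1 w2 B n0 isT xn0 e0 dl0.
rewrite -WE -rhoE in H.
have {}H := H HB erefl b1u erefl (le_trans vs3 vs1) b2u erefl (le_trans vs3 vs2)
  phil lu0 xl qp qq kap0.
apply: le_trans H _; rewrite lee_fin.
have ev w : v n * s <= w -> expR (- w) <= expR (- (v n * s)) by rewrite ler_expR lerN2.
rewrite [leRHS]mulrDl [(_ + 8) * _]mulrDl; apply: lerD; [apply: lerD|].
- by rewrite -mulrA ler_wpM2l// ler_wpM2l// ev// (le_trans vs).
- by rewrite ler_wpM2l// ev// (le_trans vs).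
- rewrite ler_wpM2l// ev// kapE.
have -> : x n ^+ 2 / L%:R * q' * ((1 - theta) / (2 * sigma2)) = v n * (r * (1 - theta) ^+ 2).
  by rewrite /q' /c vdef; field; rewrite !gt_eqF.
rewrite ler_pM2l//; have : 0 <= r * theta ^+ 2 by rewrite mulr_ge0 ?sqr_ge0// ltW.
move: thr; clear; lra.
Unshelve. all: by end_near. Qed.

(** * The large deviation lower bound by tilting *)

Section lower_bound.
Context d (T : measurableType d) (R : realType) (P : probability T R).
Variables (X : nat -> T -> R) (iX : independent P X).
Variables (sigma2 V u0 : R) (phi m : R -> R).
Hypothesis lX : forall k, light_tailed P (X k) sigma2 V u0 phi m.
Hypothesis sigma2_gt0 : 0 < sigma2.

Section tilted_walk.
Variables (lam : nat -> R) (L mm : nat).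
Hypotheses (L_gt0 : (0 < L)%N) (lam_u0 : forall k, `|lam k| <= u0)
  (lam0 : forall k, (mm <= k)%N -> lam k = 0).

Let g i y := expR (lam (i %/ L)%N * y) / phi (lam (i %/ L)%N).

Let phi_ge1 k : 1 <= phi (lam k).
Proof. by have [_ /(_ _ (lam_u0 k)) [_ ?] _ _] := lX 0%N. Qed.

Let phi_gt0 k : 0 < phi (lam k).
Proof. exact: lt_le_trans (phi_ge1 k). Qed.

Let mg i : measurable_fun setT (g i).
Proof.
apply: measurable_funM; last exact: measurable_cst.
by apply: measurableT_comp => //; exact: measurable_funM.
Qed.

Let g_ge0 i y : 0 <= g i y.
Proof. by rewrite divr_ge0 ?expR_ge0// ltW. Qed.

Let g1 i : (\int[P]_w (g i (X i w))%:E = 1)%E.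
Proof.
have [_ /(_ _ (lam_u0 (i %/ L)%N)) [E _] _ _] := lX i.
rewrite (eq_integral (fun w => (expR (lam (i %/ L)%N * X i w))%:E * ((phi (lam (i %/ L)%N))^-1)%:E)%E);
  last by move=> w _; rewrite -EFinM.
rewrite ge0_integralZr//.
- by rewrite E -EFinM divff// gt_eqF.
- apply/measurable_EFinP; apply: measurableT_comp => //.
  by apply: measurable_funM => //; exact: iX.1.
- by rewrite lee_fin invr_ge0 ltW.
Qed.

Let gM i y : (mm * L <= i)%N -> g i y = 1.
Proof.
move=> Mi; have [[_ _ phi0 _] _ _ _] := lX 0%N.
by rewrite /g lam0 ?leq_divRL// phi0 mul0r expR0 divr1.
Qed.

Let Q := tilted iX mg g_ge0 g1 gM.
Let kap i := m (lam (i %/ L)%N).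
Let Y i w := X i w - kap i.

Lemma tilted_line_crossing (b w : R) (N0 : nat) : 0 < b -> b <= 8 * V * u0 ->
  w = N0%:R * b ^+ 2 / (64 * V) -> 3 <= w ->
  (Q [set w | exists j, (b * (j + N0)%:R <= `|partial_sum Y j w|)%R] <= (8 * expR (- w))%:E)%E.
Proof.
move=> b0 bu wE w3; have [[V0 _ _ _] _ _ _] := lX 0%N.
apply: (line_crossing _ V0 _ b0 bu wE w3).
  apply: (independent_comp (h := fun i y => y - kap i)).
    exact: tilted_independent.
  by move=> i; apply: measurable_funB.
move=> j N a u jN uu0; apply: tilted_tail (ltW V0) _ jN uu0 => //.
by move=> i u' u'0; have [_ _ H _] := lX i; exact: (H _ _ (lam_u0 _) u'0).
Qed.

(** The left side of the hypothesis is the logarithm of the density dQ/dP. *)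
Lemma tilted_le (A : set T) (q : R) : measurable A ->
  (forall w, A w -> \sum_(i < mm * L) lam (i %/ L)%N * X i w -
     \sum_(i < mm * L) ln (phi (lam (i %/ L)%N)) <= q) ->
  (Q A <= (expR q)%:E * P A)%E.
Proof.
move=> mA Aq; rewrite tiltedE//.
rewrite -[X in (_ <= _ * P X)%E]setIT -integral_indic// -ge0_integralZl//; last first.
  by apply/measurable_EFinP; exact: measurable_indic.
apply: ge0_le_integral => //.
- by move=> w _; rewrite lee_fin mulr_ge0 ?tilt_weight_ge0.
- apply/measurable_EFinP; apply: measurable_funM; first exact: (measurable_tilt_weight iX).
  exact: measurable_indic.
- by apply/measurable_EFinP; apply: measurable_funM => //; exact: measurable_indic.
move=> w _; rewrite -EFinM lee_fin indicE.
have [wA|] := boolP (w \in A); last by rewrite !mulr0.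
rewrite !mulr1; move: wA; rewrite inE => /Aq; rewrite -ler_expR; apply: le_trans.
rewrite expRD expRN !expR_sum -prodfV -big_split/= /tilt_weight le_eqVlt.
apply/orP; left; apply/eqP; apply: eq_bigr => i _.
by rewrite lnK// posrE.
Qed.

End tilted_walk.

End lower_bound.

Section walk_lower_bound.
Context d (T : measurableType d) (R : realType) (P : probability T R).
Variables (xis : nat -> {RV P >-> R}) (x : nat -> R).
Hypothesis iX : independent P xis.
Variables (sigma2 V u0 : R) (phi m : R -> R).
Hypothesis lX : forall k, light_tailed P (xis k) sigma2 V u0 phi m.
Hypothesis sigma2_gt0 : 0 < sigma2.

(** Under the tilted law Q the walk stays within a linear bound of its drift with probability at
    least 1/2. On this event [A] the path is close to f and log dQ/dP <= q, so P(A) >= exp(-q)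
    Q(A). *)
Lemma walk_law_lower (f : R -> R) (n L mm : nat) (e a c eta l0 b w : R)
    (B : set (Cspace (0 : R))) :
  (0 < n)%N -> (0 < L)%N -> 0 < x n -> 0 < e -> 0 < a -> a <= e -> 0 <= eta ->
  energy_le f c -> c * (L%:R / n%:R) <= e ^+ 2 -> c <= e ^+ 2 * (mm%:R * (L%:R / n%:R)) ->
  c <= e ^+ 2 * n%:R ->
  (forall g : halfline_fun R, (forall t, 0 <= t -> `|g t - f t| <= 15 * e * (1 + t)) ->
    B (g : Cspace (0 : R))) ->
  (forall l, `|l| <= l0 -> expR ((sigma2 / 2 - eta) * l ^+ 2) <= phi l /\
     `|m l - sigma2 * l| <= eta * `|l|) -> l0 <= u0 ->
  x n / L%:R * e / sigma2 <= l0 -> eta / sigma2 <= 1 -> eta / sigma2 * mm%:R <= 1 ->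
  b = a * (x n / n%:R) -> b <= 8 * V * u0 -> w = n%:R * b ^+ 2 / (64 * V) -> 4 <= w ->
  ((2^-1 * expR (- (x n ^+ 2 / n%:R * ((sigma2 / 2 + 2 * eta) * c / sigma2 ^+ 2 +
       2 * a * e * mm%:R * (mm%:R + n%:R / L%:R) / sigma2))))%:E <= walk_law xis x n B)%E.
Proof.
move=> n0 L0 x0 e0 a0 ae eta0 ef ch ct cn fB lphi lu0 xl eta1 etam bE bu wE w4.
have [nR0 LR0] : 0 < n%:R :> R /\ 0 < L%:R :> R by rewrite !ltr0n.
set h := L%:R / n%:R in ch ct *.
have h0 : 0 < h by rewrite divr_gt0.
have c0 : 0 <= c by exact: energy_le_ge0 ef.
have b0 : 0 < b by rewrite bE mulr_gt0// divr_gt0.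
pose D k := f (k.+1%:R * h) - f (k%:R * h).
have kh0 k : 0 <= k%:R * h by rewrite mulr_ge0// ltW.
have khS k : k.+1%:R * h = k%:R * h + h by rewrite -natr1 mulrDl mul1r.
have De k : `|D k| <= e.
  apply: norm_le_of_sqr; first exact: ltW.
  apply: le_trans (energy_le_holder ef (kh0 k) _) _; first by rewrite khS lerDl ltW.
  by rewrite khS addrAC subrr add0r.
have D2 : \sum_(k < mm) D k ^+ 2 <= c * h.
  have := energy_le_grid mm ef h0 (lexx 0).
  by under eq_bigr do rewrite !add0r.
(* The tilted step mean is about sigma2 lam = x D_k / L, so block k moves the walk by about x
   D_k. *)
pose lam k : R := if (k < mm)%N then x n / L%:R * D k / sigma2 else 0.
have l00 : 0 <= l0.
  by apply: le_trans xl; rewrite !mulr_ge0// ?invr_ge0; exact: ltW.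
have lamE k : `|lam k| <= x n / L%:R * e / sigma2.
  rewrite /lam; case: ifP => _; last by rewrite normr0 !mulr_ge0// ?invr_ge0; exact: ltW.
  rewrite normrM normfV (gtr0_norm sigma2_gt0) ler_pM2r ?invr_gt0//.
  have xL : 0 < x n / L%:R by rewrite divr_gt0.
  by rewrite normrM (gtr0_norm xL) ler_pM2l.
have lam_l0 k : `|lam k| <= l0 by apply: le_trans xl.
have lam_u0 k : `|lam k| <= u0 by apply: le_trans lu0.
have lam0 k : (mm <= k)%N -> lam k = 0 by rewrite /lam ltnNge => ->.
have phi1 k : 1 <= phi (lam k).
  by have [_ /(_ _ (lam_u0 k)) [_ ?] _ _] := lX 0%N.
have mX i : measurable_fun setT (xis i) by exact: measurable_funPT.
pose kap k := m (lam k).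
pose Y i w : R := xis i w - kap (i %/ L)%N.
have mY i : measurable_fun setT (Y i) by exact: measurable_funB.
pose N := [set w | exists j, b * (j + n)%:R <= `|partial_sum Y j w|].
have mN : measurable N by exact: measurable_line_crossing.
pose A := ~` N; have mA : measurable A by exact: measurableC.
have AP w' j : A w' -> `|partial_sum Y j w'| <= b * (j + n)%:R.
  move=> Aw; rewrite leNgt; apply/negP => H; apply: Aw; exists j; exact: ltW.
have YE j w' : partial_sum Y j w' = walk xis j w' - \sum_(i < j) kap (i %/ L)%N.
  by rewrite /partial_sum /Y sumrB.
apply: (@le_trans _ _ (P A)); last first.
  apply: walk_law_ge => // w' Aw; apply: fB => t t0.
  (* At the nodes, 4 e comes from the drift and a <= e from the fluctuation; [polygon_close_fun]
     triples the sum. *)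
  have e5 : 0 <= 5 * e by rewrite mulr_ge0// ltW.
  rewrite (_ : 15 * e = 3 * (5 * e)); last by ring.
  apply: (polygon_close_fun n0 ef e5) => //.
    by apply: le_trans cn _; rewrite ler_wpM2r// exprMn ler_peMl ?sqr_ge0//; lra.
  move=> j.
  have H1 : `|(\sum_(i < j) kap (i %/ L)%N) / x n - f (j%:R / n%:R)| <= 4 * e * (1 + j%:R / n%:R).
    apply: (@drift_close _ f kap c e (eta / sigma2) (x n) n L mm j) => //.
    - exact: ltW.
    - by rewrite divr_ge0// ltW.
    - by move=> k /lam0 k0; rewrite /kap k0; have [[_ _ _ ->]] := lX 0%N.
    - move=> k km; rewrite -/h -/(D k) /kap.
      have [_ H] := lphi _ (lam_l0 k).
      have E : sigma2 * lam k = x n / L%:R * D k by rewrite /lam km mulrC divfK// gt_eqF.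
      rewrite -E; apply: le_trans H _; rewrite /lam km !normrM !normfV (gtr0_norm sigma2_gt0).
      rewrite (gtr0_norm x0) (gtr0_norm LR0) le_eqVlt; apply/orP; left; apply/eqP.
      by field; rewrite !gt_eqF.
  have H2 := AP w' j Aw; rewrite YE in H2.
  rewrite (_ : _ - _ = (walk xis j w' - \sum_(i < j) kap (i %/ L)%N) / x n +
     ((\sum_(i < j) kap (i %/ L)%N) / x n - f (j%:R / n%:R))); last by ring.
  apply: le_trans (ler_normD _ _) _; rewrite normrM normfV (gtr0_norm x0).
  have j0 : 0 <= 1 + j%:R / n%:R :> R by rewrite addr_ge0// divr_ge0.
  have H3 : `|walk xis j w' - \sum_(i < j) kap (i %/ L)%N| / x n <= a * (1 + j%:R / n%:R).
    rewrite ler_pdivrMr//; apply: le_trans H2 _; rewrite le_eqVlt; apply/orP; left; apply/eqP.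
    by rewrite bE natrD; field; rewrite gt_eqF.
  have : a * (1 + j%:R / n%:R) <= e * (1 + j%:R / n%:R) by rewrite ler_wpM2r.
  lra.
(* The first term is the entropy cost, the product of (sigma2 / 2 + 2 eta) with the bound on L sum
   lam^2; the second bounds the contribution of the centred walk by summation over blocks. *)
set q := _ * (_ + _).
have Aq w' : A w' -> \sum_(i < mm * L) lam (i %/ L)%N * xis i w' -
     \sum_(i < mm * L) ln (phi (lam (i %/ L)%N)) <= q.
  move=> Aw.
  pose S1 := \sum_(k < mm) `|lam k|; pose S2 := \sum_(k < mm) lam k ^+ 2.
  have HY : \sum_(i < mm * L) lam (i %/ L)%N * Y i w' <= 2 * b * (mm * L + n)%:R * S1.
    rewrite (block_weighted_sum lam (fun i => Y i w'))// mulr_sumr; apply: ler_sum => k _.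
    apply: le_trans (ler_norm _) _; rewrite normrM mulrC ler_wpM2r//.
    apply: le_trans (ler_normB _ _) _.
    have bk j : (j <= mm)%N -> `|partial_sum Y (j * L) w'| <= b * (mm * L + n)%:R.
      move=> jm; apply: le_trans (AP _ _ Aw) _; rewrite ler_pM2l// ler_nat leq_add2r.
      by rewrite leq_mul2r jm orbT.
    have := bk k.+1 (ltn_ord k); have := bk k (ltnW (ltn_ord k)); rewrite /partial_sum.
    lra.
  have Hk : \sum_(i < mm * L) lam (i %/ L)%N * kap (i %/ L)%N <= (sigma2 + eta) * (L%:R * S2).
    have := block_sum (fun k => lam k * kap k) mm L0 (leq0n L).
    rewrite addn0 mul0r addr0 => ->; rewrite mulrCA ler_pM2l// mulr_sumr.
    apply: ler_sum => k _; have [_ H] := lphi _ (lam_l0 k).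
    have H' : lam k * (m (lam k) - sigma2 * lam k) <= eta * lam k ^+ 2.
      apply: le_trans (ler_norm _) _; rewrite normrM.
      apply: le_trans (ler_wpM2l (normr_ge0 _) H) _.
      by rewrite mulrCA -expr2 real_normK ?num_real.
    rewrite /kap; lra.
  have Hp : (sigma2 / 2 - eta) * (L%:R * S2) <= \sum_(i < mm * L) ln (phi (lam (i %/ L)%N)).
    have := block_sum (fun k => ln (phi (lam k))) mm L0 (leq0n L).
    rewrite addn0 mul0r addr0 => ->; rewrite mulrCA ler_pM2l// mulr_sumr.
    apply: ler_sum => k _; have [H _] := lphi _ (lam_l0 k).
    have p0 : 0 < phi (lam k) by exact: lt_le_trans (phi1 k).
    by rewrite -[leLHS]expRK ler_ln ?posrE ?expR_gt0.
  have HS2 : L%:R * S2 <= x n ^+ 2 / n%:R * (c / sigma2 ^+ 2).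
    have -> : S2 = (x n / L%:R / sigma2) ^+ 2 * \sum_(k < mm) D k ^+ 2.
      rewrite mulr_sumr; apply: eq_bigr => k _; rewrite /lam ltn_ord.
      by field; rewrite !gt_eqF.
    have K0 : 0 <= L%:R * (x n / L%:R / sigma2) ^+ 2 by rewrite mulr_ge0 ?sqr_ge0.
    rewrite mulrA; apply: le_trans (ler_wpM2l K0 D2) _.
    rewrite le_eqVlt; apply/orP; left; apply/eqP; rewrite /h.
    by field; rewrite !gt_eqF.
  have HS1 : S1 <= mm%:R * (x n / L%:R * e / sigma2).
    apply: (@le_trans _ _ (\sum_(k < mm) x n / L%:R * e / sigma2)).
      by apply: ler_sum => k _; exact: lamE.
    by rewrite sumr_const card_ord mulr_natl.
  have bm0 : 0 <= 2 * b * (mm * L + n)%:R by rewrite !mulr_ge0// ltW.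
  have HS1' := ler_wpM2l bm0 HS1.
  have se : 0 <= sigma2 / 2 + 2 * eta by rewrite addr_ge0 ?mulr_ge0 ?divr_ge0//; exact: ltW.
  have HS2' := ler_wpM2l se HS2.
  have -> : q = (sigma2 / 2 + 2 * eta) * (x n ^+ 2 / n%:R * (c / sigma2 ^+ 2)) +
     2 * b * (mm * L + n)%:R * (mm%:R * (x n / L%:R * e / sigma2)).
    rewrite /q bE natrD natrM; field; by rewrite !gt_eqF.
  have -> : \sum_(i < mm * L) lam (i %/ L)%N * xis i w' =
     \sum_(i < mm * L) lam (i %/ L)%N * kap (i %/ L)%N + \sum_(i < mm * L) lam (i %/ L)%N * Y i w'.
    rewrite -big_split/=; apply: eq_bigr => i _; rewrite /Y; ring.
  clear - HY Hk Hp HS1' HS2'; lra.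
have := tilted_le iX lX L0 lam_u0 lam0 mA Aq.
have w3 : 3 <= w by apply: le_trans w4; rewrite ler_nat.
have := tilted_line_crossing iX lX L0 lam_u0 lam0 b0 bu wE w3.
set Q := tilted _ _ _ _ _; rewrite -/N => QN QA.
(* From w >= 4 and e >= 2: the crossing bound 8 exp(-w) is then at most 1/2. *)
have e16 : 16 <= expR w.
  apply: (@le_trans _ _ (expR 1 ^+ 4)); last by rewrite -expRM_natl ler_expR mulr1.
  have e2 : 2 <= expR 1 :> R by have := expR_ge1Dx (1 : R).
  by apply: (@le_trans _ _ (2 ^+ 4)); [lra|rewrite lerXn2r ?nnegrE// (le_trans _ e2)].
have QN2 : (Q N <= (2^-1)%:E)%E.
  apply: le_trans QN _; rewrite lee_fin expRN ler_pdivrMr ?expR_gt0//; lra.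
have QA2 : ((2^-1)%:E <= Q A)%E.
  rewrite /A probability_setC// leeBrDr ?fin_num_measure//.
  apply: (@le_trans _ _ ((2^-1)%:E + (2^-1)%:E)%E); first by rewrite leeD2l.
  by rewrite -EFinD lee_fin; lra.
have := le_trans QA2 QA; rewrite -(@fineK _ (P A)) ?fin_num_measure// -EFinM !lee_fin.
by rewrite expRN ler_pdivrMr ?expR_gt0// mulrC.
Qed.

End walk_lower_bound.

(** Fixes the parameters of [walk_law_lower] so that the exponent exceeds v r by less than the
    available slack v (s - r). *)
Lemma walk_law_lower_rate d (T : measurableType d) (R : realType) (P : probability T R)
    (xis : nat -> {RV P >-> R}) (x : nat -> R) (sigma2 V u0 : R) (phi m : R -> R) (v : nat -> R)
    (B : set (Cspace (0 : R))) (f : Cspace (0 : R)) (r s : R) :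
  independent P xis -> (forall k, light_tailed P (xis k) sigma2 V u0 phi m) ->
  0 < sigma2 -> (forall n, (0 < n)%N -> 0 < x n) ->
  (fun n => x n / n%:R) @ \oo --> 0 ->
  (forall n, v n = x n ^+ 2 / n%:R) -> v n @[n --> \oo] --> +oo ->
  interior B f -> (rate_I0 sigma2 f <= r%:E)%E -> r < s ->
  \forall n \near \oo, ((expR (- (v n * s)))%:E <= walk_law xis x n B)%E.
Proof.
move=> iX lX sigma2_gt0 x_gt0 x_small vdef v_large.
move=> /nbhs_ballP[e16 e160 fB] fr rs.
have r0 : 0 <= r by rewrite -lee_fin; apply: le_trans fr; exact: rate_I0_ge0.
pose c : R := 2 * sigma2 * r.
have ef : energy_le (f : halfline_fun R) c by exact/rate_I0P.
have c0 : 0 <= c by rewrite mulr_ge0// mulr_ge0// ltW.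
have [[V0 u00 _ _] _ _ asym] := lX 0%N.
have [e e0 eE] : exists2 e : R, 0 < e & e16 = 16 * e.
  exists (e16 / 16); first by apply: divr_gt0 => //; lra.
  by field.
pose h : R := e ^+ 2 / (2 * (c + 1)).
have h0 : 0 < h by apply: divr_gt0; [exact: exprn_gt0|lra].
have hE : h * (2 * (c + 1)) = e ^+ 2 by rewrite /h divfK// gt_eqF//; lra.
have eh0 : 0 < e ^+ 2 * h by rewrite mulr_gt0// exprn_gt0.
pose mm := (Num.truncn (c / (e ^+ 2 * h))).+1.
have mmE : c <= mm%:R * (e ^+ 2 * h) by exact: archi_mul.
have mm1 : 1 <= mm%:R :> R by rewrite ler1n.
have mm0 : 0 < mm%:R :> R by rewrite ltr0n.
(* The slack: k/4 for the error of [eta], k/4 for the fluctuation term (this fixes [a] through [G]),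
   and k/2 for the factor 1/2. *)
pose k : R := s - r; have k0 : 0 < k by rewrite subr_gt0.
have r16 : 0 < 16 * (r + 1) by lra.
pose eta : R := Num.min (sigma2 / mm%:R) (k * sigma2 / (16 * (r + 1))).
have eta0 : 0 < eta.
  by rewrite lt_min (divr_gt0 sigma2_gt0 mm0) (divr_gt0 (mulr_gt0 k0 sigma2_gt0) r16).
have etam : eta / sigma2 * mm%:R <= 1.
  by rewrite mulrAC ler_pdivrMr// mul1r -ler_pdivlMr// /eta ge_min lexx.
have etak : eta * (16 * (r + 1)) <= k * sigma2.
  by rewrite -ler_pdivlMr// /eta ge_min lexx orbT.
have [l1 l10 Hl] := asym _ eta0.
pose l0 : R := Num.min l1 u0.
have l00 : 0 < l0 by rewrite lt_min l10.
pose G : R := 8 * e * mm%:R * (mm%:R + h^-1).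
have G0 : 0 < G.
  by rewrite /G; apply: mulr_gt0; [apply: mulr_gt0 => //; lra|rewrite addr_gt0// invr_gt0].
pose a : R := Num.min e (k * sigma2 / G).
have a0 : 0 < a by rewrite lt_min e0 (divr_gt0 (mulr_gt0 k0 sigma2_gt0) G0).
have ae : a <= e by rewrite /a ge_min lexx.
have aG : a * G <= k * sigma2 by rewrite -ler_pdivlMr// /a ge_min lexx orbT.
have GE : G = 8 * e * mm%:R * (mm%:R + h^-1) by [].
have cE : c = 2 * sigma2 * r by [].
have kE : k = s - r by [].
have lu0 : l0 <= u0 by rewrite /l0 ge_min lexx orbT.
have lphi l : `|l| <= l0 -> expR ((sigma2 / 2 - eta) * l ^+ 2) <= phi l /\
     `|m l - sigma2 * l| <= eta * `|l|.
  by rewrite le_min => /andP[/Hl[]].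
have fB' (g : halfline_fun R) : (forall t, 0 <= t -> `|g t - (f : halfline_fun R) t| <= 15 * e * (1 + t)) ->
    B (g : Cspace (0 : R)).
  move=> H; apply: fB; apply/Cspace_ballP.
  apply: (@le_lt_trans _ _ (15 * e)%:E); last by rewrite eE lte_fin; lra.
  by apply: rho0_le => t t0; rewrite distrC H.
clearbody h mm eta l0 G a c k.
have V8 : 0 < 8 * V by lra.
have W0 : 0 < 64 * V by lra.
have xlt y : 0 < y -> \forall n \near \oo, x n / n%:R <= y.
  move=> y0; have : \forall n \near \oo, `|x n / n%:R| < y.
    by move/cvgr0_norm_lt : x_small; apply.
  by apply: filterS => n /ltW; apply: le_trans; exact: ler_norm.
have vge y : \forall n \near \oo, y <= v n by move/cvgryPge : v_large; apply.
suff core n : [/\ (0 < n)%N, h * n%:R <= (Num.truncn (h * n%:R)).+1%:R &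
      (Num.truncn (h * n%:R)).+1%:R <= 2 * h * n%:R] ->
    x n / n%:R <= l0 * (h * sigma2) / e -> x n / n%:R <= 8 * V * u0 / a ->
    2 / k <= v n -> 4 * (64 * V) / a ^+ 2 <= v n -> c / e ^+ 2 <= n%:R ->
    ((expR (- (v n * s)))%:E <= walk_law xis x n B)%E.
  near=> n; apply: core; near: n; [exact: near_window| | |exact: vge|exact: vge|].
  - by apply: xlt; exact: divr_gt0 (mulr_gt0 l00 (mulr_gt0 h0 sigma2_gt0)) e0.
  - by apply: xlt; exact: divr_gt0 (mulr_gt0 V8 u00) a0.
  - exact: nbhs_infty_ger.
move=> [n0 hL Lh]; rewrite ler_pdivlMr// => xs1; rewrite ler_pdivlMr// [_ * a]mulrC => xs2 v1 v2 nc.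
have xn0 := x_gt0 _ n0; have nR0 : 0 < n%:R :> R by rewrite ltr0n.
set L := (Num.truncn _).+1 in hL Lh.
have L0 : (0 < L)%N by [].
have LR0 : 0 < L%:R :> R by rewrite ltr0n.
clearbody L.
have e20 : 0 < e ^+ 2 by rewrite exprn_gt0.
have ch : c * (L%:R / n%:R) <= e ^+ 2.
  have : L%:R / n%:R <= 2 * h by rewrite ler_pdivrMr.
  move/(ler_wpM2l c0); clear - hE h0; lra.
have ct : c <= e ^+ 2 * (mm%:R * (L%:R / n%:R)).
  have : h <= L%:R / n%:R by rewrite ler_pdivlMr.
  move/(ler_wpM2l (ltW (mulr_gt0 e20 mm0))); clear - mmE; lra.
have cn : c <= e ^+ 2 * n%:R by rewrite mulrC -ler_pdivrMr.
have xl : x n / L%:R * e / sigma2 <= l0.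
  rewrite ler_pdivrMr// mulrAC ler_pdivrMr//.
  have : l0 * sigma2 * (h * n%:R) <= l0 * sigma2 * L%:R.
    by rewrite ler_wpM2l// mulr_ge0// ltW.
  have := ler_wpM2r (ltW nR0) xs1.
  rewrite mulrAC divfK ?gt_eqF//; clear; lra.
have eta1 : eta / sigma2 <= 1.
  apply: le_trans etam; rewrite ler_peMr// divr_ge0//; exact: ltW.
have w4 : 4 <= n%:R * (a * (x n / n%:R)) ^+ 2 / (64 * V).
  have a20 : 0 < a ^+ 2 by rewrite exprn_gt0.
  rewrite ler_pdivlMr//; move: v2; rewrite ler_pdivrMr// vdef => /le_trans; apply.
  rewrite le_eqVlt; apply/orP; left; apply/eqP; field; exact: lt0r_neq0.
have := @walk_law_lower _ _ _ P xis x iX sigma2 V u0 phi m lX sigma2_gt0 f n L mm e a c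
  eta l0 _ _ B n0 L0 xn0 e0 a0 ae (ltW eta0) ef ch ct cn fB' lphi lu0 xl eta1 etam
  erefl xs2 erefl w4.
apply: le_trans; rewrite lee_fin -vdef.
have v0 : 0 < v n by apply: lt_le_trans v1; rewrite divr_gt0.
have H1 : 2^-1 >= expR (- (v n * (k / 2))).
  rewrite expRN lef_pV2 ?posrE ?expR_gt0//.
  have : 1 <= v n * (k / 2) by move: v1; rewrite ler_pdivrMr//; clear; lra.
  have := expR_ge1Dx (v n * (k / 2)); clear; lra.
have H2 : (sigma2 / 2 + 2 * eta) * c / sigma2 ^+ 2 +
       2 * a * e * mm%:R * (mm%:R + n%:R / L%:R) / sigma2 <= r + k / 2.
  have -> : (sigma2 / 2 + 2 * eta) * c / sigma2 ^+ 2 = r + 4 * eta * r / sigma2.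
    by rewrite cE; field; exact: lt0r_neq0.
  have : 4 * eta * r / sigma2 <= k / 4.
    rewrite ler_pdivrMr//; clear - etak eta0; lra.
  have : 2 * a * e * mm%:R * (mm%:R + n%:R / L%:R) / sigma2 <= k / 4.
    rewrite ler_pdivrMr//.
    have : n%:R / L%:R <= h^-1 by rewrite ler_pdivrMr// ler_pdivlMl.
    have aem : 0 <= 2 * a * e * mm%:R.
      by rewrite !mulr_ge0//; exact: ltW.
    move/(ler_wpM2l aem); rewrite GE in aG; clear - aG; lra.
  clear; lra.
apply: le_trans (_ : expR (- (v n * (k / 2))) * expR (- (v n * (r + k / 2))) <= _).
  by rewrite -expRD ler_expR kE; clear; lra.
apply: ler_pM => //; rewrite ?expR_ge0// ler_expR lerN2.
by rewrite ler_pM2l.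
Unshelve. all: by end_near. Qed.

(** * The speed tends to infinity, and the two bounds are combined *)

Lemma speed_cvgy (R : realType) (x : nat -> R) :
  (fun n => x n / Num.sqrt n%:R) @ \oo --> +oo ->
  (x n ^+ 2 / n%:R) @[n --> \oo] --> +oo.
Proof.
move=> /cvgryPge H; apply/cvgryPge => A.
have := H (Num.max 1 A); apply: filterS => n; rewrite ge_max => /andP[y1 yA].
have -> : x n ^+ 2 / n%:R = (x n / Num.sqrt n%:R) ^+ 2 by rewrite expr_div_n sqr_sqrtr.
apply: le_trans yA _; rewrite expr2 ler_peMr//; exact: le_trans y1.
Qed.

Theorem theorem4p2 (R : realType) (d : measure_display)
    (Omega : measurableType d) (P : probability Omega R)
    (xi : {RV P >-> R}) (delta sigma2 : R)
    (xis : nat -> {RV P >-> R}) (x : nat -> R)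
    (xi_nondegenerate : ~ degenerate xi)
    (xi_centered : ('E_P[xi] = 0)%E)
    (delta_gt0 : 0 < delta)
    (xi_cramer : ('E_P[(fun w => expR (delta * `|xi w|))%R] < +oo)%E)
    (sigma2E : ('E_P[(fun w => xi w ^+ 2)%R] = sigma2%:E)%E)
    (xis_copies : forall k, same_law (xis k) xi)
    (xis_independent : mutually_independent xis)
    (x_gt0 : forall n, (0 < n)%N -> 0 < x n)
    (x_large : (fun n => x n / Num.sqrt n%:R) @ \oo --> +oo)
    (x_small : (fun n => x n / n%:R) @ \oo --> 0) :
  large_deviation_principle (E := Cspace (0 : R))
    (walk_law xis x) (fun n => x n ^+ 2 / n%:R) (rate_I0 sigma2).
Proof.
have s0 := nondegenerate_variance_gt0 xi_nondegenerate sigma2E.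
have [V [u0 [phi [m lxi]]]] := cramer_light_tailed delta_gt0 xi_cramer xi_centered sigma2E s0.
have lX k : light_tailed P (xis k) sigma2 V u0 phi m by exact: light_tailed_same_law lxi.
have iX := mutually_independentW xis_independent.
have v_large := speed_cvgy x_large.
split; first exact: rate_I0_good.
move=> B _; split.
  apply: limn_esup_lne_le => // s sB.
  exact: (walk_law_upper_rate iX lX s0 x_gt0 x_small (fun=> erefl) v_large).
apply: limn_einf_lne_ge => // s Bs.
have [f Bf fs] : exists2 f, interior B f & (rate_I0 sigma2 f < s%:E)%E.
  by move/ereal_inf_lt : Bs => [_ [f Bf <-] fs]; exists f.
have f0 : (0 <= rate_I0 sigma2 f)%E by exact: rate_I0_ge0.
case E : (rate_I0 sigma2 f) f0 fs => [r| |]// _; rewrite lte_fin => rs.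
by apply: (walk_law_lower_rate iX lX s0 x_gt0 x_small (fun=> erefl) v_large Bf _ rs); rewrite E.
Qed.
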